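(* Let $\omega$ satisfy the Diophantine condition: there are constants $\kappa>0$, $\tau\ge 1$ with $\inf_{p\in\mathbb{Z}}|n\omega-p|>\kappa|n|^{-\tau}$ for all $n\in\mathbb{Z}\setminus\{0\}$. Let $v:\mathbb{T}\to\mathbb{R}$ be $C^2$ with a unique minimum, which is non-degenerate. Then there is $\lambda_0=\lambda_0(\omega,v)>0$ such that for every $\lambda>\lambda_0$ the following holds, where $E_0$ denotes the lowest energy of the spectrum. For $E<E_0$ sufficiently close to $E_0$, the minimum $$\delta(E)=\min_{\theta\in\mathbb{T}}|\psi^u_E(\theta)-\psi^s_E(\theta)|$$ is attained at a unique point $\theta_c(E)\in\mathbb{T}$, and $$\delta(E)=C_1\,(E_0-E)+o(E_0-E)\qquad\text{as }E\nearrow E_0,$$ for some constant $C_1>0$ independent of $E$. Furthermore, there exist a function $\epsilon(E)>0$ with $\lim_{E\nearrow E_0}\epsilon(E)=0$ and a constant $C_2>0$ independent of $E$ such that $$\frac{1}{C_2}\Big(\frac{1}{\sqrt{\delta(E)}}\Big)^{1-\epsilon(E)}\le \|\psi^u_E\|_{C^1}\le C_2\,\frac{1}{\sqrt{\delta(E)}},$$ and the same two-sided inequality holds with $\|\psi^u_E\|_{C^1}$ replaced by $\|\psi^s_E\|_{C^1}$.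
   Context: $\mathbb{T}=\mathbb{R}/\mathbb{Z}$. For $\lambda>0$ and $E\in\mathbb{R}$ consider the quasi-periodic Schrödinger cocycle $(\theta,x)\mapsto(\theta+\omega,A_E(\theta)x)$ on $\mathbb{T}\times\mathbb{R}^2$ with $A_E(\theta)=\begin{pmatrix}0&1\\-1&\lambda^2v(\theta)-E\end{pmatrix}$. It is associated with the Schrödinger operator $(Hu)_n=-u_{n+1}-u_{n-1}+\lambda^2 v(\theta+n\omega)u_n$ on $\ell^2(\mathbb{Z})$, whose spectrum is independent of $\theta$; $E_0$ is the minimum of this spectrum. In projective coordinates, where $r\in\widehat{\mathbb{R}}=\mathbb{R}\cup\{\infty\}$ represents the direction of $(1,r)$, the cocycle induces $\Phi_E(\theta,r)=(\theta+\omega,\lambda^2v(\theta)-E-1/r)$. For $E<E_0$ the cocycle is uniformly hyperbolic, and its unstable and stable directions give continuous functions $\psi^u_E,\psi^s_E:\mathbb{T}\to\mathbb{R}$ (projective coordinates of the unstable and stable subspaces), which are invariant: $\psi(\theta+\omega)=\lambda^2v(\theta)-E-1/\psi(\theta)$, and satisfy $0<\psi^s_E<\psi^u_E$ with values in a bounded interval $[1/C,C]$. $\|\psi\|_{C^1}=\max|\psi|+\max|\psi'|$. *)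

(* Defs.v *)
From Stdlib Require Import Reals Lra ZArith.
Open Scope R_scope.

(* Diophantine condition: |n w - p| > kappa |n|^(-tau) for all n <> 0, all p
   (equivalent to the inf over p, since the inf is attained). *)
Definition diophantine (w kappa tau : R) : Prop :=
  0 < kappa /\ 1 <= tau /\
  forall n p : Z, n <> 0%Z ->
    Rabs (IZR n * w - IZR p) > kappa * Rpower (Rabs (IZR n)) (- tau).

(* v : T -> R, represented as a 1-periodic function on R. *)
Definition periodic1 (v : R -> R) : Prop := forall x, v (x + 1) = v x.

Definition C2_with (v v1 v2 : R -> R) : Prop :=
  (forall x, derivable_pt_lim v x (v1 x)) /\
  (forall x, derivable_pt_lim v1 x (v2 x)) /\ continuity v2.

Definition unique_min_mod1 (f : R -> R) (t0 : R) : Prop :=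
  (forall t, f t0 <= f t) /\
  (forall t, f t = f t0 -> exists k : Z, t = t0 + IZR k).

Definition Hop (lam w : R) (v : R -> R) (theta : R) (u : Z -> R) : Z -> R :=
  fun n => - u (n + 1)%Z - u (n - 1)%Z + lam ^ 2 * v (theta + IZR n * w) * u n.

(* partial sums of |u_n|^2 over n = -(N+1) .. N *)
Definition l2_partial (u : Z -> R) (N : nat) : R :=
  sum_f_R0 (fun k => (u (Z.of_nat k)) ^ 2 + (u (- Z.of_nat k - 1)%Z) ^ 2) N.

Definition l2sum (u : Z -> R) (S : R) : Prop := Un_cv (l2_partial u) S.
Definition in_l2 (u : Z -> R) : Prop := exists S, l2sum u S.

Definition resolvent (lam w : R) (v : R -> R) (theta E : R) : Prop :=
  exists G : (Z -> R) -> (Z -> R),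
    (forall u1 u2 a b, in_l2 u1 -> in_l2 u2 ->
       forall n, G (fun m => a * u1 m + b * u2 m) n = a * G u1 n + b * G u2 n) /\
    (exists M, forall u S, l2sum u S -> exists S', l2sum (G u) S' /\ S' <= M * S) /\
    (forall u, in_l2 u -> forall n,
        G (fun m => Hop lam w v theta u m - E * u m) n = u n) /\
    (forall u, in_l2 u -> forall n,
        Hop lam w v theta (G u) n - E * G u n = u n).

(* (real) spectrum of H_theta; it is independent of theta *)
Definition spectrum (lam w : R) (v : R -> R) (theta E : R) : Prop :=
  ~ resolvent lam w v theta E.

Definition is_min_spectrum (lam w : R) (v : R -> R) (E0 : R) : Prop :=
  spectrum lam w v 0 E0 /\ (forall E, spectrum lam w v 0 E -> E0 <= E).

Definition Amat (lam E : R) (v : R -> R) (theta : R) (x : R * R) : R * R :=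
  (snd x, - fst x + (lam ^ 2 * v theta - E) * snd x).

Definition Ainv (lam E : R) (v : R -> R) (theta : R) (x : R * R) : R * R :=
  ((lam ^ 2 * v theta - E) * fst x - snd x, fst x).

Fixpoint fwd (lam E w : R) (v : R -> R) (n : nat) (theta : R) (x : R * R) : R * R :=
  match n with
  | O => x
  | S k => Amat lam E v (theta + INR k * w) (fwd lam E w v k theta x)
  end.

Fixpoint bwd (lam E w : R) (v : R -> R) (n : nat) (theta : R) (x : R * R) : R * R :=
  match n with
  | O => x
  | S k => Ainv lam E v (theta - INR (S k) * w) (bwd lam E w v k theta x)
  end.

Definition vnorm (x : R * R) : R := sqrt (fst x ^ 2 + snd x ^ 2).

(* psi is the projective coordinate of the stable direction:
   (1, psi theta) is uniformly exponentially contracted forward. *)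
Definition is_stable_fn (lam E w : R) (v : R -> R) (psi : R -> R) : Prop :=
  exists C mu, 0 < C /\ 0 < mu /\
    forall theta n,
      vnorm (fwd lam E w v n theta (1, psi theta))
        <= C * exp (- mu * INR n) * vnorm (1, psi theta).

(* psi is the projective coordinate of the unstable direction:
   (1, psi theta) is uniformly exponentially contracted backward. *)
Definition is_unstable_fn (lam E w : R) (v : R -> R) (psi : R -> R) : Prop :=
  exists C mu, 0 < C /\ 0 < mu /\
    forall theta n,
      vnorm (bwd lam E w v n theta (1, psi theta))
        <= C * exp (- mu * INR n) * vnorm (1, psi theta).

Definition is_min_value (f : R -> R) (d : R) : Prop :=
  (exists t, f t = d) /\ (forall t, d <= f t).

Definition is_max_value (f : R -> R) (m : R) : Prop :=
  (exists t, f t = m) /\ (forall t, f t <= m).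

Definition is_C1_norm (psi : R -> R) (N : R) : Prop :=
  exists dpsi : R -> R,
    (forall x, derivable_pt_lim psi x (dpsi x)) /\ continuity dpsi /\
    exists a b, is_max_value (fun t => Rabs (psi t)) a /\
                is_max_value (fun t => Rabs (dpsi t)) b /\ N = a + b.

(* Main.v *)
Require Import Defs.
From Stdlib Require Import Reals Lra Lia ZArith ClassicalEpsilon FunctionalExtensionality.
From Coquelicot Require Import Coquelicot.
Open Scope R_scope.

(** The gap [psi^u - psi^s] at [th + w] is the reciprocal of the diagonal of the Green function, that
    is, the infimum over [u] with [u_0 = 1] of the quadratic form of [H - E] at the phase [th]; the
    minimizer [phi_th] is a product of invariant slopes on each side of 0.

    The central fact is a separation property: if the gap is minimal at [th], then a normalized
    subsolution at the phase [t] has defect at least [delta + c lam^2 |t - th|^2].  It is proved by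
    induction on dyadic scales of [|t - th|].  Separation at larger scales, together with the bound
    [c^n <= prod_(i <= n) |i w|] for Diophantine [w], makes the configurations at [th] and [t] decay
    like [(C / lam^2)^|k|]; their average is then a trial function at the midpoint phase, and the
    convexity of [v] near its minimum makes its energy fall below [delta] unless the defect is large.

    Uniqueness of the minimum is immediate.  With [phi_th] at one energy as a trial function at another,
    [delta(E) / (E0 - E)] is nondecreasing, and it is bounded because [phi_th] decays; this gives the
    asymptotics.  The [C^1] upper bound is Landau's inequality: [psi^u] is positive and its second
    derivative is bounded above by a multiple of [1 / (E0 - E)].  For the lower bound, if [psi^u] had
    Lipschitz constant [M], the solution following [psi^u] from the phase [th + s] would stay comparable
    to [phi_th] over [ln (1 / delta)] steps as long as [M s ln (1 / delta)] is small, and separation then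
    forces [s^2 <= C ln(1 / delta)^2 delta].  The stable direction is the unstable one of the
    reflected potential. *)

(** * Quadratic forms of Jacobi operators on integer windows *)

(** The obstacle is resonance: a solution need not decay where its orbit returns close to the center
    phase. Separation at coarser scales removes it: if [th] is low, a phase [th + m w] at distance
    at least the current scale is not, so configurations centered at the site [m] have defect at
    least [c1 Lam nd (m w)^2]. At scale [b] of order [2^-k] a window of length proportional to [k]
    suffices: a decay rate of at most 1/16 makes the truncation error at most [b^4], and the
    Diophantine orbit has no return closer than [2 2^-k] in that window. Configurations are
    subsolutions, not solutions, so that a window solution extended by zero qualifies and can be
    recentered at the site of its minimal defect. Passing to the midpoint phase gains a fixed
    multiple of [Lam cv b^2] at the center; the other sites lose at most [Lam b^2] times a factor
    that tends to 0 as [Lam] grows, because [rho] is of order [1 / Lam] while [Lam rho] stays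
    bounded. Hence a single threshold on [Lam] serves all scales. *)

Fixpoint zsum (p : Z) (n : nat) (f : Z -> R) : R :=
  match n with
  | O => 0
  | S k => zsum p k f + f (p + Z.of_nat k)%Z
  end.

(* The form of the operator [U - shift - shift^-1] on the restriction of [u] to
   the window [p, p+n); values of [u] outside the window cancel. *)
Definition form (U : Z -> R) (p : Z) (n : nat) (u : Z -> R) : R :=
  zsum p n (fun k => U k * u k ^ 2 - 2 * u k * u (k + 1)%Z)
  + 2 * u (p + Z.of_nat n - 1)%Z * u (p + Z.of_nat n)%Z.

Lemma zsum_ext p n f g :
  (forall k, (p <= k < p + Z.of_nat n)%Z -> f k = g k) -> zsum p n f = zsum p n g.
Proof.
  induction n as [|n IH]; simpl; intros H; auto.
  rewrite IH, H; auto; intros; try apply H; lia.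
Qed.

Lemma zsum_le p n f g :
  (forall k, (p <= k < p + Z.of_nat n)%Z -> f k <= g k) -> zsum p n f <= zsum p n g.
Proof.
  induction n as [|n IH]; intros H; cbn [zsum]; [lra|].
  apply Rplus_le_compat; [apply IH; intros; apply H; lia | apply H; lia].
Qed.

Lemma zsum_plus p n f g : zsum p n (fun k => f k + g k) = zsum p n f + zsum p n g.
Proof. induction n as [|n IH]; simpl; [lra|rewrite IH; lra]. Qed.

Lemma zsum_scal p n c f : zsum p n (fun k => c * f k) = c * zsum p n f.
Proof. induction n as [|n IH]; simpl; [lra|rewrite IH; lra]. Qed.

Lemma zsum_zero p n f :
  (forall k, (p <= k < p + Z.of_nat n)%Z -> f k = 0) -> zsum p n f = 0.
Proof.
  intros H; rewrite (zsum_ext _ _ _ (fun k => 0 * f k)), zsum_scal; [lra|].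
  intros; rewrite H; auto; lra.
Qed.

Lemma zsum_nonneg p n f :
  (forall k, (p <= k < p + Z.of_nat n)%Z -> 0 <= f k) -> 0 <= zsum p n f.
Proof.
  intros H; rewrite <- (zsum_zero p n (fun _ => 0)) by auto. apply zsum_le; auto.
Qed.

Lemma zsum_shift p n f j : zsum p n (fun k => f (k + j)%Z) = zsum (p + j) n f.
Proof.
  induction n as [|n IH]; cbn [zsum]; auto.
  rewrite IH. f_equal. f_equal. lia.
Qed.

Lemma zsum_split p n m f :
  zsum p (n + m) f = zsum p n f + zsum (p + Z.of_nat n) m f.
Proof.
  induction m as [|m IH]; cbn [zsum].
  - rewrite Nat.add_0_r; lra.
  - rewrite Nat.add_succ_r; cbn [zsum]. rewrite IH.
    replace (p + Z.of_nat (n + m))%Z with (p + Z.of_nat n + Z.of_nat m)%Z by lia. lra.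
Qed.

Lemma zsum_sub_le p n q m f :
  (forall k, 0 <= f k) -> (p <= q)%Z -> (q + Z.of_nat m <= p + Z.of_nat n)%Z ->
  zsum q m f <= zsum p n f.
Proof.
  intros Hf H1 H2.
  pose (i := Z.to_nat (q - p)). pose (j := (n - i - m)%nat).
  replace n with (i + (m + j))%nat by (unfold j, i; lia).
  rewrite !zsum_split. replace (p + Z.of_nat i)%Z with q by (unfold i; lia).
  assert (0 <= zsum p i f) by (apply zsum_nonneg; auto).
  assert (0 <= zsum (q + Z.of_nat m) j f) by (apply zsum_nonneg; auto). lra.
Qed.

Lemma zsum_single p n f j :
  (p <= j < p + Z.of_nat n)%Z ->
  (forall k, (p <= k < p + Z.of_nat n)%Z -> k <> j -> f k = 0) -> zsum p n f = f j.
Proof.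
  intros Hj H.
  pose (i := Z.to_nat (j - p)). pose (r := (n - i - 1)%nat).
  replace n with (i + (1 + r))%nat by (unfold r, i; lia).
  rewrite !zsum_split.
  rewrite (zsum_zero p i) by (intros; apply H; unfold i in *; lia).
  rewrite (zsum_zero _ r) by (intros; apply H; unfold i, r in *; lia).
  simpl. replace (p + Z.of_nat i + 0)%Z with j by (unfold i; lia). lra.
Qed.

Lemma zsum_term_le p n f j :
  (p <= j < p + Z.of_nat n)%Z ->
  (forall k, (p <= k < p + Z.of_nat n)%Z -> 0 <= f k) -> f j <= zsum p n f.
Proof.
  intros Hj H.
  pose (i := Z.to_nat (j - p)). pose (r := (n - i - 1)%nat).
  replace n with (i + (1 + r))%nat by (unfold r, i; lia).
  rewrite !zsum_split.
  assert (0 <= zsum p i f) by (apply zsum_nonneg; intros; apply H; unfold i in *; lia).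
  assert (0 <= zsum (p + Z.of_nat i + Z.of_nat 1) r f)
    by (apply zsum_nonneg; intros; apply H; unfold i, r in *; lia).
  simpl in *. replace (p + Z.of_nat i + 0)%Z with j by (unfold i; lia). lra.
Qed.

(** Summation by parts. On a solution the bulk vanishes and the form of a window reduces to the two
    boundary products; most energies are computed this way. *)
Lemma form_defect U p n u :
  form U p n u = zsum p n (fun k => u k * (U k * u k - u (k + 1)%Z - u (k - 1)%Z))
                 + u (p - 1)%Z * u p + u (p + Z.of_nat n - 1)%Z * u (p + Z.of_nat n)%Z.
Proof.
  unfold form. induction n as [|n IH]; cbn [zsum].
  - simpl Z.of_nat. rewrite Z.add_0_r. lra.
  - replace (p + Z.of_nat (S n) - 1)%Z with (p + Z.of_nat n)%Z by lia.
    replace (p + Z.of_nat (S n))%Z with (p + Z.of_nat n + 1)%Z by lia. nra.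
Qed.

(** Values outside the window cancel only if the window is nonempty: for [n = 0] the formula leaves
    [2 u (p-1) u p], hence [0 < n]. *)
Lemma form_ext U U' p n u u' :
  (forall k, (p <= k < p + Z.of_nat n)%Z -> U k = U' k /\ u k = u' k) ->
  (0 < n)%nat ->
  form U p n u = form U' p n u'.
Proof.
  intros H Hn. destruct n as [|n]; [lia|]. unfold form. cbn [zsum].
  replace (p + Z.of_nat (S n) - 1)%Z with (p + Z.of_nat n)%Z by lia.
  replace (p + Z.of_nat (S n))%Z with (p + Z.of_nat n + 1)%Z by lia.
  destruct (H (p + Z.of_nat n)%Z) as [-> ->]; [lia|].
  rewrite (zsum_ext p n _ (fun k => U' k * u' k ^ 2 - 2 * u' k * u' (k + 1)%Z)); [lra|].
  intros k Hk. destruct (H k) as [-> ->]; [lia|]. destruct (H (k + 1)%Z) as [_ ->]; [lia|]. lra.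
Qed.

Lemma form_diff U U' p n u :
  form U' p n u = form U p n u + zsum p n (fun k => (U' k - U k) * u k ^ 2).
Proof.
  unfold form.
  rewrite (zsum_ext p n (fun k => U' k * u k ^ 2 - 2 * u k * u (k + 1)%Z)
     (fun k => (U k * u k ^ 2 - 2 * u k * u (k + 1)%Z) + (U' k - U k) * u k ^ 2)).
  - rewrite zsum_plus. lra.
  - intros; ring.
Qed.

Lemma form_shift U p n u j :
  form (fun k => U (k + j)%Z) p n (fun k => u (k + j)%Z) = form U (p + j) n u.
Proof.
  unfold form.
  rewrite <- (zsum_shift p n (fun k => U k * u k ^ 2 - 2 * u k * u (k + 1)%Z) j).
  f_equal.
  - apply zsum_ext. intros. replace (k + 1 + j)%Z with (k + j + 1)%Z by lia. reflexivity.
  - f_equal; [f_equal|]; f_equal; lia.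
Qed.

(* Ground state substitution (Barta's inequality). *)
Lemma barta U w c u p n : (0 < n)%nat ->
  (forall k, (p <= k < p + Z.of_nat n)%Z -> 0 < w k) ->
  0 <= w (p - 1)%Z -> 0 <= w (p + Z.of_nat n)%Z ->
  (forall k, (p <= k < p + Z.of_nat n)%Z ->
     c k * w k <= U k * w k - w (k + 1)%Z - w (k - 1)%Z) ->
  zsum p n (fun k => c k * u k ^ 2) <= form U p n u.
Proof.
  intros Hn Hw Hl Hr Hc.
  assert (Hterm : forall k, (p <= k < p + Z.of_nat n)%Z ->
     c k * u k ^ 2 + w (k + 1)%Z / w k * u k ^ 2 + w (k - 1)%Z / w k * u k ^ 2 <= U k * u k ^ 2).
  { intros k Hk. specialize (Hw k Hk); specialize (Hc k Hk).
    assert (0 <= u k ^ 2) by nra.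
    replace (c k * u k ^ 2 + w (k + 1)%Z / w k * u k ^ 2 + w (k - 1)%Z / w k * u k ^ 2)
      with ((c k * w k + w (k + 1)%Z + w (k - 1)%Z) / w k * u k ^ 2) by (field; lra).
    apply Rmult_le_compat_r; auto. apply (Rmult_le_reg_r (w k)); auto.
    unfold Rdiv. rewrite Rmult_assoc, Rinv_l by lra. lra. }
  (* The partial sums carry the surplus [w (k+1) / w k * u k ^ 2], which completes a square with the
     cross term and the term [w k / w (k+1) * u (k+1) ^ 2] of the next site. *)
  assert (Hpart : forall m, (m < n)%nat -> let k := (p + Z.of_nat m)%Z in
     zsum p (S m) (fun k => c k * u k ^ 2) + w (k + 1)%Z / w k * u k ^ 2 - 2 * u k * u (k + 1)%Z
     <= zsum p (S m) (fun k => U k * u k ^ 2 - 2 * u k * u (k + 1)%Z)).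
  { induction m as [|m IH]; intros Hm k; subst k.
    - cbn [zsum]. simpl Z.of_nat. rewrite !Z.add_0_r.
      assert (H := Hterm p ltac:(lia)). assert (Hp := Hw p ltac:(lia)).
      assert (0 <= w (p - 1)%Z / w p * u p ^ 2).
      { apply Rmult_le_pos; [|nra]. apply Rdiv_le_0_compat; auto. }
      lra.
    - specialize (IH ltac:(lia)). cbn zeta in IH.
      change (zsum p (S (S m))) with (fun f => zsum p (S m) f + f (p + Z.of_nat (S m))%Z).
      cbv beta.
      set (k := (p + Z.of_nat (S m))%Z). fold k in IH.
      replace (p + Z.of_nat m)%Z with (k - 1)%Z in IH by (unfold k; lia).
      replace (k - 1 + 1)%Z with k in IH by lia.
      assert (H := Hterm k ltac:(unfold k; lia)). assert (Hk := Hw k ltac:(unfold k; lia)).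
      assert (Hk1 := Hw (k - 1)%Z ltac:(unfold k; lia)).
      assert (Hsq : 0 <= w k / w (k - 1)%Z * u (k - 1)%Z ^ 2 - 2 * u (k - 1)%Z * u k
                    + w (k - 1)%Z / w k * u k ^ 2).
      { replace (w k / w (k - 1)%Z * u (k - 1)%Z ^ 2 - 2 * u (k - 1)%Z * u k
                    + w (k - 1)%Z / w k * u k ^ 2)
          with (w k * w (k - 1)%Z * (u (k - 1)%Z / w (k - 1)%Z - u k / w k) ^ 2)
          by (field; lra).
        apply Rmult_le_pos; [nra|apply pow2_ge_0]. }
      lra. }
  destruct n as [|n]; [lia|].
  specialize (Hpart n ltac:(lia)). cbn zeta in Hpart. unfold form.
  replace (p + Z.of_nat (S n) - 1)%Z with (p + Z.of_nat n)%Z by lia.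
  replace (p + Z.of_nat (S n))%Z with (p + Z.of_nat n + 1)%Z in * by lia.
  assert (0 <= w (p + Z.of_nat n + 1)%Z / w (p + Z.of_nat n)%Z * u (p + Z.of_nat n)%Z ^ 2).
  { apply Rmult_le_pos; [|nra]. apply Rdiv_le_0_compat; auto. apply Hw; lia. }
  lra.
Qed.

(** * Dirichlet solutions and determinants of windows *)

(** The pair holds the entries of the solution at the sites [p + n] and [p + n - 1]. *)
Fixpoint ivp (U : Z -> R) (p : Z) (n : nat) : R * R :=
  match n with
  | O => (1, 0)
  | S k => (U (p + Z.of_nat k)%Z * fst (ivp U p k) - snd (ivp U p k), fst (ivp U p k))
  end.

(** Cut to 0 to the left of [p] rather than continued as a solution, so that solutions glued from
    these pieces vanish outside their window. *)
Definition lsol (U : Z -> R) (p k : Z) : R :=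
  if Z_lt_dec k p then 0 else fst (ivp U p (Z.to_nat (k - p))).

Definition refl (U : Z -> R) (k : Z) : R := U (- k)%Z.

Definition rsol (U : Z -> R) (q k : Z) : R := lsol (refl U) (- q) (- k).

(* Determinant of the window [p, q] (equal to 1 for q = p - 1). *)
Definition wdet (U : Z -> R) (p q : Z) : R := lsol U p (q + 1).

Lemma lsol_lt U p k : (k < p)%Z -> lsol U p k = 0.
Proof. intros; unfold lsol; destruct (Z_lt_dec k p); auto; lia. Qed.

Lemma lsol_start U p : lsol U p p = 1.
Proof. unfold lsol; destruct (Z_lt_dec p p); [lia|]. rewrite Z.sub_diag; reflexivity. Qed.

Lemma lsol_rec U p k : (p <= k)%Z -> lsol U p (k + 1) = U k * lsol U p k - lsol U p (k - 1).
Proof.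
  intros H. unfold lsol.
  destruct (Z_lt_dec (k + 1) p); [lia|]. destruct (Z_lt_dec k p); [lia|].
  replace (Z.to_nat (k + 1 - p)) with (S (Z.to_nat (k - p))) by lia. cbn [ivp fst].
  replace (p + Z.of_nat (Z.to_nat (k - p)))%Z with k by lia.
  f_equal. f_equal.
  destruct (Z_lt_dec (k - 1) p).
  - replace (Z.to_nat (k - p)) with 0%nat by lia. reflexivity.
  - replace (Z.to_nat (k - p)) with (S (Z.to_nat (k - 1 - p))) by lia. reflexivity.
Qed.

Lemma rsol_gt U q k : (q < k)%Z -> rsol U q k = 0.
Proof. intros; apply lsol_lt; lia. Qed.

Lemma rsol_start U q : rsol U q q = 1.
Proof. apply lsol_start. Qed.

Lemma rsol_rec U q k : (k <= q)%Z -> rsol U q (k - 1) = U k * rsol U q k - rsol U q (k + 1).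
Proof.
  intros H. unfold rsol. replace (- (k - 1))%Z with (- k + 1)%Z by lia.
  rewrite lsol_rec by lia. unfold refl at 1. replace (- - k)%Z with k by lia.
  replace (- k - 1)%Z with (- (k + 1))%Z by lia. reflexivity.
Qed.

(** The Wronskian of the two Dirichlet solutions is constant on the window; at [k = q] the right one
    takes the values 1 and 0, which leaves [lsol] at [q + 1]. *)
Lemma wronskian_lsol_rsol U p q k : (p - 1 <= k <= q)%Z ->
  lsol U p (k + 1) * rsol U q k - lsol U p k * rsol U q (k + 1) = wdet U p q.
Proof.
  intros H. replace k with (q - Z.of_nat (Z.to_nat (q - k)))%Z by lia.
  assert (Hn : (Z.of_nat (Z.to_nat (q - k)) <= q - p + 1)%Z) by lia.
  induction (Z.to_nat (q - k)) as [|n IH].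
  - simpl Z.of_nat. rewrite Z.sub_0_r, rsol_start, rsol_gt by lia. unfold wdet. lra.
  - specialize (IH ltac:(lia)).
    set (j := (q - Z.of_nat n)%Z) in *.
    replace (q - Z.of_nat (S n))%Z with (j - 1)%Z by (unfold j; lia).
    replace (j - 1 + 1)%Z with j by lia.
    rewrite lsol_rec in IH by (unfold j; lia). rewrite rsol_rec by (unfold j; lia). lra.
Qed.

Lemma wdet_empty U p : wdet U p (p - 1) = 1.
Proof. unfold wdet. replace (p - 1 + 1)%Z with p by lia. apply lsol_start. Qed.

Lemma lsol_wdet U p k : lsol U p k = wdet U p (k - 1).
Proof. unfold wdet. f_equal. lia. Qed.

Lemma rsol_wdet U q k : (k <= q)%Z -> rsol U q k = wdet U (k + 1) q.
Proof.
  intros H. rewrite <- (wronskian_lsol_rsol U (k + 1) q k) by lia.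
  rewrite lsol_start, lsol_lt by lia. lra.
Qed.

Definition pos_form (U : Z -> R) : Prop :=
  exists e, 0 < e /\ forall p n u, (0 < n)%nat -> e * zsum p n (fun k => u k ^ 2) <= form U p n u.

(** Tested with [lsol] itself, the form of a window ending at [k] reduces to the boundary product of
    [lsol] at [k] and [k + 1], which must then be positive. *)
Lemma lsol_pos U p k : pos_form U -> (p <= k)%Z -> 0 < lsol U p k.
Proof.
  intros [e [He HU]] Hk. replace k with (p + Z.of_nat (Z.to_nat (k - p)))%Z by lia.
  induction (Z.to_nat (k - p)) as [|n IH].
  - simpl Z.of_nat. rewrite Z.add_0_r, lsol_start; lra.
  - specialize (HU p (S n) (lsol U p) ltac:(lia)).
    rewrite form_defect in HU.
    rewrite (zsum_zero p (S n) (fun k => lsol U p k * _)) in HU.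
    2:{ intros j Hj. rewrite lsol_rec by lia. ring. }
    rewrite lsol_lt with (k := (p - 1)%Z) in HU by lia.
    replace (p + Z.of_nat (S n) - 1)%Z with (p + Z.of_nat n)%Z in HU by lia.
    assert (lsol U p (p + Z.of_nat n) ^ 2 <= zsum p (S n) (fun k => lsol U p k ^ 2)).
    { apply (zsum_term_le p (S n) (fun k => lsol U p k ^ 2)); [lia|]. intros; apply pow2_ge_0. }
    assert (0 < lsol U p (p + Z.of_nat n) ^ 2) by (apply pow_lt; auto).
    assert (0 < e * zsum p (S n) (fun k => lsol U p k ^ 2)) by (apply Rmult_lt_0_compat; lra).
    apply (Rmult_lt_reg_l (lsol U p (p + Z.of_nat n))); auto. lra.
Qed.

Lemma wdet_pos U p q : pos_form U -> (p - 1 <= q)%Z -> 0 < wdet U p q.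
Proof. intros; apply lsol_pos; auto; lia. Qed.

Lemma rsol_pos U q k : pos_form U -> (k <= q)%Z -> 0 < rsol U q k.
Proof. intros; rewrite rsol_wdet by auto; apply wdet_pos; auto; lia. Qed.

(** * Configurations *)

(* A configuration is a normalized bounded subsolution centered at the site 0;
   [defect] is the amount by which it fails to be a solution there. *)
Definition cfg (U u : Z -> R) : Prop :=
  (forall k, 0 <= u k <= 1) /\ u 0%Z = 1 /\
  forall k, k <> 0%Z -> U k * u k <= u (k + 1)%Z + u (k - 1)%Z.

Definition defect (U u : Z -> R) : R := U 0%Z - u 1%Z - u (-1)%Z.

(** Column [m] of the inverse of the window matrix, divided by its diagonal entry. *)
Definition wsol (U : Z -> R) (p q m k : Z) : R :=
  if Z_le_dec k m then lsol U p k / lsol U p m else rsol U q k / rsol U q m.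

(** Reciprocal of the diagonal entry at [m] of the inverse of the window matrix, by Cramer's rule:
    [lsol U p m] and [rsol U q m] are the determinants of the parts of the window left and right of
    [m]. *)
Definition wdefect (U : Z -> R) (p q m : Z) : R := wdet U p q / (lsol U p m * rsol U q m).

Lemma wsol_r U p q m k : pos_form U -> (p <= m <= q)%Z -> (m <= k)%Z ->
  wsol U p q m k = rsol U q k / rsol U q m.
Proof.
  intros HU Hm Hk. unfold wsol. destruct (Z_le_dec k m); auto.
  replace k with m by lia.
  assert (0 < lsol U p m) by (apply lsol_pos; auto; lia).
  assert (0 < rsol U q m) by (apply rsol_pos; auto; lia). field; lra.
Qed.

Lemma wsol_l U p q m k : (k <= m)%Z -> wsol U p q m k = lsol U p k / lsol U p m.
Proof. intros. unfold wsol. destruct (Z_le_dec k m); auto; lia. Qed.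

Lemma wsol_center U p q m : pos_form U -> (p <= m)%Z -> wsol U p q m m = 1.
Proof.
  intros HU H. rewrite wsol_l by lia. assert (0 < lsol U p m) by (apply lsol_pos; auto; lia).
  field; lra.
Qed.

Lemma wsol_pos U p q m k : pos_form U -> (p <= m <= q)%Z -> (p <= k <= q)%Z ->
  0 < wsol U p q m k.
Proof.
  intros HU Hm Hk.
  assert (0 < lsol U p m) by (apply lsol_pos; auto; lia).
  assert (0 < rsol U q m) by (apply rsol_pos; auto; lia).
  assert (0 < lsol U p k) by (apply lsol_pos; auto; lia).
  assert (0 < rsol U q k) by (apply rsol_pos; auto; lia).
  unfold wsol. destruct (Z_le_dec k m); apply Rdiv_lt_0_compat; auto.
Qed.

Lemma wsol_out U p q m k : (p <= m <= q)%Z -> (k < p \/ q < k)%Z -> wsol U p q m k = 0.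
Proof.
  intros Hm Hk. unfold wsol. destruct (Z_le_dec k m).
  - rewrite lsol_lt by lia. unfold Rdiv; lra.
  - rewrite rsol_gt by lia. unfold Rdiv; lra.
Qed.

Lemma wsol_eq U p q m k : pos_form U -> (p <= m <= q)%Z -> (p <= k <= q)%Z -> k <> m ->
  U k * wsol U p q m k = wsol U p q m (k + 1) + wsol U p q m (k - 1).
Proof.
  intros HU Hm Hk Hkm.
  assert (0 < lsol U p m) by (apply lsol_pos; auto; lia).
  assert (0 < rsol U q m) by (apply rsol_pos; auto; lia).
  destruct (Z_le_dec k m).
  - rewrite !wsol_l by lia. rewrite lsol_rec by lia. field; lra.
  - rewrite !wsol_r by (auto; lia). rewrite rsol_rec by lia. field; lra.
Qed.

Lemma wdefect_eq U p q m : pos_form U -> (p <= m <= q)%Z ->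
  U m - wsol U p q m (m + 1) - wsol U p q m (m - 1) = wdefect U p q m.
Proof.
  intros HU Hm.
  assert (0 < lsol U p m) by (apply lsol_pos; auto; lia).
  assert (0 < rsol U q m) by (apply rsol_pos; auto; lia).
  unfold wdefect. rewrite <- (wronskian_lsol_rsol U p q m) by lia.
  rewrite lsol_rec, wsol_r, wsol_l by (auto; lia). field; lra.
Qed.

Lemma wdefect_split U p q m : (p <= m <= q)%Z -> pos_form U ->
  wdet U p q = wdefect U p q m * (wdet U p (m - 1) * wdet U (m + 1) q).
Proof.
  intros Hm HU. unfold wdefect. rewrite <- rsol_wdet, <- lsol_wdet by lia.
  assert (0 < lsol U p m) by (apply lsol_pos; auto; lia).
  assert (0 < rsol U q m) by (apply rsol_pos; auto; lia). field; lra.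
Qed.

Lemma wform U p q m : pos_form U -> (p <= m <= q)%Z ->
  form U p (Z.to_nat (q - p + 1)) (wsol U p q m) = wdefect U p q m.
Proof.
  intros HU Hm. rewrite form_defect.
  rewrite (wsol_out U p q m (p - 1)) by lia.
  rewrite (wsol_out U p q m (p + Z.of_nat (Z.to_nat (q - p + 1)))) by lia.
  rewrite (zsum_single _ _ _ m).
  - rewrite <- (wdefect_eq U p q m), wsol_center by (auto; lia). lra.
  - lia.
  - intros k Hk Hkm. rewrite (wsol_eq U p q m k) by (auto; lia). ring.
Qed.

(** Barta's inequality with ground state [wsol] and a weight concentrated at [m]. With [wform] it
    identifies [wdefect] as the minimum of the form under the constraint [u m = 1]. *)
Lemma wdefect_form U p q m u : pos_form U -> (p <= m <= q)%Z ->
  wdefect U p q m * u m ^ 2 <= form U p (Z.to_nat (q - p + 1)) u.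
Proof.
  intros HU Hm.
  assert (H := barta U (wsol U p q m) (fun k => if Z.eq_dec k m then wdefect U p q m else 0) u
     p (Z.to_nat (q - p + 1)) ltac:(lia)).
  rewrite (zsum_single _ _ _ m) in H; [| lia |].
  2:{ intros k _ Hk. destruct (Z.eq_dec k m); [easy|ring]. }
  destruct (Z.eq_dec m m); [|easy]. apply H; clear H.
  - intros; apply wsol_pos; auto; lia.
  - rewrite wsol_out by lia; lra.
  - rewrite wsol_out by lia; lra.
  - intros k Hk. destruct (Z.eq_dec k m) as [->|Hkm].
    + rewrite <- wdefect_eq, wsol_center by (auto; lia). lra.
    + rewrite (wsol_eq U p q m k) by (auto; lia). lra.
Qed.

Lemma finite_argmin (f : Z -> R) p q : (p <= q)%Z ->
  exists m, (p <= m <= q)%Z /\ forall k, (p <= k <= q)%Z -> f m <= f k.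
Proof.
  intros H. replace q with (p + Z.of_nat (Z.to_nat (q - p)))%Z by lia.
  induction (Z.to_nat (q - p)) as [|n [m [Hm Hmin]]].
  - exists p. split; [lia|]. intros k Hk. replace k with p by lia. lra.
  - destruct (Rle_dec (f m) (f (p + Z.of_nat (S n))%Z)) as [Hle|Hgt].
    + exists m. split; [lia|]. intros k Hk.
      destruct (Z.eq_dec k (p + Z.of_nat (S n))) as [->|]; auto. apply Hmin; lia.
    + exists (p + Z.of_nat (S n))%Z. split; [lia|]. intros k Hk.
      destruct (Z.eq_dec k (p + Z.of_nat (S n))) as [->|]; [lra|].
      specialize (Hmin k ltac:(lia)). lra.
Qed.

(* At a site of minimal defect the Dirichlet solution is bounded by 1: test the
   form bound at the site j with the solution centered at m. *)
Lemma wsol_cfg U p q m : pos_form U -> (p <= m <= q)%Z ->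
  (forall k, (p <= k <= q)%Z -> wdefect U p q m <= wdefect U p q k) ->
  cfg (fun k => U (k + m)%Z) (fun k => wsol U p q m (k + m)) /\
  defect (fun k => U (k + m)%Z) (fun k => wsol U p q m (k + m)) = wdefect U p q m.
Proof.
  intros HU Hm Hmin.
  assert (Hwp : forall j, (p <= j <= q)%Z -> 0 < wdefect U p q j).
  { intros j Hj. unfold wdefect. apply Rdiv_lt_0_compat; [apply wdet_pos; auto; lia|].
    apply Rmult_lt_0_compat; [apply lsol_pos|apply rsol_pos]; auto; lia. }
  split.
  - split; [|split].
    + intros k. destruct (Z_le_dec p (k + m)); [destruct (Z_le_dec (k + m) q)|].
      * assert (0 < wsol U p q m (k + m)) by (apply wsol_pos; auto; lia).
        split; [lra|].
        assert (H1 := wdefect_form U p q (k + m) (wsol U p q m) HU ltac:(lia)).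
        rewrite wform in H1 by auto.
        specialize (Hmin (k + m)%Z ltac:(lia)). specialize (Hwp m Hm).
        apply Rnot_lt_le; intros Hlt.
        assert (1 < wsol U p q m (k + m) ^ 2) by nra.
        assert (wdefect U p q m * 1 < wdefect U p q m * wsol U p q m (k + m) ^ 2)
          by (apply Rmult_lt_compat_l; lra).
        assert (wdefect U p q m * wsol U p q m (k + m) ^ 2
                <= wdefect U p q (k + m) * wsol U p q m (k + m) ^ 2)
          by (apply Rmult_le_compat_r; lra).
        lra.
      * rewrite wsol_out by lia; lra.
      * rewrite wsol_out by lia; lra.
    + rewrite Z.add_0_l. apply wsol_center; auto; lia.
    + intros k Hk.
      assert (Hnn : forall j, 0 <= wsol U p q m j).
      { intros j. destruct (Z_le_dec p j); [destruct (Z_le_dec j q)|].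
        - apply Rlt_le, wsol_pos; auto; lia.
        - rewrite wsol_out by lia; lra.
        - rewrite wsol_out by lia; lra. }
      replace (k + 1 + m)%Z with (k + m + 1)%Z by lia.
      replace (k - 1 + m)%Z with (k + m - 1)%Z by lia.
      destruct (Z_le_dec p (k + m)); [destruct (Z_le_dec (k + m) q)|].
      * apply Req_le, wsol_eq; auto; lia.
      * rewrite wsol_out by lia. generalize (Hnn (k + m + 1)%Z) (Hnn (k + m - 1)%Z); lra.
      * rewrite wsol_out by lia. generalize (Hnn (k + m + 1)%Z) (Hnn (k + m - 1)%Z); lra.
  - unfold defect. rewrite <- (wdefect_eq U p q m) by auto.
    replace (0 + m)%Z with m by lia. replace (1 + m)%Z with (m + 1)%Z by lia.
    replace (-1 + m)%Z with (m - 1)%Z by lia. reflexivity.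
Qed.

(** The Wronskians of a subsolution with [lsol] and [rsol] are monotone along the window, which
    bounds the first from the left end and the second from the right end. Eliminating [u (j+1)]
    between the two bounds leaves the Wronskian of [lsol] and [rsol], that is [wdet], in front of
    [u j]. *)
Lemma subsolution_bound U u p q j : pos_form U -> (p <= j <= q)%Z ->
  (forall k, 0 <= u k) ->
  (forall k, (p <= k <= q)%Z -> U k * u k <= u (k + 1)%Z + u (k - 1)%Z) ->
  u j * wdet U p q <= wdet U (j + 1) q * u (p - 1)%Z + wdet U p (j - 1) * u (q + 1)%Z.
Proof.
  intros HU Hj Hu Hsub.
  rewrite <- rsol_wdet, <- lsol_wdet by lia.
  rewrite <- (wronskian_lsol_rsol U p q j) by lia.
  set (L := lsol U p). set (T := rsol U q).
  assert (HL : forall k, (p <= k)%Z -> 0 < L k) by (intros; apply lsol_pos; auto).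
  assert (HT : forall k, (k <= q)%Z -> 0 < T k) by (intros; apply rsol_pos; auto).
  assert (H1 : - u (p - 1)%Z <= L j * u (j + 1)%Z - L (j + 1)%Z * u j).
  { replace j with (p - 1 + Z.of_nat (Z.to_nat (j - p + 1)))%Z at 1 2 3 4 by lia.
    assert (Hn : (Z.of_nat (Z.to_nat (j - p + 1)) <= q - p + 1)%Z) by lia.
    induction (Z.to_nat (j - p + 1)) as [|n IH].
    - simpl Z.of_nat. rewrite Z.add_0_r. replace (p - 1 + 1)%Z with p by lia.
      unfold L. rewrite lsol_lt, lsol_start by lia. lra.
    - specialize (IH ltac:(lia)).
      set (k := (p - 1 + Z.of_nat n + 1)%Z) in *.
      replace (p - 1 + Z.of_nat (S n))%Z with k by (unfold k; lia).
      replace (p - 1 + Z.of_nat n)%Z with (k - 1)%Z in IH by (unfold k; lia).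
      unfold L at 2. rewrite lsol_rec by (unfold k; lia). fold L.
      specialize (Hsub k ltac:(unfold k; lia)). specialize (HL k ltac:(unfold k; lia)).
      nra. }
  assert (H2 : T j * u (j + 1)%Z - T (j + 1)%Z * u j <= u (q + 1)%Z).
  { replace j with (q - Z.of_nat (Z.to_nat (q - j)))%Z at 1 2 3 4 by lia.
    assert (Hn : (Z.of_nat (Z.to_nat (q - j)) <= q - p)%Z) by lia.
    induction (Z.to_nat (q - j)) as [|n IH].
    - simpl Z.of_nat. rewrite Z.sub_0_r. unfold T. rewrite rsol_start, rsol_gt by lia. lra.
    - specialize (IH ltac:(lia)).
      set (k := (q - Z.of_nat n)%Z) in *.
      replace (q - Z.of_nat (S n))%Z with (k - 1)%Z by (unfold k; lia).
      replace (k - 1 + 1)%Z with k by lia.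
      unfold T at 1. rewrite rsol_rec by (unfold k; lia). fold T.
      specialize (Hsub k ltac:(unfold k; lia)). specialize (HT k ltac:(unfold k; lia)).
      nra. }
  specialize (HL j ltac:(lia)). specialize (HT j ltac:(lia)).
  assert (L j * (T j * u (j + 1)%Z - T (j + 1)%Z * u j) <= L j * u (q + 1)%Z)
    by (apply Rmult_le_compat_l; lra).
  assert (T j * (L (j + 1)%Z * u j - L j * u (j + 1)%Z) <= T j * u (p - 1)%Z)
    by (apply Rmult_le_compat_l; lra).
  lra.
Qed.

(** * Distance to the nearest integer *)

(** [up (x - / 2)] is the integer in the interval from [x - 1/2] (excluded) to [x + 1/2]
    (included). *)
Definition nd (x : R) : R := Rabs (x - IZR (up (x - / 2))).

Lemma nd_half x : nd x <= / 2.
Proof.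
  unfold nd. destruct (archimed (x - / 2)) as [H1 H2]. apply Rabs_le; lra.
Qed.

Lemma nd_pos x : 0 <= nd x.
Proof. apply Rabs_pos. Qed.

Lemma nd_le x k : nd x <= Rabs (x - IZR k).
Proof.
  destruct (Z.eq_dec k (up (x - / 2))) as [->|Hk]; [unfold nd; lra|].
  assert (Hx := nd_half x). unfold nd in *. set (j := up (x - / 2)) in *.
  assert (Hd : 1 <= Rabs (IZR k - IZR j)).
  { rewrite <- minus_IZR, <- abs_IZR. apply IZR_le. lia. }
  assert (Rabs (IZR k - IZR j) <= Rabs (x - IZR j) + Rabs (x - IZR k)).
  { replace (IZR k - IZR j) with ((x - IZR j) - (x - IZR k)) by ring.
    eapply Rle_trans; [apply Rabs_triang|]. rewrite Rabs_Ropp. lra. }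
  lra.
Qed.

Lemma nd_rep x : exists k, Rabs (x - IZR k) = nd x.
Proof. exists (up (x - / 2)). reflexivity. Qed.

Lemma nd_triang x y : nd (x + y) <= nd x + nd y.
Proof.
  destruct (nd_rep x) as [i <-], (nd_rep y) as [j <-].
  eapply Rle_trans; [apply (nd_le _ (i + j))|].
  rewrite plus_IZR. replace (x + y - (IZR i + IZR j)) with ((x - IZR i) + (y - IZR j)) by ring.
  apply Rabs_triang.
Qed.

Lemma nd_opp_le x : nd (- x) <= nd x.
Proof.
  destruct (nd_rep x) as [i <-]. eapply Rle_trans; [apply (nd_le _ (- i))|].
  rewrite opp_IZR, <- Rabs_Ropp. right. f_equal. ring.
Qed.

Lemma nd_opp x : nd (- x) = nd x.
Proof.
  apply Rle_antisym; [apply nd_opp_le|]. rewrite <- (Ropp_involutive x) at 1. apply nd_opp_le.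
Qed.

Lemma nd_le_abs x : nd x <= Rabs x.
Proof. generalize (nd_le x 0). rewrite Rminus_0_r. auto. Qed.

Lemma nd_small x : Rabs x <= / 2 -> nd x = Rabs x.
Proof.
  intros H. apply Rle_antisym; [apply nd_le_abs|].
  destruct (nd_rep x) as [k Hk]. rewrite <- Hk.
  destruct (Z.eq_dec k 0) as [->|Hk0]; [rewrite Rminus_0_r; lra|].
  assert (1 <= Rabs (IZR k)) by (rewrite <- abs_IZR; apply IZR_le; lia).
  assert (Rabs (IZR k) <= Rabs x + Rabs (x - IZR k)).
  { replace (IZR k) with (x - (x - IZR k)) at 1 by ring.
    eapply Rle_trans; [apply Rabs_triang|]. rewrite Rabs_Ropp. lra. }
  lra.
Qed.

Lemma dioph_nd w kappa tau : diophantine w kappa tau ->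
  forall m, m <> 0%Z -> kappa * Rpower (Rabs (IZR m)) (- tau) < nd (IZR m * w).
Proof.
  intros [Hk [Ht H]] m Hm. destruct (nd_rep (IZR m * w)) as [k <-]. apply Rlt_gt, H; auto.
Qed.

Lemma dioph_nd_pos w kappa tau : diophantine w kappa tau ->
  forall m, m <> 0%Z -> 0 < nd (IZR m * w).
Proof.
  intros H m Hm. eapply Rlt_trans; [|apply (dioph_nd w kappa tau H m Hm)].
  apply Rmult_lt_0_compat; [apply H|apply exp_pos].
Qed.

(** * Products of small divisors *)

Fixpoint rprod (f : nat -> R) (n : nat) : R :=
  match n with O => 1 | S k => rprod f k * f (S k) end.

Fixpoint rsum (f : nat -> R) (n : nat) : R :=
  match n with O => 0 | S k => rsum f k + f (S k) end.

(** Elements of [A] are at least [g] apart, and the first is at least [g] away from 0, so the last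
    one up to [n] is at least [g] times their number. The induction carries this last element. *)
Lemma separated_count (A : nat -> Prop) (ind : nat -> R) (g : R) :
  (forall i, A i -> ind i = 1) -> (forall i, ~ A i -> ind i = 0) ->
  (forall i, (1 <= i)%nat -> A i -> g <= INR i) ->
  (forall i j, (1 <= i < j)%nat -> A i -> A j -> g <= INR j - INR i) ->
  forall n, rsum ind n * g <= INR n.
Proof.
  intros H1 H0 Hg Hgg n.
  enough (exists l, (l <= n)%nat /\ (l = 0%nat \/ (1 <= l)%nat /\ A l) /\ rsum ind n * g <= INR l)
    as [l [Hl [_ H]]] by (apply le_INR in Hl; lra).
  induction n as [|n [l [Hl [HA H]]]]; simpl rsum.
  - exists 0%nat. split; [lia|]. split; auto. simpl; lra.
  - destruct (classic (A (S n))) as [Hn|Hn].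
    + exists (S n). split; [lia|]. split; [right; split; [lia|auto]|].
      rewrite (H1 _ Hn). destruct HA as [->|[Hl1 HA]].
      * simpl INR in H. specialize (Hg (S n) ltac:(lia) Hn). lra.
      * specialize (Hgg l (S n) ltac:(lia) HA Hn). lra.
    + exists l. split; [lia|]. split; auto. rewrite (H0 _ Hn). lra.
Qed.

Lemma rsum_scal c f n : rsum (fun i => c * f i) n = c * rsum f n.
Proof. induction n; simpl; [lra|rewrite IHn; lra]. Qed.

Lemma rsum_le f g n : (forall i, (1 <= i <= n)%nat -> f i <= g i) -> rsum f n <= rsum g n.
Proof.
  induction n; simpl rsum; intros H; [lra|].
  apply Rplus_le_compat; [apply IHn; intros; apply H; lia|apply H; lia].
Qed.

Lemma rsum_minus f g n : rsum (fun i => f i - g i) n = rsum f n - rsum g n.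
Proof. induction n; simpl; [lra|rewrite IHn; lra]. Qed.

Lemma exp_rsum_ln f n : (forall i, (1 <= i)%nat -> 0 < f i) ->
  exp (rsum (fun i => ln (f i)) n) = rprod f n.
Proof.
  intros H; induction n; simpl; [apply exp_0|].
  rewrite exp_plus, IHn, exp_ln; auto. apply H; lia.
Qed.

Lemma rpow_half_pos m : 0 < (/ 2) ^ m.
Proof. apply pow_lt; lra. Qed.

(* Dyadic counting: the times i <= n with nd (i w) < 2^-m are separated by
   (kappa 2^(m-1))^(1/tau), so the average of -ln nd (i w) is bounded. *)
Lemma small_divisor_product w kappa tau : diophantine w kappa tau ->
  exists cw, 0 < cw <= 1 /\ forall n, cw ^ n <= rprod (fun i => nd (INR i * w)) n.
Proof.
  intros Hd. destruct Hd as [Hk [Ht Hdd]] eqn:E. clear E.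
  set (s := fun i : nat => nd (INR i * w)).
  assert (Hsd : forall i, (1 <= i)%nat -> kappa * Rpower (INR i) (- tau) < s i).
  { intros i Hi. assert (H := dioph_nd w kappa tau Hd (Z.of_nat i) ltac:(lia)).
    rewrite <- INR_IZR_INZ in H. rewrite Rabs_pos_eq in H by apply pos_INR. exact H. }
  assert (Hsp : forall i, (1 <= i)%nat -> 0 < s i).
  { intros i Hi. eapply Rlt_trans; [|apply Hsd; auto]. apply Rmult_lt_0_compat; auto. apply exp_pos. }
  set (g := fun m : nat => exp ((ln kappa - ln 2 + INR m * ln 2) / tau)).
  assert (Hln2 : 0 < ln 2) by (rewrite <- ln_1; apply ln_increasing; lra).
  (* Stated with [2 * 2^-m] so that it also applies to the difference of two times whose divisors
     are below [2^-m]. *)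
  assert (Hg : forall m i, (1 <= i)%nat -> s i < 2 * (/ 2) ^ m -> g m <= INR i).
  { intros m i Hi H. specialize (Hsd i Hi).
    assert (Hi0 : 0 < INR i) by (apply lt_0_INR; lia).
    assert (Hlt : kappa * Rpower (INR i) (- tau) < 2 * (/ 2) ^ m) by lra.
    apply ln_increasing in Hlt; [|apply Rmult_lt_0_compat; auto; apply exp_pos].
    rewrite ln_mult in Hlt by (auto; apply exp_pos).
    rewrite ln_mult in Hlt by (try lra; apply rpow_half_pos).
    unfold Rpower in Hlt. rewrite ln_exp in Hlt.
    rewrite ln_pow in Hlt by lra. rewrite ln_Rinv in Hlt by lra.
    unfold g. rewrite <- (exp_ln (INR i)) by auto. left. apply exp_increasing.
    apply (Rmult_lt_reg_r tau); [lra|]. unfold Rdiv. rewrite Rmult_assoc, Rinv_l by lra. lra. }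
  set (K := exp (- (ln kappa - ln 2) / tau)).
  set (r := exp (- ln 2 / tau)).
  assert (Hr : 0 < r < 1).
  { split; [apply exp_pos|]. unfold r. rewrite <- exp_0. apply exp_increasing.
    assert (0 < ln 2 / tau) by (apply Rdiv_lt_0_compat; lra). lra. }
  assert (Hginv : forall m, g m * (K * r ^ m) = 1).
  { intros m. unfold g, K, r. rewrite <- exp_0.
    replace (exp (- ln 2 / tau) ^ m) with (exp (INR m * (- ln 2 / tau))).
    - rewrite <- !exp_plus. f_equal. field. lra.
    - rewrite <- (Rpower_pow m) by apply exp_pos. unfold Rpower. rewrite ln_exp. reflexivity. }
  set (ind := fun (m i : nat) => if Rlt_dec (s i) ((/ 2) ^ m) then 1 else 0).
  assert (Hcnt : forall m n, rsum (ind m) n <= INR n * (K * r ^ m)).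
  { intros m n.
    assert (H : rsum (ind m) n * g m <= INR n).
    { apply (separated_count (fun i => s i < (/ 2) ^ m)).
      - intros i Hi. unfold ind. destruct (Rlt_dec _ _); easy.
      - intros i Hi. unfold ind. destruct (Rlt_dec _ _); easy.
      - intros i Hi H. apply Hg; auto. generalize (rpow_half_pos m); lra.
      - intros i j Hij Hi Hj. rewrite <- minus_INR by lia. apply Hg; [lia|].
        assert (s (j - i)%nat <= s j + s i).
        { unfold s. rewrite minus_INR by lia. rewrite <- (nd_opp (INR i * w)).
          replace ((INR j - INR i) * w) with (INR j * w + - (INR i * w)) by ring.
          apply nd_triang. }
        lra. }
    apply (Rmult_le_compat_r (K * r ^ m)) in H.
    - rewrite Rmult_assoc, Hginv in H. lra.
    - apply Rlt_le, Rmult_lt_0_compat; [apply exp_pos|apply pow_lt; lra]. }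
  set (C := ln 2 * (K / (1 - r))).
  assert (HC : 0 < C).
  { unfold C. apply Rmult_lt_0_compat; auto. apply Rdiv_lt_0_compat; [apply exp_pos|lra]. }
  (* Divisors truncated from below at [2^-M]. Passing from [M] to [M + 1] costs at most [ln 2] for
     each time counted by [ind M]; there are at most [n K r^M] of these, so the total loss is [n]
     times a geometric series. *)
  set (mx := fun M i => Rmax (s i) ((/ 2) ^ M)).
  assert (HP : forall M n, - (INR n * ln 2 * (K * (1 - r ^ M) / (1 - r)))
                           <= rsum (fun i => ln (mx M i)) n).
  { induction M as [|M IH]; intros n.
    - simpl pow. replace (K * (1 - 1) / (1 - r)) with 0 by (field; lra).
      rewrite Rmult_0_r, Ropp_0.
      replace 0 with (rsum (fun i => 0 * 0) n) by (rewrite rsum_scal; lra).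
      apply rsum_le. intros i _. unfold mx. simpl.
      rewrite Rmax_right by (generalize (nd_half (INR i * w)); unfold s; lra).
      rewrite ln_1; lra.
    - assert (H1 : rsum (fun i => ln (mx M i) - ln 2 * ind M i) n <= rsum (fun i => ln (mx (S M) i)) n).
      { apply rsum_le. intros i Hi. unfold mx, ind.
        assert (Hp := rpow_half_pos M). assert (Hi0 := Hsp i ltac:(lia)).
        destruct (Rlt_dec (s i) ((/ 2) ^ M)) as [Hlt|Hge].
        - rewrite Rmax_right by lra. rewrite Rmult_1_r. unfold Rminus.
          rewrite <- ln_Rinv, <- ln_mult by lra.
          apply ln_le; [apply Rmult_lt_0_compat; lra|].
          eapply Rle_trans; [|apply Rmax_r]. simpl. lra.
        - rewrite !Rmax_left by (simpl; lra). lra. }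
      rewrite rsum_minus, rsum_scal in H1. specialize (IH n). specialize (Hcnt M n).
      assert (ln 2 * rsum (ind M) n <= ln 2 * (INR n * (K * r ^ M)))
        by (apply Rmult_le_compat_l; lra).
      replace (INR n * ln 2 * (K * (1 - r ^ S M) / (1 - r)))
        with (INR n * ln 2 * (K * (1 - r ^ M) / (1 - r)) + ln 2 * (INR n * (K * r ^ M)))
        by (simpl; field; lra).
      lra. }
  assert (HQ : forall n, - (INR n * C) <= rsum (fun i => ln (s i)) n).
  { intros n.
    assert (HM : exists M, forall i, (1 <= i <= n)%nat -> (/ 2) ^ M <= s i).
    { clear - Hsp. induction n as [|n [M HM]].
      - exists 0%nat. intros; lia.
      - destruct (pow_lt_1_zero (/ 2) ltac:(rewrite Rabs_pos_eq; lra) (s (S n)) (Hsp (S n) ltac:(lia)))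
          as [N HN].
        exists (M + N)%nat. intros i Hi.
        destruct (Nat.eq_dec i (S n)) as [->|Hi'].
        + specialize (HN (M + N)%nat ltac:(lia)).
          rewrite Rabs_pos_eq in HN by (apply Rlt_le, rpow_half_pos). lra.
        + eapply Rle_trans; [|apply HM; lia]. rewrite pow_add.
          assert ((/ 2) ^ N <= 1) by (rewrite <- (pow1 N); apply pow_incr; lra).
          generalize (rpow_half_pos M) (rpow_half_pos N). nra. }
    destruct HM as [M HM]. specialize (HP M n).
    rewrite <- (Rle_antisym _ _ (rsum_le (fun i => ln (mx M i)) (fun i => ln (s i)) n
       ltac:(intros i Hi; unfold mx; rewrite Rmax_left by auto; lra))
       (rsum_le (fun i => ln (s i)) (fun i => ln (mx M i)) n
       ltac:(intros i Hi; unfold mx; rewrite Rmax_left by auto; lra))).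
    eapply Rle_trans; [|apply HP]. apply Ropp_le_contravar.
    unfold C. rewrite Rmult_assoc. apply Rmult_le_compat_l; [apply pos_INR|].
    apply Rmult_le_compat_l; [lra|].
    unfold Rdiv. apply Rmult_le_compat_r; [apply Rlt_le, Rinv_0_lt_compat; lra|].
    assert (0 < r ^ M) by (apply pow_lt; lra). assert (0 < K) by apply exp_pos. nra. }
  exists (exp (- C)). split.
  - split; [apply exp_pos|]. rewrite <- exp_0. left. apply exp_increasing. lra.
  - intros n. rewrite <- exp_rsum_ln by auto.
    replace (exp (- C) ^ n) with (exp (- (INR n * C))).
    + destruct (HQ n) as [H|H]; [left; apply exp_increasing; auto|rewrite H; lra].
    + rewrite <- (Rpower_pow n) by apply exp_pos. unfold Rpower. rewrite ln_exp. f_equal. ring.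
Qed.

(** * Decay of configurations *)

Fixpoint zprod (p : Z) (n : nat) (f : Z -> R) : R :=
  match n with
  | O => 1
  | S k => zprod p k f * f (p + Z.of_nat k)%Z
  end.

Lemma zprod_split p n m f :
  zprod p (n + m) f = zprod p n f * zprod (p + Z.of_nat n) m f.
Proof.
  induction m as [|m IH]; cbn [zprod].
  - rewrite Nat.add_0_r; lra.
  - rewrite Nat.add_succ_r; cbn [zprod]. rewrite IH.
    replace (p + Z.of_nat (n + m))%Z with (p + Z.of_nat n + Z.of_nat m)%Z by lia. lra.
Qed.

Lemma zprod_pos p n f :
  (forall k, (p <= k < p + Z.of_nat n)%Z -> 0 < f k) -> 0 < zprod p n f.
Proof.
  induction n as [|n IH]; intros H; cbn [zprod]; [lra|].
  apply Rmult_lt_0_compat; [apply IH; intros; apply H; lia|apply H; lia].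
Qed.

Lemma zprod_le1 p n f :
  (forall k, (p <= k < p + Z.of_nat n)%Z -> 0 < f k <= 1) -> zprod p n f <= 1.
Proof.
  induction n as [|n IH]; intros H; cbn [zprod]; [lra|].
  assert (0 < zprod p n f) by (apply zprod_pos; intros; apply H; lia).
  specialize (IH ltac:(intros; apply H; lia)). specialize (H (p + Z.of_nat n)%Z ltac:(lia)). nra.
Qed.

Lemma zprod_sq p n A f : zprod p n (fun k => A * f k ^ 2) = A ^ n * zprod p n f ^ 2.
Proof. induction n as [|n IH]; cbn [zprod]; [simpl; lra|]. rewrite IH. simpl. ring. Qed.

Definition shiftz (m : Z) (U : Z -> R) (k : Z) : R := U (k + m)%Z.

(** The non-resonance condition on the sites to the right of the center. It will be used with
    [kk m = c1 Lam nd (m w)^2], as provided by separation. *)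
Definition good (U kk : Z -> R) (R : Z) : Prop :=
  forall m u, (1 <= m <= R)%Z -> cfg (shiftz m U) u -> kk m <= defect (shiftz m U) u.

(** At the site of minimal defect the window solution is a configuration, so [good] applies to
    it. *)
Lemma good_wdefect U kk Rg p q : pos_form U -> good U kk Rg ->
  (1 <= p <= q)%Z -> (q <= Rg)%Z ->
  exists m, (p <= m <= q)%Z /\ kk m <= wdefect U p q m /\
    forall k, (p <= k <= q)%Z -> wdefect U p q m <= wdefect U p q k.
Proof.
  intros HU HG Hp Hq.
  destruct (finite_argmin (wdefect U p q) p q ltac:(lia)) as [m [Hm Hmin]].
  exists m. split; auto. split; auto.
  destruct (wsol_cfg U p q m HU Hm Hmin) as [H1 H2]. rewrite <- H2.
  apply (HG m _ ltac:(lia) H1).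
Qed.

(* Split the window at the site of minimal defect. *)
Lemma good_wdet U kk Rg : pos_form U -> good U kk Rg -> (forall k, (1 <= k)%Z -> 0 < kk k) ->
  forall n p, (1 <= p)%Z -> (p + Z.of_nat n - 1 <= Rg)%Z ->
  zprod p n kk <= wdet U p (p + Z.of_nat n - 1).
Proof.
  intros HU HG Hk n. induction n as [n IH] using lt_wf_ind. intros p Hp HR.
  destruct n as [|n].
  - simpl Z.of_nat. replace (p + 0 - 1)%Z with (p - 1)%Z by lia. rewrite wdet_empty. simpl; lra.
  - set (q := (p + Z.of_nat (S n) - 1)%Z) in *.
    destruct (good_wdefect U kk Rg p q HU HG ltac:(lia) HR) as [m [Hm [Hkm _]]].
    rewrite (wdefect_split U p q m) by auto.
    pose (i := Z.to_nat (m - p)). pose (j := Z.to_nat (q - m)).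
    replace (S n) with (i + (1 + j))%nat by (unfold i, j; lia). rewrite !zprod_split.
    assert (H1 := IH i ltac:(unfold i; lia) p Hp ltac:(unfold i; lia)).
    assert (H2 := IH j ltac:(unfold j; lia) (m + 1)%Z ltac:(lia) ltac:(unfold j; lia)).
    replace (p + Z.of_nat i - 1)%Z with (m - 1)%Z in H1 by (unfold i; lia).
    replace (m + 1 + Z.of_nat j - 1)%Z with q in H2 by (unfold j; lia).
    replace (p + Z.of_nat i)%Z with m by (unfold i; lia). cbn [zprod Z.of_nat].
    rewrite Z.add_0_r, Rmult_1_l. replace (m + Z.pos (Pos.of_succ_nat 0))%Z with (m + 1)%Z by lia.
    assert (0 < zprod p i kk) by (apply zprod_pos; intros; apply Hk; lia).
    assert (0 < zprod (m + 1) j kk) by (apply zprod_pos; intros; apply Hk; lia).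
    assert (0 < kk m) by (apply Hk; lia).
    replace (zprod p i kk * (kk m * zprod (m + 1) j kk))
      with (kk m * (zprod p i kk * zprod (m + 1) j kk)) by ring.
    apply Rmult_le_compat; try lra.
    + apply Rmult_le_pos; lra.
    + apply Rmult_le_compat; lra.
Qed.

Lemma cfg_refl U u : cfg U u -> cfg (refl U) (refl u).
Proof.
  intros [H1 [H2 H3]]. unfold refl. split; [auto|]. split; [auto|].
  intros k Hk. specialize (H3 (- k)%Z ltac:(lia)).
  replace (- (k + 1))%Z with (- k - 1)%Z by lia. replace (- (k - 1))%Z with (- k + 1)%Z by lia. lra.
Qed.

Lemma defect_refl U u : defect (refl U) (refl u) = defect U u.
Proof. unfold defect, refl. simpl. lra. Qed.

Lemma zsum_refl n : forall p f,
  zsum p n (fun k => f (- k)%Z) = zsum (- (p + Z.of_nat n - 1)) n f.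
Proof.
  induction n as [|n IH]; intros p f; auto.
  rewrite (zsum_split (- (p + Z.of_nat (S n) - 1)) 1 n f
    : zsum (- (p + Z.of_nat (S n) - 1)) (S n) f = _).
  cbn [zsum]. rewrite IH. replace (- (p + Z.of_nat (S n) - 1) + Z.of_nat 0)%Z
    with (- (p + Z.of_nat n))%Z by lia.
  replace (- (p + Z.of_nat (S n) - 1) + Z.of_nat 1)%Z with (- (p + Z.of_nat n - 1))%Z by lia. lra.
Qed.

Lemma form_refl U p n u :
  form (refl U) p n (refl u) = form U (- (p + Z.of_nat n - 1)) n u.
Proof.
  rewrite !form_defect.
  rewrite (zsum_ext p n _ (fun k => (fun j => u j * (U j * u j - u (j + 1)%Z - u (j - 1)%Z)) (- k)%Z)).
  - rewrite (zsum_refl n p (fun j => u j * (U j * u j - u (j + 1)%Z - u (j - 1)%Z))). unfold refl.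
    replace (- (p - 1))%Z with (- (p + Z.of_nat n - 1) + Z.of_nat n)%Z by lia.
    replace (- p)%Z with (- (p + Z.of_nat n - 1) + Z.of_nat n - 1)%Z by lia.
    replace (- (p + Z.of_nat n))%Z with (- (p + Z.of_nat n - 1) - 1)%Z by lia. ring.
  - intros k _. unfold refl.
    replace (- (k + 1))%Z with (- k - 1)%Z by lia. replace (- (k - 1))%Z with (- k + 1)%Z by lia. ring.
Qed.

Lemma pos_form_refl U : pos_form U -> pos_form (refl U).
Proof.
  intros [e [He H]]. exists e. split; auto. intros p n u Hn.
  specialize (H (- (p + Z.of_nat n - 1))%Z n (refl u) Hn).
  assert (E : form (refl U) p n u = form U (- (p + Z.of_nat n - 1)) n (refl u)).
  { rewrite <- form_refl. apply form_ext; auto. intros k _. unfold refl.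
    rewrite Z.opp_involutive. auto. }
  rewrite E. rewrite <- (zsum_refl n p (fun k => refl u k ^ 2)) in H. unfold refl in H at 1.
  rewrite (zsum_ext p n _ (fun k => u k ^ 2)) in H; auto.
  intros k _. rewrite Z.opp_involutive. reflexivity.
Qed.

Section Decay.
Variables (w cw A : R).
Hypothesis Hcw : 0 < cw <= 1.
Hypothesis Hprod : forall n, cw ^ n <= rprod (fun i => nd (INR i * w)) n.
Hypothesis HA : 1 <= A.

Let s (k : Z) : R := nd (IZR k * w).
Let kk (k : Z) : R := A * s k ^ 2.
(** The 2 counts the two ends of a window. The exponent 8 is 4 + 4: a loss [cw^(4n)] in the minimal
    defect of a window of length [2n], and the same loss in the determinant of half of that
    window. *)
Let rho := 2 / (A * cw ^ 8).

Lemma zprod_nd n : zprod 1 n s = rprod (fun i => nd (INR i * w)) n.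
Proof.
  induction n as [|n IH]; auto. cbn [zprod rprod]. rewrite IH. unfold s.
  do 3 f_equal. rewrite INR_IZR_INZ. f_equal. lia.
Qed.

(** A single divisor inherits the bound on the product because the others are at most 1. *)
Lemma nd_pow_bound k : (1 <= k)%Z -> cw ^ Z.to_nat k <= s k /\ 0 < s k <= 1.
Proof.
  intros Hk.
  assert (Hpos : 0 < s k).
  { assert (H := Hprod (Z.to_nat k)). rewrite <- zprod_nd in H.
    assert (0 < cw ^ Z.to_nat k) by (apply pow_lt; lra).
    destruct (Req_dec (s k) 0) as [Hz0|Hz0].
    - exfalso. replace (Z.to_nat k) with (S (Z.to_nat k - 1)) in H at 2 by lia.
      cbn [zprod] in H. replace (1 + Z.of_nat (Z.to_nat k - 1))%Z with k in H by lia.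
      rewrite Hz0 in H. lra.
    - assert (0 <= s k) by apply nd_pos. lra. }
  assert (Hle : forall j, s j <= 1) by (intros j; generalize (nd_half (IZR j * w)); unfold s; lra).
  split; [|auto].
  assert (H := Hprod (Z.to_nat k)). rewrite <- zprod_nd in H.
  replace (Z.to_nat k) with (S (Z.to_nat k - 1)) in H at 2 by lia.
  cbn [zprod] in H. replace (1 + Z.of_nat (Z.to_nat k - 1))%Z with k in H by lia.
  assert (Hz : forall n, 0 <= zprod 1 n s <= 1).
  { clear H. induction n as [|n IH]; cbn [zprod]; [lra|].
    assert (0 <= s (1 + Z.of_nat n)%Z <= 1) by (split; [apply nd_pos|apply Hle]).
    split; nra. }
  specialize (Hz (Z.to_nat k - 1)%nat). nra.
Qed.

Lemma kk_pos k : (1 <= k)%Z -> 0 < kk k.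
Proof.
  intros Hk. destruct (nd_pow_bound k Hk) as [_ H]. unfold kk.
  apply Rmult_lt_0_compat; [lra|]. apply pow_lt; lra.
Qed.

(** Multiplying by the first [p - 1] divisors only decreases the product and completes it to one
    that starts at 1; hence the exponent [p - 1 + n], doubled by the square in [kk]. *)
Lemma zprod_kk p n : (1 <= p)%Z ->
  A ^ n * cw ^ (2 * (Z.to_nat p - 1 + n)) <= zprod p n kk.
Proof.
  intros Hp. unfold kk. rewrite zprod_sq. apply Rmult_le_compat_l; [apply pow_le; lra|].
  rewrite Nat.mul_comm, pow_mult.
  set (i := (Z.to_nat p - 1)%nat).
  assert (H := Hprod (i + n)). rewrite <- zprod_nd, zprod_split in H.
  replace (1 + Z.of_nat i)%Z with p in H by (unfold i; lia).
  assert (0 < zprod p n s) by (apply zprod_pos; intros; apply nd_pow_bound; lia).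
  assert (0 < zprod 1 i s) by (apply zprod_pos; intros; apply nd_pow_bound; lia).
  assert (zprod 1 i s <= 1) by (apply zprod_le1; intros; apply nd_pow_bound; lia).
  assert (0 < cw ^ (i + n)) by (apply pow_lt; lra).
  apply pow_incr. split; [lra|]. nra.
Qed.

Lemma cw_pow_le i j : (i <= j)%nat -> cw ^ j <= cw ^ i.
Proof.
  intros H. replace j with (i + (j - i))%nat by lia. rewrite pow_add.
  assert (0 < cw ^ i) by (apply pow_lt; lra).
  assert (cw ^ (j - i) <= 1) by (rewrite <- (pow1 (j - i)); apply pow_incr; lra).
  assert (0 < cw ^ (j - i)) by (apply pow_lt; lra). nra.
Qed.

Lemma rho_pos : 0 < rho.
Proof.
  unfold rho. apply Rdiv_lt_0_compat; [lra|]. apply Rmult_lt_0_compat; [lra|apply pow_lt; lra].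
Qed.

Lemma rho_pow n : (1 <= n)%nat -> 2 * / (A ^ n * cw ^ (8 * n)) <= rho ^ n.
Proof.
  intros Hn. unfold rho, Rdiv. rewrite Rpow_mult_distr, pow_inv, Rpow_mult_distr, <- pow_mult.
  apply Rmult_le_compat_r.
  - apply Rlt_le, Rinv_0_lt_compat, Rmult_lt_0_compat; apply pow_lt; lra.
  - rewrite <- (pow_1 2) at 1. apply Rle_pow; [lra|lia].
Qed.

Variables (U : Z -> R) (Rg : Z).
Hypothesis HU : pos_form U.
Hypothesis HG : good U kk Rg.

Lemma inv_wdet_bound n : (Z.of_nat n <= Rg)%Z -> / wdet U 1 (Z.of_nat n) <= rho ^ n.
Proof.
  intros Hn. destruct n as [|n].
  - simpl Z.of_nat. replace 0%Z with (1 - 1)%Z by lia. rewrite wdet_empty. simpl; lra.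
  - eapply Rle_trans; [|apply rho_pow; lia].
    assert (H := good_wdet U kk Rg HU HG kk_pos (S n) 1 ltac:(lia) ltac:(lia)).
    assert (H' := zprod_kk 1 (S n) ltac:(lia)).
    replace (1 + Z.of_nat (S n) - 1)%Z with (Z.of_nat (S n)) in H by lia.
    assert (Hc : cw ^ (8 * S n) <= cw ^ (2 * (Z.to_nat 1 - 1 + S n))) by (apply cw_pow_le; lia).
    assert (0 < A ^ S n) by (apply pow_lt; lra).
    assert (0 < cw ^ (8 * S n)) by (apply pow_lt; lra).
    assert (0 < A ^ S n * cw ^ (8 * S n)) by (apply Rmult_lt_0_compat; lra).
    assert (/ wdet U 1 (Z.of_nat (S n)) <= / (A ^ S n * cw ^ (8 * S n))).
    { apply Rinv_le_contravar; auto. eapply Rle_trans; [|apply H]. eapply Rle_trans; [|apply H'].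
      apply Rmult_le_compat_l; lra. }
    assert (0 < / (A ^ S n * cw ^ (8 * S n))) by (apply Rinv_0_lt_compat; auto). lra.
Qed.

(** The site [n] is placed in the middle of the window from 1 to [2n], at whose ends [u] is at most
    1. Then [u n] is at most [1/F (1/D1 + 1/D2)], where the defect [F] is at least [A cw^(4n)] and
    the determinants [D1], [D2] of the two halves are at least [A^(n-1) cw^(4n)]. The doubled window
    is the reason for asking [good] up to [2n]. *)
Lemma cfg_decay u n : (forall k, 0 <= u k <= 1) ->
  (forall k, (1 <= k)%Z -> U k * u k <= u (k + 1)%Z + u (k - 1)%Z) ->
  (2 * Z.of_nat n <= Rg)%Z -> u (Z.of_nat n) <= rho ^ n.
Proof.
  intros Hu Hsub Hn. destruct n as [|n']; [apply Hu|].
  set (n := S n') in *. assert (Hn1 : (1 <= n)%nat) by (unfold n; lia). clearbody n.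
  assert (Hb := subsolution_bound U u 1 (2 * Z.of_nat n) (Z.of_nat n) HU ltac:(lia)
     (fun k => proj1 (Hu k)) ltac:(intros; apply Hsub; lia)).
  destruct (good_wdefect U kk Rg 1 (2 * Z.of_nat n) HU HG ltac:(lia) Hn) as [m [Hm [Hkm Hmin]]].
  specialize (Hmin (Z.of_nat n) ltac:(lia)).
  rewrite (wdefect_split U 1 (2 * Z.of_nat n) (Z.of_nat n)) in Hb by (auto; lia).
  set (F := wdefect U 1 (2 * Z.of_nat n) (Z.of_nat n)) in *.
  assert (H1 := good_wdet U kk Rg HU HG kk_pos (n - 1) 1 ltac:(lia) ltac:(lia)).
  assert (H2 := good_wdet U kk Rg HU HG kk_pos n (Z.of_nat n + 1) ltac:(lia) ltac:(lia)).
  replace (1 + Z.of_nat (n - 1) - 1)%Z with (Z.of_nat n - 1)%Z in H1 by lia.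
  replace (Z.of_nat n + 1 + Z.of_nat n - 1)%Z with (2 * Z.of_nat n)%Z in H2 by lia.
  assert (H1' := zprod_kk 1 (n - 1) ltac:(lia)).
  assert (H2' := zprod_kk (Z.of_nat n + 1) n ltac:(lia)).
  set (D1 := wdet U 1 (Z.of_nat n - 1)) in *.
  set (D2 := wdet U (Z.of_nat n + 1) (2 * Z.of_nat n)) in *.
  set (c := cw ^ (4 * n)).
  assert (Hc : 0 < c) by (apply pow_lt; lra).
  assert (Hc1 : c <= cw ^ (2 * (Z.to_nat 1 - 1 + (n - 1)))) by (apply cw_pow_le; lia).
  assert (Hc2 : c <= cw ^ (2 * (Z.to_nat (Z.of_nat n + 1) - 1 + n))) by (apply cw_pow_le; lia).
  assert (HAn : 0 < A ^ (n - 1)) by (apply pow_lt; lra).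
  assert (HAS : A ^ n = A * A ^ (n - 1)) by (destruct n; [lia|]; simpl; rewrite Nat.sub_0_r; auto).
  assert (HAle : A ^ (n - 1) <= A ^ n) by (rewrite HAS; nra).
  assert (HD1 : A ^ (n - 1) * c <= D1).
  { eapply Rle_trans; [|apply H1]. eapply Rle_trans; [|apply H1']. apply Rmult_le_compat_l; lra. }
  assert (HD2 : A ^ (n - 1) * c <= D2).
  { eapply Rle_trans; [|apply H2]. eapply Rle_trans; [|apply H2'].
    apply Rmult_le_compat; lra. }
  assert (HF : A * c <= F).
  { apply Rle_trans with (kk m); [|lra]. unfold kk. apply Rmult_le_compat_l; [lra|].
    unfold c. replace (4 * n)%nat with (2 * n * 2)%nat by lia. rewrite pow_mult.
    apply pow_incr. split; [apply pow_le; lra|].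
    eapply Rle_trans; [|apply (nd_pow_bound m); lia]. apply cw_pow_le; lia. }
  assert (HAc : 0 < A ^ (n - 1) * c) by (apply Rmult_lt_0_compat; auto).
  assert (HAc' : 0 < A * c) by (apply Rmult_lt_0_compat; lra).
  assert (HD1p : 0 < D1) by (eapply Rlt_le_trans; [apply HAc|auto]).
  assert (HD2p : 0 < D2) by (eapply Rlt_le_trans; [apply HAc|auto]).
  assert (HFp : 0 < F) by (eapply Rlt_le_trans; [apply HAc'|auto]).
  assert (Hu0 : u (1 - 1)%Z <= 1) by apply Hu.
  assert (Hu1 : u (2 * Z.of_nat n + 1)%Z <= 1) by apply Hu.
  assert (Hun := Hu (Z.of_nat n)).
  assert (Hb' : u (Z.of_nat n) * (F * (D1 * D2)) <= D2 + D1).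
  { eapply Rle_trans; [apply Hb|].
    assert (D2 * u (1 - 1)%Z <= D2 * 1) by (apply Rmult_le_compat_l; lra).
    assert (D1 * u (2 * Z.of_nat n + 1)%Z <= D1 * 1) by (apply Rmult_le_compat_l; lra). lra. }
  eapply Rle_trans; [|apply rho_pow; auto].
  assert (Hi1 : / D1 <= / (A ^ (n - 1) * c)) by (apply Rinv_le_contravar; auto).
  assert (Hi2 : / D2 <= / (A ^ (n - 1) * c)) by (apply Rinv_le_contravar; auto).
  assert (HiF : / F <= / (A * c)) by (apply Rinv_le_contravar; auto).
  assert (Hle : u (Z.of_nat n) <= / F * (/ D1 + / D2)).
  { apply (Rmult_le_reg_r (F * (D1 * D2))).
    - apply Rmult_lt_0_compat; [|apply Rmult_lt_0_compat]; auto.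
    - eapply Rle_trans; [apply Hb'|]. right. field. repeat split; apply Rgt_not_eq; auto. }
  eapply Rle_trans; [apply Hle|].
  assert (0 < / F) by (apply Rinv_0_lt_compat; auto).
  assert (0 < / D1) by (apply Rinv_0_lt_compat; auto).
  assert (0 < / D2) by (apply Rinv_0_lt_compat; auto).
  eapply Rle_trans; [apply Rmult_le_compat; [lra|lra|apply HiF|apply Rplus_le_compat; [apply Hi1|apply Hi2]]|].
  right. replace (8 * n)%nat with (4 * n + 4 * n)%nat by lia. rewrite pow_add, HAS. fold c.
  field. lra.
Qed.
End Decay.

(** * Comparison of decaying Dirichlet solutions for two nearby potentials *)

Lemma INR_le_pow2 n : INR n <= 2 ^ n.
Proof.
  induction n as [|n IH]; [simpl; lra|]. rewrite S_INR. simpl.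
  assert (1 <= 2 ^ n) by (apply pow_R1_Rle; lra). lra.
Qed.

Lemma geom_zsum x n : 0 <= x <= / 2 -> zsum 1 n (fun k => x ^ Z.to_nat k) <= 2 * x.
Proof.
  intros Hx. enough (zsum 1 n (fun k => x ^ Z.to_nat k) <= 2 * x * (1 - x ^ n)).
  { assert (0 <= x ^ n) by (apply pow_le; lra). nra. }
  induction n as [|n IH]; cbn [zsum]; [simpl; lra|].
  replace (Z.to_nat (1 + Z.of_nat n)) with (S n) by lia.
  assert (0 <= x ^ n) by (apply pow_le; lra). cbn [pow].
  assert (0 <= x * x ^ n) by nra. nra.
Qed.

Section Difference.
Variables (U U' f f' : Z -> R) (M : nat) (rho e B : R).
Hypothesis Hrho : 0 < rho.
Hypothesis Hrho2 : 2 * rho ^ 2 <= 1.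
Hypothesis He : 0 <= e.
Hypothesis HB : 1 <= rho * B.
Hypothesis Hf0 : f 0%Z = 1.
Hypothesis Hf0' : f' 0%Z = 1.
Hypothesis HfM : f (Z.of_nat M + 1)%Z = 0.
Hypothesis HfM' : f' (Z.of_nat M + 1)%Z = 0.
Hypothesis Hfp : forall k, (k <= M)%nat -> 0 < f (Z.of_nat k) <= rho ^ k.
Hypothesis Hfp' : forall k, (k <= M)%nat -> 0 < f' (Z.of_nat k) <= rho ^ k.
Hypothesis Hf : forall k, (1 <= k <= Z.of_nat M)%Z -> U k * f k = f (k + 1)%Z + f (k - 1)%Z.
Hypothesis Hf' : forall k, (1 <= k <= Z.of_nat M)%Z -> U' k * f' k = f' (k + 1)%Z + f' (k - 1)%Z.
Hypothesis HUU : forall k, (1 <= k <= Z.of_nat M)%Z -> Rabs (U' k - U k) <= e.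
Hypothesis HUB : forall k, (1 <= k <= Z.of_nat M)%Z -> U k <= B.

Let h (k : Z) := f k * f' (k + 1)%Z - f (k + 1)%Z * f' k.

(** The mixed Wronskian vanishes at the right end, and a step to the left from [z] changes it by
    [(U' - U) f f'] at [z], at most [e rho^(2z)]. The condition [2 rho^2 <= 1] sums these terms into
    the factor 2. *)
Lemma diff_wronskian j k : (k + j = M)%nat -> Rabs (h (Z.of_nat k)) <= 2 * e * rho ^ (2 * k + 2).
Proof.
  revert k; induction j as [|j IH]; intros k Hk.
  - replace k with M by lia. unfold h. rewrite HfM, HfM'.
    rewrite Rmult_0_r, Rmult_0_l, Rminus_0_r, Rabs_R0.
    assert (0 < rho ^ (2 * M + 2)) by (apply pow_lt; auto). nra.
  - specialize (IH (S k) ltac:(lia)).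
    set (z := Z.of_nat (S k)) in *.
    assert (Hz : h (Z.of_nat k) = h z - (U' z - U z) * (f z * f' z)).
    { unfold h. replace (Z.of_nat k) with (z - 1)%Z by (unfold z; lia).
      replace (z - 1 + 1)%Z with z by lia.
      assert (H1 := Hf z ltac:(unfold z; lia)). assert (H2 := Hf' z ltac:(unfold z; lia)).
      replace ((U' z - U z) * (f z * f' z)) with (f z * (U' z * f' z) - f' z * (U z * f z)) by ring.
      rewrite H1, H2. ring. }
    rewrite Hz. eapply Rle_trans; [apply Rabs_triang|]. rewrite Rabs_Ropp, Rabs_mult.
    specialize (HUU z ltac:(unfold z; lia)).
    assert (H1 := Hfp (S k) ltac:(lia)). assert (H2 := Hfp' (S k) ltac:(lia)). fold z in H1, H2.
    assert (Hff : 0 < f z * f' z <= rho ^ (2 * k + 2)).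
    { split; [apply Rmult_lt_0_compat; lra|].
      replace (2 * k + 2)%nat with (S k + S k)%nat by lia. rewrite pow_add.
      apply Rmult_le_compat; lra. }
    rewrite (Rabs_pos_eq (f z * f' z)) by lra.
    assert (Rabs (U' z - U z) * (f z * f' z) <= e * rho ^ (2 * k + 2)).
    { apply Rmult_le_compat; try lra. apply Rabs_pos. }
    replace (2 * S k + 2)%nat with ((2 * k + 2) + 2)%nat in IH by lia.
    rewrite pow_add in IH. set (t := rho ^ (2 * k + 2)) in *.
    assert (2 * e * (t * rho ^ 2) <= e * t).
    { replace (2 * e * (t * rho ^ 2)) with ((e * t) * (2 * rho ^ 2)) by ring.
      assert (0 <= e * t) by (apply Rmult_le_pos; lra). nra. }
    lra.
Qed.

(** The equation gives [f (k-1) <= U k * f k], so [f] decays at most by the factor [1 / B] per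
    step. *)
Lemma diff_lower k : (k <= M)%nat -> 1 <= f (Z.of_nat k) * B ^ k.
Proof.
  assert (HBp : 0 < B) by (apply (Rmult_lt_reg_l rho); lra).
  induction k as [|k IH]; intros Hk.
  - simpl. rewrite Hf0. lra.
  - specialize (IH ltac:(lia)).
    set (z := Z.of_nat (S k)) in *.
    assert (H1 := Hf z ltac:(unfold z; lia)).
    replace (z - 1)%Z with (Z.of_nat k) in H1 by (unfold z; lia).
    assert (Hz := Hfp (S k) Hk). fold z in Hz.
    assert (0 <= f (z + 1)%Z).
    { destruct (Nat.eq_dec (S k) M) as [E|E].
      - unfold z. rewrite E, HfM. lra.
      - generalize (Hfp (S (S k)) ltac:(lia)). replace (Z.of_nat (S (S k))) with (z + 1)%Z by (unfold z; lia). lra. }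
    assert (U z * f z <= B * f z) by (apply Rmult_le_compat_r; [lra|apply HUB; unfold z; lia]).
    assert (0 < B ^ k) by (apply pow_lt; auto). cbn [pow].
    assert (f (Z.of_nat k) * B ^ k <= B * f z * B ^ k) by (apply Rmult_le_compat_r; lra). lra.
Qed.

(** The increment of [f' / f] from [n] to [n + 1] is the mixed Wronskian divided by [f n * f (n+1)].
    Upper bounds with [rho] against lower bounds with [1 / B] leave a growth [(rho B)^(2n)]. *)
Lemma diff_ratio n : (n <= M)%nat ->
  Rabs (f' (Z.of_nat n) / f (Z.of_nat n) - 1) <= 2 * INR n * e * rho * (rho * B) ^ (2 * n).
Proof.
  assert (HBp : 0 < B) by (apply (Rmult_lt_reg_l rho); lra).
  induction n as [|n IH]; intros Hn.
  - simpl Z.of_nat. rewrite Hf0, Hf0'. simpl. replace (1 / 1 - 1) with 0 by lra. rewrite Rabs_R0. lra.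
  - specialize (IH ltac:(lia)). rewrite S_INR.
    set (z := Z.of_nat n) in *. replace (Z.of_nat (S n)) with (z + 1)%Z by (unfold z; lia).
    assert (Hz := Hfp n ltac:(lia)). assert (Hz1 := Hfp (S n) Hn).
    replace (Z.of_nat (S n)) with (z + 1)%Z in Hz1 by (unfold z; lia). fold z in Hz.
    replace (f' (z + 1)%Z / f (z + 1)%Z - 1)
      with (h z * / (f z * f (z + 1)%Z) + (f' z / f z - 1)) by (unfold h; field; lra).
    eapply Rle_trans; [apply Rabs_triang|]. rewrite Rabs_mult.
    assert (Hh := diff_wronskian (M - n) n ltac:(lia)). fold z in Hh.
    assert (Hi : Rabs (/ (f z * f (z + 1)%Z)) <= B ^ (2 * n + 1)).
    { rewrite Rabs_pos_eq by (apply Rlt_le, Rinv_0_lt_compat, Rmult_lt_0_compat; lra).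
      assert (H1 := diff_lower n ltac:(lia)). assert (H2 := diff_lower (S n) Hn).
      replace (Z.of_nat (S n)) with (z + 1)%Z in H2 by (unfold z; lia). fold z in H1.
      replace (2 * n + 1)%nat with (n + S n)%nat by lia. rewrite pow_add.
      apply (Rmult_le_reg_r (f z * f (z + 1)%Z)); [apply Rmult_lt_0_compat; lra|].
      rewrite Rinv_l by (apply Rgt_not_eq, Rmult_lt_0_compat; lra).
      replace (B ^ n * B ^ S n * (f z * f (z + 1)%Z)) with ((f z * B ^ n) * (f (z + 1)%Z * B ^ S n)) by ring.
      nra. }
    assert (Rabs (h z) * Rabs (/ (f z * f (z + 1)%Z)) <= 2 * e * rho ^ (2 * n + 2) * B ^ (2 * n + 1)).
    { apply Rmult_le_compat; auto; apply Rabs_pos. }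
    assert (E1 : rho ^ (2 * n + 2) * B ^ (2 * n + 1) = rho * (rho * B) ^ (2 * n + 1)).
    { rewrite Rpow_mult_distr. replace (2 * n + 2)%nat with (S (2 * n + 1)) by lia. simpl. ring. }
    assert (Hmono : forall i j, (i <= j)%nat -> (rho * B) ^ i <= (rho * B) ^ j)
      by (intros; apply Rle_pow; auto).
    assert (M1 := Hmono (2 * n + 1)%nat (2 * S n)%nat ltac:(lia)).
    assert (M2 := Hmono (2 * n)%nat (2 * S n)%nat ltac:(lia)).
    set (G1 := (rho * B) ^ (2 * n + 1)) in *. set (G2 := (rho * B) ^ (2 * S n)) in *.
    set (G0 := (rho * B) ^ (2 * n)) in *.
    assert (0 <= e * rho) by nra. assert (0 <= INR n) by apply pos_INR.
    assert (2 * e * rho ^ (2 * n + 2) * B ^ (2 * n + 1) <= 2 * (e * rho) * G2).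
    { rewrite Rmult_assoc, E1. replace (2 * e * (rho * G1)) with (2 * (e * rho) * G1) by ring.
      apply Rmult_le_compat_l; lra. }
    assert (2 * INR n * e * rho * G0 <= 2 * INR n * (e * rho) * G2).
    { replace (2 * INR n * e * rho * G0) with (2 * INR n * (e * rho) * G0) by ring.
      apply Rmult_le_compat_l; auto. apply Rmult_le_pos; lra. }
    lra.
Qed.

(** The relative error of [f'] may grow like [n (rho B)^(2n)], but the squares carry [rho^(2n)]. In
    the application [rho B] is bounded and [rho] small, so the product is summable; the factor [n]
    is absorbed by [2^n]. *)
Lemma diff_squares : 2 * (rho * (rho * B)) ^ 2 <= / 2 ->
  zsum 1 M (fun k => Rabs (f' k ^ 2 - f k ^ 2)) <= 16 * e * rho * (rho * (rho * B)) ^ 2.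
Proof.
  intros Hx. set (x := 2 * (rho * (rho * B)) ^ 2) in *.
  assert (Hx0 : 0 <= x) by (unfold x; nra).
  apply Rle_trans with (zsum 1 M (fun k => (4 * e * rho) * x ^ Z.to_nat k)).
  2:{ rewrite zsum_scal. assert (H := geom_zsum x M ltac:(lra)).
      assert (0 <= 4 * e * rho) by nra.
      apply Rle_trans with (4 * e * rho * (2 * x)); [apply Rmult_le_compat_l; auto|].
      unfold x. right. ring. }
  apply zsum_le. intros k Hk. pose (n := Z.to_nat k).
  replace k with (Z.of_nat n) by (unfold n; lia). rewrite Nat2Z.id.
  assert (H1 := Hfp n ltac:(unfold n; lia)). assert (H2 := Hfp' n ltac:(unfold n; lia)).
  assert (H3 := diff_ratio n ltac:(unfold n; lia)).
  set (z := Z.of_nat n) in *.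
  replace (f' z ^ 2 - f z ^ 2) with ((f' z / f z - 1) * (f z * (f z + f' z))) by (field; lra).
  rewrite Rabs_mult. rewrite (Rabs_pos_eq (f z * (f z + f' z))) by nra.
  assert (f z * (f z + f' z) <= 2 * (rho ^ n * rho ^ n)) by nra.
  apply Rle_trans with ((2 * INR n * e * rho * (rho * B) ^ (2 * n)) * (2 * (rho ^ n * rho ^ n))).
  { apply Rmult_le_compat; auto; [apply Rabs_pos|nra]. }
  assert (H4 := INR_le_pow2 n). unfold x. rewrite (Rpow_mult_distr 2 ((rho * (rho * B)) ^ 2) n), <- pow_mult.
  replace (2 * INR n * e * rho * (rho * B) ^ (2 * n) * (2 * (rho ^ n * rho ^ n)))
    with ((4 * e * rho * (rho * (rho * B)) ^ (2 * n)) * INR n).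
  - replace (4 * e * rho * (2 ^ n * (rho * (rho * B)) ^ (2 * n)))
      with ((4 * e * rho * (rho * (rho * B)) ^ (2 * n)) * 2 ^ n) by ring.
    apply Rmult_le_compat_l; auto.
    apply Rmult_le_pos; [nra|]. apply pow_le. apply Rmult_le_pos; lra.
  - rewrite (Rpow_mult_distr rho (rho * B)). replace (2 * n)%nat with (n + n)%nat by lia.
    rewrite (pow_add rho). ring.
Qed.
End Difference.

(** * Separation of configurations *)

Lemma pow_lt_2 x y : 0 <= x < y -> x ^ 2 < y ^ 2.
Proof. intros. nra. Qed.

Definition orb (w : R) (W : R -> R) (th : R) (k : Z) : R := W (th + IZR k * w).

Lemma shiftz_orb w W th m : shiftz m (orb w W th) = orb w W (th + IZR m * w).
Proof.
  extensionality k. unfold shiftz, orb. f_equal. rewrite plus_IZR. ring.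
Qed.

Lemma refl_refl U : refl (refl U) = U.
Proof. extensionality k. unfold refl. f_equal. lia. Qed.

Lemma shiftz_refl U m : shiftz m (refl U) = refl (shiftz (- m) U).
Proof. extensionality k. unfold shiftz, refl. f_equal. lia. Qed.

Lemma shiftz_0 U : shiftz 0 U = U.
Proof. extensionality k. unfold shiftz. f_equal. lia. Qed.

Lemma wsol_refl U (M : Z) k : pos_form U -> (0 <= M)%Z ->
  wsol (refl U) (- M) M 0 k = wsol U (- M) M 0 (- k).
Proof.
  intros HU HM. destruct (Z_le_dec 0 k).
  - rewrite wsol_r by (try lia; apply pos_form_refl; auto). rewrite wsol_l by lia.
    unfold rsol. rewrite refl_refl. simpl. reflexivity.
  - rewrite wsol_l by lia. rewrite wsol_r by (auto; lia).
    unfold rsol. rewrite Z.opp_involutive. simpl. reflexivity.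
Qed.

Section Sides.
Variables (U U' Um f f' : Z -> R) (M : nat) (rho Lam A0 A1 A2 b : R).
Hypothesis HLam : 0 < Lam.
Hypothesis HA1 : 0 <= A1.
Hypothesis HA2 : 0 <= A2.
Hypothesis Hb : 0 < b.
Hypothesis Hrho : 0 < rho.
Hypothesis Hrho2 : 2 * rho ^ 2 <= 1.
Hypothesis HB : 1 <= rho * (Lam * A0).
Hypothesis Hx : 2 * (rho * (rho * (Lam * A0))) ^ 2 <= / 2.
Hypothesis Hf0 : f 0%Z = 1.
Hypothesis Hf0' : f' 0%Z = 1.
Hypothesis HfM : f (Z.of_nat M + 1)%Z = 0.
Hypothesis HfM' : f' (Z.of_nat M + 1)%Z = 0.
Hypothesis Hfp : forall k, (k <= M)%nat -> 0 < f (Z.of_nat k) <= rho ^ k.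
Hypothesis Hfp' : forall k, (k <= M)%nat -> 0 < f' (Z.of_nat k) <= rho ^ k.
Hypothesis Hf : forall k, (1 <= k <= Z.of_nat M)%Z -> U k * f k = f (k + 1)%Z + f (k - 1)%Z.
Hypothesis Hf' : forall k, (1 <= k <= Z.of_nat M)%Z -> U' k * f' k = f' (k + 1)%Z + f' (k - 1)%Z.
Hypothesis HUU : forall k, Rabs (U' k - U k) <= Lam * A1 * b.
Hypothesis HUm : forall k, Rabs (Um k - U k) <= Lam * A1 * (b / 2).
Hypothesis HUmid : forall k, Rabs (U k + U' k - 2 * Um k) <= Lam * A2 * (b / 2) ^ 2.
Hypothesis HUB : forall k, U k <= Lam * A0.

(** The summand equals [- (Um - U) (f'^2 - f^2) - (U + U' - 2 Um) f'^2]: a product of two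
    differences of first order in [b], plus a second difference of the potential. The sum is
    therefore quadratic in [b]. *)
Lemma side_sum :
  zsum 1 M (fun k => (Um k - U k) * f k ^ 2 + (Um k - U' k) * f' k ^ 2)
  <= Lam * b ^ 2 * (A2 * rho ^ 2 / 2 + 8 * A1 ^ 2 * (Lam * rho) * (rho * (rho * (Lam * A0))) ^ 2).
Proof.
  assert (He : 0 <= Lam * A1 * b) by (apply Rmult_le_pos; [apply Rmult_le_pos|]; lra).
  assert (H1 := diff_squares U U' f f' M rho (Lam * A1 * b) (Lam * A0) Hrho Hrho2 He HB Hf0 Hf0'
    HfM HfM' Hfp Hfp' Hf Hf' (fun k _ => HUU k) (fun k _ => HUB k) Hx).
  assert (H2 : zsum 1 M (fun k => f' k ^ 2) <= 2 * rho ^ 2).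
  { eapply Rle_trans; [|apply (geom_zsum (rho ^ 2) M); nra].
    apply zsum_le. intros k Hk. rewrite <- pow_mult, Nat.mul_comm, pow_mult.
    assert (H := Hfp' (Z.to_nat k) ltac:(lia)). rewrite Z2Nat.id in H by lia.
    apply pow_incr. lra. }
  apply Rle_trans with
    (zsum 1 M (fun k => (Lam * A1 * (b / 2)) * Rabs (f' k ^ 2 - f k ^ 2)
                        + (Lam * A2 * (b / 2) ^ 2) * f' k ^ 2)).
  - apply zsum_le. intros k Hk.
    replace ((Um k - U k) * f k ^ 2 + (Um k - U' k) * f' k ^ 2)
      with ((Um k - U k) * - (f' k ^ 2 - f k ^ 2) + - (U k + U' k - 2 * Um k) * f' k ^ 2) by ring.
    apply Rplus_le_compat.
    + eapply Rle_trans; [apply Rle_abs|]. rewrite Rabs_mult, Rabs_Ropp.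
      apply Rmult_le_compat_r; [apply Rabs_pos|auto].
    + apply Rmult_le_compat_r; [apply pow2_ge_0|].
      eapply Rle_trans; [apply Rle_abs|]. rewrite Rabs_Ropp. auto.
  - rewrite zsum_plus, !zsum_scal.
    set (X := zsum 1 M (fun k => Rabs (f' k ^ 2 - f k ^ 2))) in *.
    set (Y := zsum 1 M (fun k => f' k ^ 2)) in *.
    set (Q := (rho * (rho * (Lam * A0))) ^ 2) in *.
    assert (Lam * A1 * (b / 2) * X <= Lam * A1 * (b / 2) * (16 * (Lam * A1 * b) * rho * Q))
      by (apply Rmult_le_compat_l; lra).
    assert (Lam * A2 * (b / 2) ^ 2 * Y <= Lam * A2 * (b / 2) ^ 2 * (2 * rho ^ 2)).
    { apply Rmult_le_compat_l; auto. apply Rmult_le_pos; [apply Rmult_le_pos; lra|apply pow2_ge_0]. }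
    eapply Rle_trans; [apply Rplus_le_compat; [apply H|apply H0]|]. right. field.
Qed.
End Sides.

(** * Induction on dyadic scales *)

Section Separation.
Variables (w tmin Lam c0 c1 cv rv A0 A1 A2 cw delta : R) (W : R -> R) (k0 : nat).
Hypothesis Hcw : 0 < cw <= 1.
Hypothesis Hprod : forall n, cw ^ n <= rprod (fun i => nd (INR i * w)) n.
Hypothesis Hk0 : forall k m, (k0 <= k)%nat -> m <> 0%Z -> (Z.abs m <= 2 * Z.of_nat k + 4)%Z ->
  2 * (/ 2) ^ k <= nd (IZR m * w).
Hypothesis HWper : forall t k, W (t + IZR k) = W t.
Hypothesis HWlow : forall t, Lam * c0 * nd (t - tmin) ^ 2 <= W t.
Hypothesis HWup : forall t, W t <= Lam * A0.
Hypothesis HWlip : forall t s, Rabs (W t - W s) <= Lam * A1 * Rabs (t - s).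
Hypothesis HWmid : forall t h, Rabs (W (t - h) + W (t + h) - 2 * W t) <= Lam * A2 * h ^ 2.
Hypothesis HWconv : forall t h, Rabs (t - tmin) + Rabs h <= rv ->
  Lam * cv * h ^ 2 <= W (t - h) + W (t + h) - 2 * W t.
Hypothesis Hpos : forall th, pos_form (orb w W th).
Hypothesis HT : forall th p n u, (p <= 0 < p + Z.of_nat n)%Z ->
  delta * u 0%Z ^ 2 <= form (orb w W th) p n u.
Hypothesis Hdelta : 0 < delta <= 3.
Hypothesis Hc0 : 0 < c0.
Hypothesis Hc1 : 0 < c1.
Hypothesis Hc10 : 8 * c1 <= c0.
Hypothesis Hc1v : 32 * c1 <= cv.
Hypothesis HA0 : 0 <= A0.
Hypothesis HA1 : 0 <= A1.
Hypothesis HA2 : 0 <= A2.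
Hypothesis Hrv : 0 < rv.
Hypothesis HLam : 1 <= c1 * Lam.
Hypothesis HLam_rv : 40 <= c0 * Lam * (rv / 3) ^ 2.
Hypothesis HLam_k0 : 40 < c0 * Lam * (/ 4) ^ (k0 + 1).
Let rho := 2 / (c1 * Lam * cw ^ 8).
Hypothesis Hrho : rho <= / 16.
Hypothesis Hrho_x : 2 * (rho * (rho * (Lam * A0))) ^ 2 <= / 2.
Hypothesis Hrho_B : 1 <= rho * (Lam * A0).
Hypothesis Hrho_small :
  A2 * rho ^ 2 + 16 * A1 ^ 2 * (Lam * rho) * (rho * (rho * (Lam * A0))) ^ 2 <= cv / 8.

Let kk (m : Z) := c1 * Lam * nd (IZR m * w) ^ 2.

Definition below th u b := cfg (orb w W th) u /\ defect (orb w W th) u < delta + c1 * Lam * b ^ 2.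

(** Concerns all distances from [2^-k] up, so that larger [k] says more; [k = 0] is void because
    [nd] is at most 1/2. *)
Definition separated (k : nat) : Prop := forall th th' u u',
  (/ 2) ^ k <= nd (th' - th) -> below th u (nd (th' - th)) -> below th' u' (nd (th' - th)) -> False.

Lemma Lam_pos : 0 < Lam.
Proof. apply (Rmult_lt_reg_l c1); lra. Qed.

Lemma rho_positive : 0 < rho.
Proof. apply (rho_pos cw (c1 * Lam)); auto. Qed.

Lemma below_mono th u b b' : 0 <= b <= b' -> below th u b -> below th u b'.
Proof.
  intros Hb [H1 H2]. split; auto. eapply Rlt_le_trans; [apply H2|].
  assert (b ^ 2 <= b' ^ 2) by (apply pow_incr; auto).
  apply Rplus_le_compat_l, Rmult_le_compat_l; lra.
Qed.

(** The phases [th] and [th + m w] are at distance [nd (m w)], and the first is low, so the second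
    is not. This turns separation into the non-resonance condition [good]. *)
Lemma separated_good k th u b m : separated k -> below th u b -> 0 <= b ->
  b <= nd (IZR m * w) -> (/ 2) ^ k <= nd (IZR m * w) ->
  forall u', cfg (shiftz m (orb w W th)) u' ->
  delta + kk m <= defect (shiftz m (orb w W th)) u'.
Proof.
  intros HS Hu Hb Hm Hk u' Hu'. rewrite shiftz_orb in *.
  apply Rnot_lt_le. intros Hlt.
  apply (HS th (th + IZR m * w) u u');
    replace (th + IZR m * w - th) with (IZR m * w) by ring; auto.
  - apply (below_mono th u b); auto.
  - split; auto.
Qed.

Lemma good_right k th u b R0 : separated k -> below th u b -> 0 <= b ->
  (forall m, m <> 0%Z -> (Z.abs m <= R0)%Z ->
     b <= nd (IZR m * w) /\ (/ 2) ^ k <= nd (IZR m * w)) ->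
  good (orb w W th) kk R0 /\ good (refl (orb w W th)) kk R0.
Proof.
  intros HS Hu Hb HR. split; intros m u' Hm Hu'.
  - destruct (HR m ltac:(lia) ltac:(lia)) as [H1 H2].
    generalize (separated_good k th u b m HS Hu Hb H1 H2 u' Hu'). lra.
  - destruct (HR (- m)%Z ltac:(lia) ltac:(lia)) as [H1 H2].
    rewrite shiftz_refl in *. apply cfg_refl in Hu'. rewrite refl_refl in Hu'.
    generalize (separated_good k th u b (- m) HS Hu Hb H1 H2 _ Hu').
    rewrite <- (defect_refl (shiftz (- m) (orb w W th))), refl_refl.
    unfold kk. rewrite opp_IZR, Ropp_mult_distr_l_reverse, nd_opp. lra.
Qed.

(** On the window from 1 to [M], the end value [u 0 = 1] contributes exactly the Dirichlet solution,
    and the end value at [M + 1], at most 1, contributes the reciprocal determinant, at most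
    [rho^M]. *)
Lemma dirichlet_near V u M : pos_form V -> good V kk (2 * Z.of_nat M + 2) -> cfg V u ->
  (1 <= M)%nat -> u 1%Z <= wsol V (- Z.of_nat M) (Z.of_nat M) 0 1 + rho ^ M.
Proof.
  intros HV HG [H1 [H2 H3]] HM.
  assert (Hb := subsolution_bound V u 1 (Z.of_nat M) 1 HV ltac:(lia) (fun k => proj1 (H1 k))
     ltac:(intros; apply H3; lia)).
  rewrite wdet_empty in Hb. replace (1 - 1)%Z with 0%Z in Hb by lia. rewrite H2 in Hb.
  rewrite wsol_r by (auto; lia). rewrite !rsol_wdet by lia.
  replace (0 + 1)%Z with 1%Z by lia.
  assert (HD : 0 < wdet V 1 (Z.of_nat M)) by (apply wdet_pos; auto; lia).
  assert (Hi := inv_wdet_bound w cw (c1 * Lam) Hcw Hprod HLam V (2 * Z.of_nat M + 2) HV HG M ltac:(lia)).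
  fold rho in Hi.
  assert (Hu : u (Z.of_nat M + 1)%Z <= 1) by apply H1.
  apply Rle_trans with (wdet V (1 + 1) (Z.of_nat M) / wdet V 1 (Z.of_nat M) + / wdet V 1 (Z.of_nat M)); [|lra].
  apply (Rmult_le_reg_r (wdet V 1 (Z.of_nat M))); auto.
  replace ((wdet V (1 + 1) (Z.of_nat M) / wdet V 1 (Z.of_nat M) + / wdet V 1 (Z.of_nat M)) * wdet V 1 (Z.of_nat M))
    with (wdet V (1 + 1) (Z.of_nat M) + 1) by (field; lra). lra.
Qed.

(* Replace a configuration by the Dirichlet solution on a symmetric window: the
   separation at larger distances keeps the latter bounded by 1 and decaying. *)
Lemma dirichlet_below k th u b : separated k -> below th u b ->
  (k0 <= k)%nat -> (/ 2) ^ (k + 1) <= b < (/ 2) ^ k ->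
  let M := (k + 1)%nat in
  let f := wsol (orb w W th) (- Z.of_nat M) (Z.of_nat M) 0 in
  wdefect (orb w W th) (- Z.of_nat M) (Z.of_nat M) 0 < delta + 2 * (c1 * Lam * b ^ 2) /\
  (forall n, (n <= M)%nat -> 0 < f (Z.of_nat n) <= rho ^ n) /\
  (forall n, (n <= M)%nat -> 0 < f (- Z.of_nat n)%Z <= rho ^ n).
Proof.
  intros HS Hu Hk Hb M f.
  assert (HLp := Lam_pos). assert (Hrp := rho_positive).
  assert (Hb0 : 0 < b) by (generalize (rpow_half_pos (k + 1)); lra).
  assert (Hnd : forall m, m <> 0%Z -> (Z.abs m <= 2 * Z.of_nat M + 2)%Z -> 2 * b <= nd (IZR m * w)
     /\ (/ 2) ^ k <= nd (IZR m * w)).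
  { intros m Hm1 Hm2. assert (H := Hk0 k m Hk Hm1 ltac:(unfold M in Hm2; lia)).
    generalize (rpow_half_pos k). lra. }
  destruct (good_right k th u b (2 * Z.of_nat M + 2) HS Hu ltac:(lra)
    ltac:(intros m Hm1 Hm2; destruct (Hnd m Hm1 Hm2); split; lra)) as [HG1 HG2].
  set (V := orb w W th) in *.
  assert (HV : pos_form V) by apply Hpos.
  assert (Hcu : cfg V u) by apply Hu.
  assert (H1 := dirichlet_near V u M HV HG1 Hcu ltac:(unfold M; lia)).
  assert (H2 := dirichlet_near (refl V) (refl u) M (pos_form_refl V HV) HG2 (cfg_refl V u Hcu) ltac:(unfold M; lia)).
  rewrite wsol_refl in H2 by (auto; lia). unfold refl in H2.
  (* Here [rho <= 1/16] and [M = k + 1] enter: [16^-(k+1)] is the fourth power of [2^-(k+1) <= b],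
     so the truncation costs less than the allowed excess of the defect. *)
  assert (HrM : 2 * rho ^ M <= c1 * Lam * b ^ 2).
  { assert (Hr4 : rho ^ M <= b ^ 4).
    { apply Rle_trans with ((/ 16) ^ M); [apply pow_incr; lra|].
      replace (/ 16) with ((/ 2) ^ 4) by (simpl; lra). rewrite <- pow_mult, Nat.mul_comm, pow_mult.
      apply pow_incr. split; [apply Rlt_le, rpow_half_pos|unfold M; lra]. }
    assert (b <= / 2 + / 2).
    { assert ((/ 2) ^ k <= 1) by (rewrite <- (pow1 k); apply pow_incr; lra). lra. }
    assert (Hbh : b <= / 2).
    { destruct k as [|k']; [|simpl in Hb; assert ((/ 2) ^ k' <= 1) by (rewrite <- (pow1 k'); apply pow_incr; lra); lra].
      assert (Hx := proj1 (Hnd 1%Z ltac:(lia) ltac:(lia))). generalize (nd_half (1 * w)). lra. }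
    assert (b ^ 4 <= b ^ 2 / 4).
    { replace (b ^ 4) with (b ^ 2 * b ^ 2) by ring.
      assert (b ^ 2 <= (/ 2) ^ 2) by (apply pow_incr; lra).
      unfold Rdiv. apply Rmult_le_compat_l; [apply pow2_ge_0|]. simpl in *. lra. }
    assert (1 * b ^ 2 <= c1 * Lam * b ^ 2) by (apply Rmult_le_compat_r; [apply pow2_ge_0|auto]).
    assert (0 <= b ^ 2) by apply pow2_ge_0. lra. }
  assert (HF : wdefect V (- Z.of_nat M) (Z.of_nat M) 0 <= defect V u + 2 * rho ^ M).
  { rewrite <- wdefect_eq by (auto; lia). unfold defect.
    replace (0 + 1)%Z with 1%Z by lia. replace (0 - 1)%Z with (-1)%Z by lia.
    change (Z.opp 1) with (-1)%Z in H2. lra. }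
  assert (Hdu : defect V u < delta + c1 * Lam * b ^ 2) by apply Hu.
  split; [lra|].
  destruct (finite_argmin (wdefect V (- Z.of_nat M) (Z.of_nat M)) (- Z.of_nat M) (Z.of_nat M) ltac:(lia))
    as [q [Hq Hmin]].
  (* The defect is minimal at the center: at another site [q] it would be at least
     [delta + 4 c1 Lam b^2], since [nd (q w) >= 2 b], while at 0 it is below
     [delta + 2 c1 Lam b^2]. *)
  assert (Hcf : cfg V f).
  { destruct (Z.eq_dec q 0) as [->|Hq0].
    - destruct (wsol_cfg V _ _ 0 HV Hq Hmin) as [Hc _].
      rewrite <- (shiftz_0 V), <- (shiftz_0 f). exact Hc.
    - exfalso. destruct (wsol_cfg V _ _ q HV Hq Hmin) as [Hc Hd].
      destruct (Hnd q Hq0 ltac:(lia)) as [Hn1 Hn2].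
      assert (Hx := separated_good k th u b q HS Hu ltac:(lra) ltac:(lra) Hn2 _ Hc).
      unfold shiftz in Hx. fold V in Hx. rewrite Hd in Hx.
      assert (H0 := Hmin 0%Z ltac:(lia)).
      assert (b ^ 2 * 4 <= nd (IZR q * w) ^ 2) by nra.
      assert (c1 * Lam * (b ^ 2 * 4) <= kk q) by (apply Rmult_le_compat_l; lra).
      assert (0 < c1 * Lam * b ^ 2) by (apply Rmult_lt_0_compat; [lra|apply pow_lt; auto]).
      lra. }
  assert (Hdec : forall n, (n <= M)%nat -> f (Z.of_nat n) <= rho ^ n).
  { intros n Hn. apply (cfg_decay w cw (c1 * Lam) Hcw Hprod HLam V (2 * Z.of_nat M + 2) HV HG1 f n).
    - apply Hcf.
    - intros; apply Hcf; lia.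
    - lia. }
  assert (Hdec' : forall n, (n <= M)%nat -> f (- Z.of_nat n)%Z <= rho ^ n).
  { intros n Hn. apply cfg_refl in Hcf.
    apply (cfg_decay w cw (c1 * Lam) Hcw Hprod HLam (refl V) (2 * Z.of_nat M + 2)
      (pos_form_refl V HV) HG2 (refl f) n).
    - apply Hcf.
    - intros; apply Hcf; lia.
    - lia. }
  split; intros n Hn; split; auto; apply wsol_pos; auto; lia.
Qed.

(** The potential at the center is the defect plus two neighbors that are at most 1; with
    [delta <= 3] this accounts for the 5. Low phases are thus close to the minimum of the
    potential. *)
Lemma below_near th u b : below th u b -> 0 <= b ->
  c0 * Lam * nd (th - tmin) ^ 2 <= 5 + c1 * Lam * b ^ 2.
Proof.
  intros [[H1 [H2 _]] H3] Hb. unfold defect in H3.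
  assert (HW := HWlow th). unfold orb in H3. rewrite Rmult_0_l, Rplus_0_r in H3.
  assert (H4 := H1 1%Z). assert (H5 := H1 (-1)%Z). lra.
Qed.

Lemma orb_period th k : orb w W (th + IZR k) = orb w W th.
Proof.
  extensionality j. unfold orb. rewrite <- (HWper (th + IZR j * w) k). f_equal. ring.
Qed.

(** Both window solutions are tested at the midpoint phase and the two inequalities are added. The
    excess of the defects is below [4 c1 Lam b^2 <= Lam b^2 cv / 8], the sites away from the center
    lose at most [Lam b^2 cv / 8], and strong convexity at the center gains [Lam b^2 cv / 4], so
    [2 delta < 2 delta] results. *)
Lemma midpoint_contradiction th beta k u u' :
  separated k -> (k0 <= k)%nat ->
  (/ 2) ^ (k + 1) <= Rabs beta < (/ 2) ^ k ->
  Rabs (th - tmin) + Rabs beta <= rv ->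
  below th u (Rabs beta) -> below (th + beta) u' (Rabs beta) -> False.
Proof.
  intros HS Hk Hb Hrv' Hu Hu'.
  assert (HLp := Lam_pos). assert (Hrp := rho_positive).
  set (b := Rabs beta) in *.
  assert (Hb0 : 0 < b) by (generalize (rpow_half_pos (k + 1)); lra).
  destruct (dirichlet_below k th u b HS Hu Hk Hb) as [HF [Hfr Hfl]].
  destruct (dirichlet_below k (th + beta) u' b HS Hu' Hk Hb) as [HF' [Hfr' Hfl']].
  set (M := (k + 1)%nat) in *.
  set (U := orb w W th) in *. set (U' := orb w W (th + beta)) in *.
  set (Um := orb w W (th + beta / 2)).
  set (f := wsol U (- Z.of_nat M) (Z.of_nat M) 0) in *.
  set (f' := wsol U' (- Z.of_nat M) (Z.of_nat M) 0) in *.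
  assert (HU : pos_form U) by apply Hpos. assert (HU' : pos_form U') by apply Hpos.
  assert (HUU : forall j, Rabs (U' j - U j) <= Lam * A1 * b).
  { intros j. eapply Rle_trans; [apply HWlip|]. right. unfold b. f_equal. f_equal. ring. }
  assert (Hb2 : Rabs (beta / 2) = b / 2).
  { unfold Rdiv. rewrite Rabs_mult, (Rabs_pos_eq (/ 2)) by lra. reflexivity. }
  assert (HUm : forall j, Rabs (Um j - U j) <= Lam * A1 * (b / 2)).
  { intros j. eapply Rle_trans; [apply HWlip|]. right. rewrite <- Hb2. f_equal. f_equal. ring. }
  assert (Hsq : (beta / 2) ^ 2 = (b / 2) ^ 2) by (rewrite <- Hb2, <- pow2_abs; reflexivity).
  assert (HUmid : forall j, Rabs (U j + U' j - 2 * Um j) <= Lam * A2 * (b / 2) ^ 2).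
  { intros j. rewrite <- Hsq. unfold U, U', Um, orb.
    generalize (HWmid (th + beta / 2 + IZR j * w) (beta / 2)).
    replace (th + beta / 2 + IZR j * w - beta / 2) with (th + IZR j * w) by ring.
    replace (th + beta / 2 + IZR j * w + beta / 2) with (th + beta + IZR j * w) by field. auto. }
  assert (Hrho2 : 2 * rho ^ 2 <= 1) by nra.
  assert (Hside1 : zsum 1 M (fun j => (Um j - U j) * f j ^ 2 + (Um j - U' j) * f' j ^ 2)
     <= Lam * b ^ 2 * (A2 * rho ^ 2 / 2 + 8 * A1 ^ 2 * (Lam * rho) * (rho * (rho * (Lam * A0))) ^ 2)).
  { apply side_sum; auto.
    - apply wsol_center; auto; lia.
    - apply wsol_center; auto; lia.
    - apply wsol_out; lia.
    - apply wsol_out; lia.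
    - intros j Hj. apply wsol_eq; auto; lia.
    - intros j Hj. apply wsol_eq; auto; lia.
    - intros j. apply HWup. }
  assert (Hside2 : zsum 1 M (fun j => (refl Um j - refl U j) * refl f j ^ 2 + (refl Um j - refl U' j) * refl f' j ^ 2)
     <= Lam * b ^ 2 * (A2 * rho ^ 2 / 2 + 8 * A1 ^ 2 * (Lam * rho) * (rho * (rho * (Lam * A0))) ^ 2)).
  { apply side_sum; auto; unfold refl; auto.
    - apply wsol_center; auto; lia.
    - apply wsol_center; auto; lia.
    - apply wsol_out; lia.
    - apply wsol_out; lia.
    - intros j Hj. unfold f. rewrite wsol_eq by (auto; lia).
      replace (- (j + 1))%Z with (- j - 1)%Z by lia. replace (- (j - 1))%Z with (- j + 1)%Z by lia. ring.
    - intros j Hj. unfold f'. rewrite wsol_eq by (auto; lia).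
      replace (- (j + 1))%Z with (- j - 1)%Z by lia. replace (- (j - 1))%Z with (- j + 1)%Z by lia. ring.
    - intros j. apply HWup. }
  assert (Hform := wform U (- Z.of_nat M) (Z.of_nat M) 0 HU ltac:(lia)).
  assert (Hform' := wform U' (- Z.of_nat M) (Z.of_nat M) 0 HU' ltac:(lia)).
  fold f in Hform. fold f' in Hform'.
  replace (Z.to_nat (Z.of_nat M - - Z.of_nat M + 1)) with (M + (1 + M))%nat in * by lia.
  assert (HT1 := HT (th + beta / 2) (- Z.of_nat M)%Z (M + (1 + M)) f ltac:(lia)).
  assert (HT2 := HT (th + beta / 2) (- Z.of_nat M)%Z (M + (1 + M)) f' ltac:(lia)).
  fold Um in HT1, HT2.
  rewrite (form_diff U), Hform in HT1. rewrite (form_diff U'), Hform' in HT2.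
  assert (Hf0 : f 0%Z = 1) by (apply wsol_center; auto; lia).
  assert (Hf0' : f' 0%Z = 1) by (apply wsol_center; auto; lia).
  rewrite Hf0 in HT1. rewrite Hf0' in HT2.
  set (g := fun j => (Um j - U j) * f j ^ 2 + (Um j - U' j) * f' j ^ 2) in *.
  assert (Hsum : zsum (- Z.of_nat M) (M + (1 + M)) (fun j => (Um j - U j) * f j ^ 2)
     + zsum (- Z.of_nat M) (M + (1 + M)) (fun j => (Um j - U' j) * f' j ^ 2)
     = zsum 1 M (fun j => g (- j)%Z) + g 0%Z + zsum 1 M g).
  { rewrite <- zsum_plus. fold g. rewrite !zsum_split. rewrite (zsum_refl M 1 g). cbn [zsum].
    replace (- (1 + Z.of_nat M - 1))%Z with (- Z.of_nat M)%Z by lia.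
    replace (- Z.of_nat M + Z.of_nat M + Z.of_nat 0)%Z with 0%Z by lia.
    replace (- Z.of_nat M + Z.of_nat M + Z.of_nat 1)%Z with 1%Z by lia. ring. }
  change (zsum 1 M (fun j => g (- j)%Z) <= Lam * b ^ 2 *
    (A2 * rho ^ 2 / 2 + 8 * A1 ^ 2 * (Lam * rho) * (rho * (rho * (Lam * A0))) ^ 2)) in Hside2.
  assert (Hg0 : g 0%Z <= - (Lam * cv * (b / 2) ^ 2)).
  { unfold g. rewrite Hf0, Hf0'.
    assert (H := HWconv (th + beta / 2) (beta / 2)). rewrite Hsq in H.
    unfold Um, U, U', orb. rewrite !Rmult_0_l, !Rplus_0_r.
    replace (th + beta / 2 - beta / 2) with th in H by ring.
    replace (th + beta / 2 + beta / 2) with (th + beta) in H by field.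
    assert (Rabs (th + beta / 2 - tmin) + Rabs (beta / 2) <= rv).
    { replace (th + beta / 2 - tmin) with ((th - tmin) + beta / 2) by ring.
      generalize (Rabs_triang (th - tmin) (beta / 2)). rewrite Hb2. lra. }
    specialize (H H0). lra. }
  assert (HLb : 0 < Lam * b ^ 2) by (apply Rmult_lt_0_compat; [auto|apply pow_lt; auto]).
  assert (Hend : Lam * b ^ 2 * (A2 * rho ^ 2 + 16 * A1 ^ 2 * (Lam * rho) * (rho * (rho * (Lam * A0))) ^ 2)
     <= Lam * b ^ 2 * (cv / 8)) by (apply Rmult_le_compat_l; lra).
  assert (Lam * b ^ 2 * (32 * c1) <= Lam * b ^ 2 * cv) by (apply Rmult_le_compat_l; lra).
  assert (0 < Lam * b ^ 2 * c1) by (apply Rmult_lt_0_compat; lra).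
  lra.
Qed.

(** Only distances [b] between [2^-(k+1)] and [2^-k] are new. Both phases being within reach of
    [tmin] gives [c0 Lam b^2 <= 20 + 4 c1 Lam b^2], hence at most 40 because [8 c1 <= c0]. For large
    [Lam] this forces [k >= k0] and puts both phases into the region of convexity, where the
    midpoint argument applies. *)
Lemma separated_all k : separated k.
Proof.
  induction k as [|k IH]; intros th th' u u' Hnd Hu Hu'.
  - simpl in Hnd. generalize (nd_half (th' - th)). lra.
  - set (b := nd (th' - th)) in *.
    destruct (Rle_dec ((/ 2) ^ k) b) as [Hbig|Hsmall].
    { apply (IH th th' u u'); auto. }
    assert (Hb0 : 0 < b) by (generalize (rpow_half_pos (S k)); lra).
    assert (HLp := Lam_pos).
    assert (H1 := below_near th u b Hu ltac:(lra)).
    assert (H2 := below_near th' u' b Hu' ltac:(lra)).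
    assert (Htri : b <= nd (th - tmin) + nd (th' - tmin)).
    { unfold b. replace (th' - th) with ((th' - tmin) + - (th - tmin)) by ring.
      generalize (nd_triang (th' - tmin) (- (th - tmin))). rewrite nd_opp. lra. }
    set (x := nd (th - tmin)) in *. set (y := nd (th' - tmin)) in *.
    assert (Hx0 : 0 <= x) by apply nd_pos. assert (Hy0 : 0 <= y) by apply nd_pos.
    assert (Hc1b : 8 * (c1 * Lam * b ^ 2) <= c0 * Lam * b ^ 2).
    { assert (0 < Lam * b ^ 2) by (apply Rmult_lt_0_compat; [auto|apply pow_lt; auto]). nra. }
    assert (HcL : 0 < c0 * Lam) by (apply Rmult_lt_0_compat; auto).
    assert (Hbb : c0 * Lam * b ^ 2 <= 40).
    { assert (b ^ 2 <= 2 * x ^ 2 + 2 * y ^ 2).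
      { apply Rle_trans with ((x + y) ^ 2); [apply pow_incr; lra|].
        generalize (pow2_ge_0 (x - y)). lra. }
      assert (c0 * Lam * b ^ 2 <= c0 * Lam * (2 * x ^ 2 + 2 * y ^ 2)) by (apply Rmult_le_compat_l; lra).
      lra. }
    assert (Hxx : c0 * Lam * x ^ 2 <= 10) by lra.
    assert (Hb3 : b <= rv / 3).
    { apply Rnot_lt_le. intros Hlt. assert ((rv / 3) ^ 2 < b ^ 2) by (apply pow_lt_2; lra).
      assert (c0 * Lam * (rv / 3) ^ 2 < c0 * Lam * b ^ 2) by (apply Rmult_lt_compat_l; lra). lra. }
    assert (Hx3 : x <= rv / 3).
    { apply Rnot_lt_le. intros Hlt. assert ((rv / 3) ^ 2 < x ^ 2) by (apply pow_lt_2; lra).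
      assert (c0 * Lam * (rv / 3) ^ 2 < c0 * Lam * x ^ 2) by (apply Rmult_lt_compat_l; lra). lra. }
    assert (Hkk : (k0 <= k)%nat).
    { destruct (le_lt_dec k0 k) as [H|H]; auto. exfalso.
      assert (Hp : (/ 4) ^ (k0 + 1) <= b ^ 2).
      { replace (/ 4) with ((/ 2) ^ 2) by (simpl; lra). rewrite <- pow_mult, Nat.mul_comm, pow_mult.
        apply pow_incr. split; [apply Rlt_le, rpow_half_pos|].
        eapply Rle_trans; [|apply Hnd].
        apply (cw_pow_le (/ 2)); [lra|lia]. }
      assert (c0 * Lam * (/ 4) ^ (k0 + 1) <= c0 * Lam * b ^ 2) by (apply Rmult_le_compat_l; lra). lra. }
    (* A midpoint is meaningful only on the line, so representatives of both phases near [tmin] are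
       chosen; the orbits do not change. *)
    destruct (nd_rep (th - tmin)) as [i Hi]. destruct (nd_rep (th' - th)) as [j Hj].
    fold x in Hi. fold b in Hj.
    set (beta := th' - th - IZR j) in *.
    assert (Eth : orb w W (th - IZR i) = orb w W th).
    { rewrite <- (orb_period (th - IZR i) i). f_equal. ring. }
    assert (Eth' : orb w W (th - IZR i + beta) = orb w W th').
    { rewrite <- (orb_period (th - IZR i + beta) (i + j)). f_equal. unfold beta. rewrite plus_IZR. ring. }
    apply (midpoint_contradiction (th - IZR i) beta k u u'); auto; rewrite ?Hj.
    + split; [|lra]. rewrite Nat.add_1_r. auto.
    + replace (th - IZR i - tmin) with (th - tmin - IZR i) by ring. rewrite Hi. lra.
    + unfold below. rewrite Eth. exact Hu.
    + unfold below. rewrite Eth'. exact Hu'.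
Qed.

Theorem separation th th' u u' : 0 < nd (th' - th) ->
  cfg (orb w W th) u -> cfg (orb w W th') u' ->
  defect (orb w W th) u < delta + c1 * Lam * nd (th' - th) ^ 2 ->
  delta + c1 * Lam * nd (th' - th) ^ 2 <= defect (orb w W th') u'.
Proof.
  intros Hnd Hu Hu' Hd. apply Rnot_lt_le. intros Hd'.
  destruct (pow_lt_1_zero (/ 2) ltac:(rewrite Rabs_pos_eq; lra) _ Hnd) as [N HN].
  specialize (HN N ltac:(lia)). rewrite Rabs_pos_eq in HN by (apply Rlt_le, rpow_half_pos).
  apply (separated_all N th th' u u'); [lra| |]; split; auto.
Qed.

(** A phase that attains [delta] is low at every distance, so it is separated from all other phases
    of its orbit and [good] holds without restriction on the range. *)
Theorem minimizer_decay th u : cfg (orb w W th) u -> defect (orb w W th) u = delta ->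
  forall n, u (Z.of_nat n) <= rho ^ n /\ u (- Z.of_nat n)%Z <= rho ^ n.
Proof.
  intros Hu Hd n. assert (HLp := Lam_pos).
  assert (Hnd : forall m, m <> 0%Z -> 0 < nd (IZR m * w)).
  { intros m Hm. assert (H := Hk0 (k0 + Z.to_nat (Z.abs m)) m ltac:(lia) Hm ltac:(lia)).
    generalize (rpow_half_pos (k0 + Z.to_nat (Z.abs m))). lra. }
  assert (HG : forall m u', m <> 0%Z -> cfg (shiftz m (orb w W th)) u' ->
     kk m <= defect (shiftz m (orb w W th)) u').
  { intros m u' Hm Hu'. rewrite shiftz_orb in *. assert (Hm' := Hnd m Hm).
    assert (0 < kk m) by (apply Rmult_lt_0_compat; [lra|apply pow_lt; auto]).
    assert (H0 := separation th (th + IZR m * w) u u').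
    replace (th + IZR m * w - th) with (IZR m * w) in H0 by ring.
    unfold kk in *. specialize (H0 Hm' Hu Hu' ltac:(lra)). lra. }
  split.
  - apply (cfg_decay w cw (c1 * Lam) Hcw Hprod HLam (orb w W th) (2 * Z.of_nat n) (Hpos th)).
    + intros m u' Hm Hu'. apply HG; auto; lia.
    + apply Hu.
    + intros k Hk. apply Hu; lia.
    + lia.
  - assert (Hur := cfg_refl _ _ Hu).
    apply (cfg_decay w cw (c1 * Lam) Hcw Hprod HLam (refl (orb w W th)) (2 * Z.of_nat n)
      (pos_form_refl _ (Hpos th)) ) with (u := refl u).
    + intros m u' Hm Hu'. rewrite shiftz_refl in *. apply cfg_refl in Hu'. rewrite refl_refl in Hu'.
      assert (H0 := HG (- m)%Z _ ltac:(lia) Hu').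
      rewrite <- (defect_refl (shiftz (- m) (orb w W th))), refl_refl in H0.
      unfold kk in H0. rewrite opp_IZR, Ropp_mult_distr_l_reverse, nd_opp in H0. exact H0.
    + apply Hur.
    + intros k Hk. apply Hur; lia.
    + lia.
Qed.
End Separation.

(** * The spectrum and the quadratic form *)

Lemma lim_le (u : nat -> R) (l K : R) : is_lim_seq u l -> (forall n, u n <= K) -> l <= K.
Proof. intros H1 H2. exact (is_lim_seq_le u (fun _ => K) l K H2 H1 (is_lim_seq_const K)). Qed.

Lemma l2_partial_zsum u N :
  l2_partial u N = zsum (- Z.of_nat N - 1) (2 * N + 2) (fun k => u k ^ 2).
Proof.
  unfold l2_partial. induction N as [|N IH].
  - simpl. lra.
  - rewrite tech5, IH.
    replace (2 * S N + 2)%nat with (1 + ((2 * N + 2) + 1))%nat by lia.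
    rewrite (zsum_split _ 1), (zsum_split _ (2 * N + 2)). cbn [zsum].
    replace (- Z.of_nat (S N) - 1 + Z.of_nat 1)%Z with (- Z.of_nat N - 1)%Z by lia.
    replace (- Z.of_nat N - 1 + Z.of_nat (2 * N + 2) + Z.of_nat 0)%Z with (Z.of_nat (S N)) by lia.
    replace (- Z.of_nat (S N) - 1 + Z.of_nat 0)%Z with (- Z.of_nat (S N) - 1)%Z by lia. lra.
Qed.

Lemma l2_partial_growing u : Un_growing (l2_partial u).
Proof.
  intros N. unfold l2_partial. rewrite tech5.
  generalize (pow2_ge_0 (u (Z.of_nat (S N)))) (pow2_ge_0 (u (- Z.of_nat (S N) - 1)%Z)). lra.
Qed.

Lemma l2_partial_le u S N : l2sum u S -> l2_partial u N <= S.
Proof. intros H. apply growing_ineq; auto. apply l2_partial_growing. Qed.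

Lemma l2_zsum_le u S p n : l2sum u S -> zsum p n (fun k => u k ^ 2) <= S.
Proof.
  intros H. pose (N := (Z.to_nat (Z.abs p) + n)%nat).
  eapply Rle_trans; [|apply (l2_partial_le u S N H)]. rewrite l2_partial_zsum.
  apply zsum_sub_le; [intros; apply pow2_ge_0| |]; unfold N; lia.
Qed.

Lemma l2_bounded u K : (forall N, l2_partial u N <= K) -> exists S, l2sum u S /\ S <= K.
Proof.
  intros H. destruct (growing_cv (l2_partial u)) as [S HS].
  - apply l2_partial_growing.
  - exists K. intros x [N ->]. apply H.
  - exists S. split; auto. apply (lim_le (l2_partial u)); auto. apply is_lim_seq_Reals; auto.
Qed.

Lemma l2sum_finite u p n : (forall k, (k < p \/ p + Z.of_nat n <= k)%Z -> u k = 0) ->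
  l2sum u (zsum p n (fun k => u k ^ 2)).
Proof.
  intros H eps Heps. exists (Z.to_nat (Z.abs p) + n)%nat. intros N HN.
  rewrite l2_partial_zsum.
  pose (i := Z.to_nat (p + Z.of_nat N + 1)). pose (j := (2 * N + 2 - i - n)%nat).
  replace (2 * N + 2)%nat with (i + (n + j))%nat by (unfold j, i; lia).
  rewrite !zsum_split.
  rewrite (zsum_zero _ i) by (intros; rewrite H; [ring|unfold i in *; lia]).
  rewrite (zsum_zero _ j) by (intros; rewrite H; [ring|unfold i in *; lia]).
  replace (- Z.of_nat N - 1 + Z.of_nat i)%Z with p by (unfold i; lia).
  unfold Rdist. rewrite Rplus_0_l, Rplus_0_r, Rminus_diag, Rabs_R0. auto.
Qed.

Lemma form_step U p n u : form U p (S (S n)) u = form U p (S n) u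
  + U (p + Z.of_nat (S n))%Z * u (p + Z.of_nat (S n))%Z ^ 2
  - 2 * u (p + Z.of_nat n)%Z * u (p + Z.of_nat (S n))%Z.
Proof.
  unfold form. cbn [zsum].
  replace (p + Z.of_nat (S (S n)) - 1)%Z with (p + Z.of_nat (S n))%Z by lia.
  replace (p + Z.of_nat (S n) - 1)%Z with (p + Z.of_nat n)%Z by lia.
  replace (p + Z.of_nat (S (S n)))%Z with (p + Z.of_nat (S n) + 1)%Z by lia.
  replace (p + Z.of_nat n + 1)%Z with (p + Z.of_nat (S n))%Z by lia. ring.
Qed.

Lemma form_one U p u : form U p 1 u = U p * u p ^ 2.
Proof.
  unfold form. cbn [zsum]. simpl Z.of_nat. rewrite Z.add_0_r.
  replace (p + 1 - 1)%Z with p by lia. ring.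
Qed.

Lemma form_upper U p n u B : (0 < n)%nat -> (forall k, U k <= B) ->
  form U p n u <= (B + 2) * zsum p n (fun k => u k ^ 2).
Proof.
  intros Hn HU. destruct n as [|n]; [lia|].
  (* The square at the last site is kept in reserve for the cross term with the next site. *)
  enough (form U p (S n) u <= (B + 2) * zsum p (S n) (fun k => u k ^ 2) - u (p + Z.of_nat n)%Z ^ 2)
    by (generalize (pow2_ge_0 (u (p + Z.of_nat n)%Z)); lra).
  clear Hn. induction n as [|n IH].
  - rewrite form_one. cbn [zsum]. simpl Z.of_nat. rewrite Z.add_0_r.
    assert (U p * u p ^ 2 <= B * u p ^ 2) by (apply Rmult_le_compat_r; [apply pow2_ge_0|auto]).
    generalize (pow2_ge_0 (u p)). lra.
  - rewrite form_step.
    change (zsum p (S (S n)) (fun k => u k ^ 2))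
      with (zsum p (S n) (fun k => u k ^ 2) + u (p + Z.of_nat (S n))%Z ^ 2).
    set (x := u (p + Z.of_nat (S n))%Z) in *. set (y := u (p + Z.of_nat n)%Z) in *.
    assert (U (p + Z.of_nat (S n))%Z * x ^ 2 <= B * x ^ 2)
      by (apply Rmult_le_compat_r; [apply pow2_ge_0|auto]).
    generalize (pow2_ge_0 (x + y)). lra.
Qed.

Lemma form_lower U p n u c : (0 < n)%nat -> (forall k, c + 2 <= U k) ->
  c * zsum p n (fun k => u k ^ 2) <= form U p n u.
Proof.
  intros Hn HU. rewrite <- zsum_scal.
  apply (barta U (fun _ => 1) (fun _ => c)); auto; intros; try lra.
  specialize (HU k). lra.
Qed.

Lemma form_scale U p n u t : form U p n (fun k => t * u k) = t ^ 2 * form U p n u.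
Proof.
  unfold form. rewrite Rmult_plus_distr_l, <- zsum_scal. f_equal; [|ring].
  apply zsum_ext. intros; ring.
Qed.

Lemma form_expand U p n u g t : (0 < n)%nat ->
  form U p n (fun k => u k + t * g k) =
  form U p n u + 2 * t * (zsum p n (fun k => g k * (U k * u k - u (k + 1)%Z - u (k - 1)%Z))
     + u (p - 1)%Z * g p + g (p + Z.of_nat n - 1)%Z * u (p + Z.of_nat n)%Z)
  + t ^ 2 * form U p n g.
Proof.
  intros Hn. destruct n as [|n]; [lia|]. clear Hn. induction n as [|n IH].
  - rewrite !form_one. cbn [zsum]. simpl Z.of_nat. rewrite !Z.add_0_r.
    replace (p + 1 - 1)%Z with p by lia. ring.
  - rewrite !form_step, IH.
    change (zsum p (S (S n)) (fun k => g k * (U k * u k - u (k + 1)%Z - u (k - 1)%Z)))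
      with (zsum p (S n) (fun k => g k * (U k * u k - u (k + 1)%Z - u (k - 1)%Z))
            + (fun k => g k * (U k * u k - u (k + 1)%Z - u (k - 1)%Z)) (p + Z.of_nat (S n))%Z).
    cbv beta.
    replace (p + Z.of_nat (S (S n)) - 1)%Z with (p + Z.of_nat (S n))%Z by lia.
    replace (p + Z.of_nat (S n) - 1)%Z with (p + Z.of_nat n)%Z by lia.
    replace (p + Z.of_nat (S (S n)))%Z with (p + Z.of_nat (S n) + 1)%Z by lia. ring.
Qed.

Section Spectrum.
Variables (lam w : R) (v : R -> R) (B : R).
Let V (k : Z) : R := lam ^ 2 * v (0 + IZR k * w).
Hypothesis HV : forall k, Rabs (V k) <= B.

Lemma Hop_V u k : Hop lam w v 0 u k = V k * u k - u (k + 1)%Z - u (k - 1)%Z.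
Proof. unfold Hop, V. ring. Qed.

Lemma form_window_extend U p n u : (0 < n)%nat ->
  (forall k, (k < p \/ p + Z.of_nat n <= k)%Z -> u k = 0) ->
  form U (p - 1) (n + 2) u = form U p n u.
Proof.
  intros Hn H. rewrite !form_defect.
  replace (n + 2)%nat with (1 + (n + 1))%nat by lia. rewrite !zsum_split. cbn [zsum].
  rewrite (H (p - 1 + Z.of_nat 0)%Z) by lia. rewrite (H (p - 1 - 1)%Z) by lia.
  rewrite (H (p - 1 + Z.of_nat (1 + (n + 1)))%Z) by lia. rewrite (H (p - 1)%Z) by lia.
  rewrite (H (p + Z.of_nat n)%Z) by lia.
  rewrite (H (p - 1 + Z.of_nat 1 + Z.of_nat n + Z.of_nat 0)%Z) by lia.
  replace (p - 1 + Z.of_nat 1)%Z with p by lia. ring.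
Qed.

(* The infimum of the Rayleigh quotient admits approximate eigenvectors, hence lies
   in the spectrum. *)
Lemma form_nonneg_of_resolvent E0 :
  (forall E, E < E0 -> resolvent lam w v 0 E) ->
  forall p n u, (0 < n)%nat -> 0 <= form (fun k => V k - E0) p n u.
Proof.
  intros HR p0 n0 u0 Hn0. apply Rnot_lt_le. intros Hneg.
  set (nsq := fun p n (u : Z -> R) => zsum p n (fun k => u k ^ 2)).
  set (A := fun x => exists p n u, (0 < n)%nat /\ nsq p n u = 1 /\ x = - form V p n u).
  assert (HVb : forall k, - B <= V k <= B).
  { intros k. specialize (HV k). apply Rabs_le_between in HV. lra. }
  assert (Hfsub : forall p n u c, form (fun k => V k - c) p n u = form V p n u - c * nsq p n u).
  { intros. rewrite (form_diff V). unfold nsq.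
    rewrite (zsum_ext _ _ (fun k => (V k - c - V k) * u k ^ 2) (fun k => - c * u k ^ 2)) by (intros; ring).
    rewrite zsum_scal. ring. }
  assert (Hnn : forall p n u, 0 <= nsq p n u).
  { intros. apply zsum_nonneg. intros; apply pow2_ge_0. }
  assert (Hnorm : forall p n u, (0 < n)%nat -> 0 < nsq p n u ->
     exists u', nsq p n u' = 1 /\ form V p n u' = form V p n u / nsq p n u).
  { intros p n u Hn Hpos. exists (fun k => / sqrt (nsq p n u) * u k). split.
    - unfold nsq at 1. rewrite (zsum_ext _ _ _ (fun k => / nsq p n u * u k ^ 2)).
      + rewrite zsum_scal. fold (nsq p n u). field. lra.
      + intros k _. rewrite Rpow_mult_distr, pow_inv, pow2_sqrt; auto.
    - rewrite form_scale, pow_inv, pow2_sqrt by auto. unfold Rdiv; ring. }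
  assert (Hzero : forall p n u, (0 < n)%nat -> nsq p n u = 0 -> form V p n u = 0).
  { intros p n u Hn H0. apply Rle_antisym.
    - generalize (form_upper V p n u B Hn ltac:(apply HVb)). fold (nsq p n u). rewrite H0. lra.
    - generalize (form_lower V p n u (- B - 2) Hn ltac:(intros k; specialize (HVb k); lra)).
      fold (nsq p n u). rewrite H0. lra. }
  destruct (completeness A) as [s [Hub Hlub]].
  { exists (B + 2). intros x [p [n [u [Hn [H1 ->]]]]].
    generalize (form_lower V p n u (- B - 2) Hn ltac:(intros k; specialize (HVb k); lra)).
    fold (nsq p n u). rewrite H1. lra. }
  { rewrite Hfsub in Hneg. destruct (Rle_lt_or_eq_dec _ _ (Hnn p0 n0 u0)) as [Hp|Hp].
    - destruct (Hnorm p0 n0 u0 Hn0 Hp) as [u' [H1 H2]]. exists (- form V p0 n0 u'). exists p0, n0, u'. auto.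
    - rewrite Hzero in Hneg by auto. rewrite <- Hp in Hneg. lra. }
  set (mu := - s).
  assert (Hmu : forall p n u, (0 < n)%nat -> 0 <= form (fun k => V k - mu) p n u).
  { intros p n u Hn. rewrite Hfsub. destruct (Rle_lt_or_eq_dec _ _ (Hnn p n u)) as [Hp|Hp].
    - destruct (Hnorm p n u Hn Hp) as [u' [H1 H2]].
      assert (H3 : - form V p n u' <= s) by (apply Hub; exists p, n, u'; auto).
      rewrite H2 in H3.
      assert (mu * nsq p n u <= form V p n u / nsq p n u * nsq p n u)
        by (apply Rmult_le_compat_r; unfold mu; lra).
      unfold Rdiv in H. rewrite Rmult_assoc, Rinv_l in H by lra. lra.
    - rewrite Hzero by auto. rewrite <- Hp. lra. }
  assert (HmuE : mu < E0).
  { rewrite Hfsub in Hneg. specialize (Hmu p0 n0 u0 Hn0). rewrite Hfsub in Hmu.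
    specialize (Hnn p0 n0 u0). nra. }
  destruct (HR mu HmuE) as [G [_ [[M HM] [HG1 _]]]].
  assert (HVm : forall k, V k - mu <= B + Rabs mu).
  { intros k. specialize (HVb k). generalize (Rle_abs (- mu)). rewrite Rabs_Ropp. lra. }
  set (K := B + Rabs mu + 2).
  assert (HK : 0 < K).
  { unfold K. specialize (HVb 0%Z). generalize (Rabs_pos mu). lra. }
  (* Chosen so that the bound [M] on the resolvent maps a residual of squared norm [K eps] to a
     vector of squared norm at most 1/2, although that vector is normalized. *)
  set (eps := / (2 * K * (Rabs M + 1))).
  assert (HM1 : 0 < Rabs M + 1) by (generalize (Rabs_pos M); lra).
  assert (Heps : 0 < eps) by (apply Rinv_0_lt_compat; nra).
  assert (Hex : exists p n u, (0 < n)%nat /\ nsq p n u = 1 /\ form V p n u <= mu + eps).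
  { apply NNPP. intros Hno. assert (s <= s - eps); [|lra].
    apply Hlub. intros x [p [n [u [Hn [H1 ->]]]]].
    apply Rnot_lt_le. intros Hlt. apply Hno. exists p, n, u. unfold mu. repeat split; auto. lra. }
  destruct Hex as [p [n [u [Hn [H1 H2]]]]].
  set (ub := fun k => if Z_le_dec p k then (if Z_lt_dec k (p + Z.of_nat n) then u k else 0) else 0).
  assert (Hub0 : forall k, (k < p \/ p + Z.of_nat n <= k)%Z -> ub k = 0).
  { intros k Hk. unfold ub. destruct (Z_le_dec p k); auto. destruct (Z_lt_dec k (p + Z.of_nat n)); auto. lia. }
  assert (Hub1 : forall k, (p <= k < p + Z.of_nat n)%Z -> ub k = u k).
  { intros k Hk. unfold ub. destruct (Z_le_dec p k); [|lia]. destruct (Z_lt_dec k (p + Z.of_nat n)); auto. lia. }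
  set (U := fun k => V k - mu).
  set (g := fun k => U k * ub k - ub (k + 1)%Z - ub (k - 1)%Z).
  assert (Hg0 : forall k, (k < p - 1 \/ p - 1 + Z.of_nat (n + 2) <= k)%Z -> g k = 0).
  { intros k Hk. unfold g. rewrite !Hub0 by lia. ring. }
  assert (Hfub : form U (p - 1) (n + 2) ub <= eps).
  { rewrite form_window_extend by auto.
    rewrite (form_ext U U p n ub u) by (auto; intros; split; auto).
    unfold U. rewrite Hfsub, H1. lra. }
  set (Sg := zsum (p - 1) (n + 2) (fun k => g k ^ 2)).
  (* Cauchy-Schwarz for the nonnegative form of [V - mu], obtained by testing [ub - g / K]: the
     squared norm of the residual is at most [K] times the form at [ub]. *)
  assert (HSg : Sg <= K * eps).
  { assert (H3 := Hmu (p - 1)%Z (n + 2)%nat (fun k => ub k + (- / K) * g k) ltac:(lia)).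
    fold U in H3. rewrite form_expand in H3 by lia.
    rewrite (Hub0 (p - 1 - 1)%Z) in H3 by lia.
    rewrite (Hub0 (p - 1 + Z.of_nat (n + 2))%Z) in H3 by lia.
    rewrite (zsum_ext _ _ (fun k => g k * _) (fun k => g k ^ 2)) in H3 by (intros; unfold g; ring).
    fold Sg in H3.
    assert (H4 := form_upper U (p - 1) (n + 2) g (B + Rabs mu) ltac:(lia) HVm). fold Sg K in H4.
    assert (Hi : 0 < / K) by (apply Rinv_0_lt_compat; auto).
    assert (H5 : (- / K) ^ 2 * form U (p - 1) (n + 2) g <= / K * Sg).
    { replace (/ K * Sg) with ((- / K) ^ 2 * (K * Sg)) by (field; lra).
      apply Rmult_le_compat_l; auto. apply pow2_ge_0. }
    assert (H6 : / K * Sg <= eps) by lra.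
    apply (Rmult_le_compat_l K) in H6; [|lra]. rewrite <- Rmult_assoc, Rinv_r in H6; lra. }
  assert (HL1 : l2sum ub 1).
  { rewrite <- H1. unfold nsq. rewrite (zsum_ext p n (fun k => u k ^ 2) (fun k => ub k ^ 2)).
    - apply l2sum_finite; auto.
    - intros k Hk. rewrite Hub1; auto. }
  assert (HL2 : l2sum g Sg) by (apply l2sum_finite; auto).
  destruct (HM g Sg HL2) as [S' [HS1 HS2]].
  assert (HGg : G g = ub).
  { extensionality k. rewrite <- (HG1 ub (ex_intro _ 1 HL1) k). f_equal.
    extensionality m. rewrite Hop_V. unfold g, U. ring. }
  rewrite HGg in HS1. assert (S' = 1) by (apply (UL_sequence (l2_partial ub)); auto). subst S'.
  assert (HSn : 0 <= Sg) by (apply zsum_nonneg; intros; apply pow2_ge_0).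
  assert (M * Sg <= (Rabs M + 1) * (K * eps)).
  { apply Rle_trans with ((Rabs M + 1) * Sg).
    - apply Rmult_le_compat_r; auto. generalize (Rle_abs M). lra.
    - apply Rmult_le_compat_l; lra. }
  unfold eps in H. replace ((Rabs M + 1) * (K * / (2 * K * (Rabs M + 1)))) with (/ 2) in H by (field; lra).
  lra.
Qed.
End Spectrum.

(** * A coercive form at [E0] places [E0] in the resolvent set *)

Lemma in_l2_bounded u K : (forall N, l2_partial u N <= K) -> in_l2 u.
Proof. intros H. destruct (l2_bounded u K H) as [S [HS _]]. exists S; auto. Qed.

Lemma l2_comb u1 u2 a b : in_l2 u1 -> in_l2 u2 -> in_l2 (fun m => a * u1 m + b * u2 m).
Proof.
  intros [S1 H1] [S2 H2]. apply (in_l2_bounded _ (2 * a ^ 2 * S1 + 2 * b ^ 2 * S2)).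
  intros N. rewrite l2_partial_zsum.
  eapply Rle_trans; [apply (zsum_le _ _ _ (fun k => 2 * a ^ 2 * u1 k ^ 2 + 2 * b ^ 2 * u2 k ^ 2))|].
  - intros k _. generalize (pow2_ge_0 (a * u1 k - b * u2 k)). lra.
  - rewrite zsum_plus, !zsum_scal, <- !l2_partial_zsum.
    apply Rplus_le_compat; (apply Rmult_le_compat_l; [|apply l2_partial_le; auto]);
    apply Rmult_le_pos; try lra; apply pow2_ge_0.
Qed.

Lemma l2_scal_sum u S a : l2sum u S -> l2sum (fun m => a * u m) (a ^ 2 * S).
Proof.
  intros H. apply is_lim_seq_Reals. apply is_lim_seq_Reals in H.
  apply (is_lim_seq_ext (fun N => a ^ 2 * l2_partial u N)).
  - intros N. rewrite !l2_partial_zsum, <- zsum_scal. apply zsum_ext. intros; ring.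
  - exact (is_lim_seq_scal_l _ (a ^ 2) S H).
Qed.

Lemma l2_entry u S k : l2sum u S -> u k ^ 2 <= S.
Proof. intros H. generalize (l2_zsum_le u S k 1 H). simpl. rewrite Z.add_0_r. lra. Qed.

Lemma l2_tail u T : l2sum u T ->
  is_lim_seq (fun N => u (Z.of_nat N) ^ 2 + u (- Z.of_nat N - 1)%Z ^ 2) 0.
Proof.
  intros H. apply is_lim_seq_Reals in H. apply is_lim_seq_incr_1.
  apply (is_lim_seq_ext (fun N => l2_partial u (S N) - l2_partial u N)).
  - intros N. unfold l2_partial. rewrite tech5. ring.
  - replace (Finite 0) with (Finite (T - T)) by (f_equal; ring).
    apply is_lim_seq_minus'; auto. apply (is_lim_seq_incr_1 (l2_partial u)); auto.
Qed.

Section Resolvent.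
Variables (lam w : R) (v : R -> R) (B : R).
Let V (k : Z) : R := lam ^ 2 * v (0 + IZR k * w).
Hypothesis HV : forall k, Rabs (V k) <= B.

Lemma Hop_l2 u E : in_l2 u -> in_l2 (fun m => Hop lam w v 0 u m - E * u m).
Proof.
  intros [S HS]. set (K := B + Rabs E).
  apply (in_l2_bounded _ (3 * (S + S + K ^ 2 * S))).
  intros N. rewrite l2_partial_zsum.
  assert (Hb : forall k, Rabs (V k - E) <= K).
  { intros k. eapply Rle_trans; [apply Rabs_triang|]. rewrite Rabs_Ropp. unfold K. specialize (HV k). lra. }
  eapply Rle_trans; [apply (zsum_le _ _ _ (fun k => 3 * ((u (k + 1)%Z ^ 2 + u (k + -1)%Z ^ 2) + K ^ 2 * u k ^ 2)))|].
  - intros k _. unfold Hop. fold (V k). replace (k + -1)%Z with (k - 1)%Z by lia.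
    set (a := u (k + 1)%Z). set (b := u (k - 1)%Z).
    replace (- a - b + V k * u k - E * u k) with (- a - b + (V k - E) * u k) by ring.
    assert (((V k - E) * u k) ^ 2 <= K ^ 2 * u k ^ 2).
    { rewrite Rpow_mult_distr. apply Rmult_le_compat_r; [apply pow2_ge_0|].
      rewrite <- (pow2_abs (V k - E)). apply pow_incr. split; [apply Rabs_pos|apply Hb]. }
    set (c := (V k - E) * u k) in *.
    generalize (pow2_ge_0 (a - b)) (pow2_ge_0 (a + c)) (pow2_ge_0 (b + c)). lra.
  - rewrite zsum_scal, !zsum_plus, zsum_scal.
    rewrite (zsum_shift _ _ (fun k => u k ^ 2) 1), (zsum_shift _ _ (fun k => u k ^ 2) (-1)).
    apply Rmult_le_compat_l; [lra|].
    repeat apply Rplus_le_compat; try (apply l2_zsum_le; auto).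
    apply Rmult_le_compat_l; [apply pow2_ge_0|apply l2_zsum_le; auto].
Qed.

Variables (E0 c : R).
Hypothesis Hc : 0 < c.
Hypothesis Hcoer : forall p n u, (0 < n)%nat ->
  c * zsum p n (fun k => u k ^ 2) <= form (fun k => V k - E0) p n u.

(** Pairing the equation with [f] on growing windows leaves boundary products, which vanish in the
    limit because [f] is square summable. The bound is uniform in [E <= E0], as the limit of the
    resolvents below requires. *)
Lemma coercive_bound E f g S : E <= E0 -> in_l2 f -> l2sum g S ->
  (forall n, Hop lam w v 0 f n - E * f n = g n) ->
  forall N, l2_partial f N <= S / c ^ 2.
Proof.
  intros HE [Sf Hf] Hg Heq N.
  set (bd := fun M : nat => 2 * ((f (Z.of_nat M) ^ 2 + f (- Z.of_nat M - 1)%Z ^ 2)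
     + (f (Z.of_nat (M + 1)) ^ 2 + f (- Z.of_nat (M + 1) - 1)%Z ^ 2))).
  assert (Hbd : is_lim_seq bd 0).
  { assert (H := l2_tail f Sf Hf). unfold bd.
    replace (Finite 0) with (Rbar_mult 2 (0 + 0)) by (simpl; f_equal; ring).
    apply is_lim_seq_scal_l. apply is_lim_seq_plus'; auto.
    apply (is_lim_seq_incr_n (fun N => f (Z.of_nat N) ^ 2 + f (- Z.of_nat N - 1)%Z ^ 2) 1) in H.
    auto. }
  assert (Hmain : forall M, l2_partial f M <= S / c ^ 2 + 2 / c * bd M).
  { intros M. rewrite l2_partial_zsum.
    set (p := (- Z.of_nat M - 1)%Z). set (n := (2 * M + 2)%nat).
    set (X := zsum p n (fun k => f k ^ 2)).
    assert (H1 : c * X <= form (fun k => V k - E) p n f).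
    { eapply Rle_trans; [apply Hcoer; unfold n; lia|].
      rewrite (form_diff (fun k => V k - E0) (fun k => V k - E)).
      assert (0 <= zsum p n (fun k => (V k - E - (V k - E0)) * f k ^ 2)); [|lra].
      apply zsum_nonneg. intros. apply Rmult_le_pos; [lra|apply pow2_ge_0]. }
    rewrite form_defect in H1.
    rewrite (zsum_ext p n (fun k => f k * _) (fun k => f k * g k)) in H1.
    2:{ intros k _. rewrite <- Heq. unfold Hop. fold (V k). ring. }
    assert (H2 : zsum p n (fun k => f k * g k) <= c / 2 * X + / (2 * c) * S).
    { eapply Rle_trans; [apply (zsum_le _ _ _ (fun k => c / 2 * f k ^ 2 + / (2 * c) * g k ^ 2))|].
      - intros k _.
        assert (0 <= / (2 * c) * (c * f k - g k) ^ 2).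
        { apply Rmult_le_pos; [apply Rlt_le, Rinv_0_lt_compat; lra|apply pow2_ge_0]. }
        replace (/ (2 * c) * (c * f k - g k) ^ 2)
          with (c / 2 * f k ^ 2 + / (2 * c) * g k ^ 2 - f k * g k) in H by (field; lra). lra.
      - rewrite zsum_plus, !zsum_scal. fold X. apply Rplus_le_compat_l, Rmult_le_compat_l.
        + apply Rlt_le, Rinv_0_lt_compat; lra.
        + apply l2_zsum_le; auto. }
    assert (H3 : f (p - 1)%Z * f p + f (p + Z.of_nat n - 1)%Z * f (p + Z.of_nat n)%Z <= bd M).
    { unfold bd. replace (p - 1)%Z with (- Z.of_nat (M + 1) - 1)%Z by (unfold p; lia).
      replace (p + Z.of_nat n - 1)%Z with (Z.of_nat M) by (unfold p, n; lia).
      replace (p + Z.of_nat n)%Z with (Z.of_nat (M + 1)) by (unfold p, n; lia).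
      unfold p. set (x1 := f (- Z.of_nat (M + 1) - 1)%Z). set (x2 := f (- Z.of_nat M - 1)%Z).
      set (x3 := f (Z.of_nat M)). set (x4 := f (Z.of_nat (M + 1))).
      generalize (pow2_ge_0 (x1 - x2)) (pow2_ge_0 (x3 - x4)) (pow2_ge_0 x1) (pow2_ge_0 x2)
        (pow2_ge_0 x3) (pow2_ge_0 x4). lra. }
    assert (H4 : c / 2 * X <= / (2 * c) * S + bd M) by lra.
    apply (Rmult_le_compat_l (2 / c)) in H4; [|apply Rlt_le, Rdiv_lt_0_compat; lra].
    replace (2 / c * (c / 2 * X)) with X in H4 by (field; lra).
    eapply Rle_trans; [apply H4|]. right. field. lra. }
  assert (Hlim : is_lim_seq (fun M => S / c ^ 2 + 2 / c * bd (M + N)%nat) (S / c ^ 2)).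
  { replace (Finite (S / c ^ 2)) with (Finite (S / c ^ 2 + 2 / c * 0)) by (f_equal; ring).
    apply is_lim_seq_plus'; [apply is_lim_seq_const|].
    apply (is_lim_seq_scal_l (fun M => bd (M + N)%nat) (2 / c) 0).
    apply (is_lim_seq_incr_n bd N); auto. }
  refine (is_lim_seq_le (fun _ => l2_partial f N) _ _ _ _ (is_lim_seq_const _) Hlim).
  intros M. eapply Rle_trans; [|apply Hmain].
  apply tech9; [apply l2_partial_growing|lia].
Qed.

Hypothesis HR : forall E, E < E0 -> resolvent lam w v 0 E.

(** The inverse at [E0] is the entrywise limit of the inverses at [E0 - 1/(j+1)]; the uniform bound
    makes them a Cauchy sequence and passes to the limit. *)
Lemma coercive_resolvent : resolvent lam w v 0 E0.
Proof.
  set (En := fun j : nat => E0 - / (INR j + 1)).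
  assert (Hinv : forall j : nat, 0 < / (INR j + 1)).
  { intros j. apply Rinv_0_lt_compat. generalize (pos_INR j). lra. }
  assert (HEn : forall j, En j < E0) by (intros j; unfold En; specialize (Hinv j); lra).
  assert (Hlim0 : is_lim_seq (fun j => / (INR j + 1)) 0).
  { apply (is_lim_seq_ext (fun j => / INR (S j))); [intros; rewrite S_INR; auto|].
    apply (is_lim_seq_incr_1 (fun j => / INR j)).
    replace (Finite 0) with (Rbar_inv p_infty) by reflexivity.
    apply is_lim_seq_inv; [apply is_lim_seq_INR|easy]. }
  assert (HG : exists G : nat -> (Z -> R) -> Z -> R, forall j,
    (forall u1 u2 a b, in_l2 u1 -> in_l2 u2 ->
       forall n, G j (fun m => a * u1 m + b * u2 m) n = a * G j u1 n + b * G j u2 n) /\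
    (exists M, forall u S, l2sum u S -> exists S', l2sum (G j u) S' /\ S' <= M * S) /\
    (forall u, in_l2 u -> forall n, G j (fun m => Hop lam w v 0 u m - En j * u m) n = u n) /\
    (forall u, in_l2 u -> forall n, Hop lam w v 0 (G j u) n - En j * G j u n = u n)).
  { exists (fun j => proj1_sig (constructive_indefinite_description _ (HR (En j) (HEn j)))).
    intros j. destruct (constructive_indefinite_description _ (HR (En j) (HEn j))) as [G HGj]. exact HGj. }
  destruct HG as [G HG].
  assert (Hin : forall j u, in_l2 u -> in_l2 (G j u)).
  { intros j u [S HS]. destruct (HG j) as [_ [[M HM] _]]. destruct (HM u S HS) as [S' [H _]]. exists S'; auto. }
  assert (Hbound : forall j u S, l2sum u S -> forall N, l2_partial (G j u) N <= S / c ^ 2).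
  { intros j u S HS. apply (coercive_bound (En j) _ u); auto.
    - apply Rlt_le, HEn.
    - apply Hin. exists S; auto.
    - destruct (HG j) as [_ [_ [_ H]]]. apply H. exists S; auto. }
  assert (Hcn : 0 < c ^ 2) by (apply pow_lt; auto).
  assert (Hentry : forall j u S k, l2sum u S -> G j u k ^ 2 <= S / c ^ 2).
  { intros j u S k HS. destruct (l2_bounded (G j u) (S / c ^ 2) (Hbound j u S HS)) as [S' [H1 H2]].
    generalize (l2_entry _ _ k H1). lra. }
  (* Resolvent identity: [G j u - G i u] solves the equation at the energy [En j] with right-hand
     side [(En j - En i) G i u]. *)
  assert (Hdiff : forall i j u S k, l2sum u S ->
     Rabs (G j u k - G i u k) <= Rabs (En j - En i) * (sqrt S / c ^ 2)).
  { intros i j u S k HS. assert (Hu : in_l2 u) by (exists S; auto).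
    assert (HS0 : 0 <= S) by (generalize (l2_entry u S 0 HS) (pow2_ge_0 (u 0%Z)); lra).
    destruct (l2_bounded (G i u) (S / c ^ 2) (Hbound i u S HS)) as [S' [H1 H2]].
    assert (Hz : forall N, l2_partial (fun m => 1 * G j u m + -1 * G i u m) N
        <= ((En j - En i) ^ 2 * S') / c ^ 2).
    { apply (coercive_bound (En j) _ (fun m => (En j - En i) * G i u m)).
      - apply Rlt_le, HEn.
      - apply l2_comb; auto.
      - apply l2_scal_sum; auto.
      - intros n. destruct (HG j) as [_ [_ [_ Hj]]]. destruct (HG i) as [_ [_ [_ Hi]]].
        specialize (Hj u Hu n). specialize (Hi u Hu n). unfold Hop in *.
        match type of Hj with ?x = _ => match type of Hi with ?y = _ =>
          transitivity (x - y + (En j - En i) * G i u n); [ring|rewrite Hi, Hj; ring] end end. }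
    destruct (l2_bounded _ _ Hz) as [S'' [H3 H4]].
    assert (H5 := l2_entry _ _ k H3).
    assert (H6 : (G j u k - G i u k) ^ 2 <= (Rabs (En j - En i) * (sqrt S / c ^ 2)) ^ 2).
    { replace (G j u k - G i u k) with (1 * G j u k + -1 * G i u k) by ring.
      eapply Rle_trans; [apply H5|]. eapply Rle_trans; [apply H4|].
      rewrite Rpow_mult_distr, pow2_abs. unfold Rdiv. rewrite Rpow_mult_distr, pow2_sqrt by auto.
      rewrite Rmult_assoc. apply Rmult_le_compat_l; [apply pow2_ge_0|].
      replace (S * (/ c ^ 2) ^ 2) with (S / c ^ 2 * / c ^ 2) by (field; lra).
      apply Rmult_le_compat_r; auto. apply Rlt_le, Rinv_0_lt_compat; auto. }
    rewrite <- pow2_abs in H6. apply Rsqr_incr_0_var.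
    - rewrite !Rsqr_pow2. auto.
    - apply Rmult_le_pos; [apply Rabs_pos|]. apply Rdiv_le_0_compat; [apply sqrt_pos|auto]. }
  set (Gi := fun (u : Z -> R) (k : Z) => real (Lim_seq (fun j => G j u k))).
  assert (HGi : forall u k, in_l2 u -> is_lim_seq (fun j => G j u k) (Gi u k)).
  { intros u k [S HS]. unfold Gi. apply Lim_seq_correct'. apply ex_lim_seq_cauchy_corr.
    set (K := sqrt S / c ^ 2).
    assert (HK : 0 <= K) by (apply Rdiv_le_0_compat; [apply sqrt_pos|auto]).
    intros eps. apply is_lim_seq_spec in Hlim0.
    assert (He : 0 < eps / (K + 1)) by (apply Rdiv_lt_0_compat; [apply cond_pos|lra]).
    destruct (Hlim0 (mkposreal _ He)) as [N HN]. exists N. intros n m Hn Hm. simpl in HN.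
    specialize (HN n Hn) as Hn'. specialize (HN m Hm) as Hm'. rewrite Rminus_0_r in Hn', Hm'.
    rewrite Rabs_pos_eq in Hn', Hm' by apply Rlt_le, Hinv.
    eapply Rle_lt_trans; [apply Hdiff; eauto|]. fold K.
    assert (Hd : Rabs (En n - En m) <= eps / (K + 1)).
    { unfold En. specialize (Hinv n) as Hin1. specialize (Hinv m) as Him1. apply Rabs_le. lra. }
    apply Rle_lt_trans with (eps / (K + 1) * K); [apply Rmult_le_compat_r; auto|].
    apply Rlt_le_trans with (eps / (K + 1) * (K + 1)); [apply Rmult_lt_compat_l; lra|].
    right. field. lra. }
  assert (HEGlim : forall u k, in_l2 u -> is_lim_seq (fun j => (En j - E0) * G j u k) 0).
  { intros u k Hu. replace (Finite 0) with (Rbar_mult (Finite 0) (Finite (Gi u k))) by (simpl; f_equal; ring).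
    apply is_lim_seq_mult'; auto.
    apply (is_lim_seq_ext (fun j => - / (INR j + 1))); [intros; unfold En; ring|].
    replace (Finite 0) with (Rbar_opp 0) by (simpl; f_equal; ring). apply is_lim_seq_opp in Hlim0. auto. }
  exists Gi. split; [|split; [|split]].
  - intros u1 u2 a b H1 H2 n.
    assert (Ha := HGi _ n (l2_comb u1 u2 a b H1 H2)).
    assert (Hb : is_lim_seq (fun j => G j (fun m => a * u1 m + b * u2 m) n) (a * Gi u1 n + b * Gi u2 n)).
    { apply (is_lim_seq_ext (fun j => a * G j u1 n + b * G j u2 n)).
      - intros j. symmetry. apply (HG j); auto.
      - apply is_lim_seq_plus'; [exact (is_lim_seq_scal_l _ a _ (HGi u1 n H1))|exact (is_lim_seq_scal_l _ b _ (HGi u2 n H2))]. }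
    apply is_lim_seq_unique in Ha. apply is_lim_seq_unique in Hb. rewrite Ha in Hb. injection Hb; auto.
  - exists (/ c ^ 2). intros u S HS.
    destruct (l2_bounded (Gi u) (S / c ^ 2)) as [S' [H1 H2]].
    + intros N. apply (lim_le (fun j => l2_partial (G j u) N)); [|intros j; apply Hbound; auto].
      apply (is_lim_seq_ext (fun j => zsum (- Z.of_nat N - 1) (2 * N + 2) (fun k => G j u k ^ 2))).
      { intros; symmetry; apply l2_partial_zsum. }
      rewrite l2_partial_zsum. induction (2 * N + 2)%nat as [|n IH]; cbn [zsum]; [apply is_lim_seq_const|].
      apply is_lim_seq_plus'; auto.
      assert (H := HGi u (- Z.of_nat N - 1 + Z.of_nat n)%Z (ex_intro _ S HS)).
      apply (is_lim_seq_ext (fun j => G j u (- Z.of_nat N - 1 + Z.of_nat n)%Z * G j u (- Z.of_nat N - 1 + Z.of_nat n)%Z));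
        [intros; ring|].
      replace (Gi u (- Z.of_nat N - 1 + Z.of_nat n)%Z ^ 2)
        with (Gi u (- Z.of_nat N - 1 + Z.of_nat n)%Z * Gi u (- Z.of_nat N - 1 + Z.of_nat n)%Z) by ring.
      apply is_lim_seq_mult'; auto.
    + exists S'. split; auto. unfold Rdiv in H2. lra.
  - intros u Hu n.
    assert (Ha := HGi _ n (Hop_l2 u E0 Hu)).
    assert (Hb : is_lim_seq (fun j => G j (fun m => Hop lam w v 0 u m - E0 * u m) n) (u n + 0)).
    { apply (is_lim_seq_ext (fun j => u n + (En j - E0) * G j u n)).
      - intros j. destruct (HG j) as [Hl [_ [Hi _]]].
        rewrite <- (Hi u Hu n) at 1.
        transitivity (1 * G j (fun m => Hop lam w v 0 u m - En j * u m) n + (En j - E0) * G j u n); [ring|].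
        rewrite <- Hl by (auto; apply Hop_l2; auto). f_equal. extensionality m. ring.
      - apply is_lim_seq_plus'; [apply is_lim_seq_const|auto]. }
    apply is_lim_seq_unique in Ha. apply is_lim_seq_unique in Hb. rewrite Ha in Hb.
    injection Hb. lra.
  - intros u Hu n.
    assert (Ha : is_lim_seq (fun j => Hop lam w v 0 (G j u) n - E0 * G j u n)
                            (Hop lam w v 0 (Gi u) n - E0 * Gi u n)).
    { unfold Hop. apply is_lim_seq_minus'; [apply is_lim_seq_plus'; [apply is_lim_seq_minus'|]|].
      - exact (proj1 (is_lim_seq_opp _ _) (HGi u (n + 1)%Z Hu)).
      - auto.
      - exact (is_lim_seq_scal_l _ _ _ (HGi u n Hu)).
      - exact (is_lim_seq_scal_l _ _ _ (HGi u n Hu)). }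
    assert (Hb : is_lim_seq (fun j => Hop lam w v 0 (G j u) n - E0 * G j u n) (u n + 0)).
    { apply (is_lim_seq_ext (fun j => u n + (En j - E0) * G j u n)).
      - intros j. destruct (HG j) as [_ [_ [_ Hi]]]. rewrite <- (Hi u Hu n) at 1. ring.
      - apply is_lim_seq_plus'; [apply is_lim_seq_const|auto]. }
    apply is_lim_seq_unique in Ha. apply is_lim_seq_unique in Hb. rewrite Ha in Hb.
    injection Hb. lra.
Qed.
End Resolvent.

(** * Density of the orbit and positivity of the form at every phase *)

(** With [b = nd (k w)] and [j] the integer part of [1 / b], the number 1 lies between [j b] and
    [(j+1) b], so one of the multiples [j k], [(j+1) k] comes within [b / 2] of an integer. *)
Lemma nd_halving w k : (1 <= k)%Z -> (forall m, m <> 0%Z -> 0 < nd (IZR m * w)) ->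
  exists k', (1 <= k')%Z /\ nd (IZR k' * w) <= nd (IZR k * w) / 2.
Proof.
  intros Hk Hpos. destruct (nd_rep (IZR k * w)) as [p Hp].
  assert (Hb := Hpos k ltac:(lia)). set (b := nd (IZR k * w)) in *.
  assert (Hb2 : b <= / 2) by apply nd_half.
  destruct (archimed (/ b)) as [Ha1 Ha2]. set (j := (up (/ b) - 1)%Z).
  assert (Hj : IZR j = IZR (up (/ b)) - 1) by (unfold j; rewrite minus_IZR; auto).
  assert (Hib : / b * b = 1) by (apply Rinv_l; lra).
  assert (Hj1 : IZR j * b <= 1) by nra.
  assert (Hj2 : 1 < (IZR j + 1) * b) by nra.
  assert (Hj0 : (1 <= j)%Z).
  { apply le_IZR. assert (2 <= / b) by (replace 2 with (/ / 2) by lra; apply Rinv_le_contravar; lra).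
    assert (H1 : (2 <= up (/ b))%Z) by (apply le_IZR; lra). apply IZR_le. unfold j. lia. }
  assert (Hs : exists s : Z, IZR k * w - IZR p = IZR s * b /\ (s = 1 \/ s = -1)%Z).
  { destruct (Rcase_abs (IZR k * w - IZR p)) as [H|H].
    - exists (-1)%Z. split; [|auto]. rewrite <- Hp, Rabs_left by auto. ring.
    - exists 1%Z. split; [|auto]. rewrite <- Hp, Rabs_right by auto. ring. }
  destruct Hs as [s [Hs Hs1]].
  assert (Hsa : Rabs (IZR s) = 1).
  { destruct Hs1 as [->| ->]; [rewrite Rabs_pos_eq; lra|rewrite Rabs_left; lra]. }
  assert (Hm : forall m : Z, nd (IZR (m * k) * w) <= Rabs (IZR m * b - 1)).
  { intros m. eapply Rle_trans; [apply (nd_le _ (m * p + s))|].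
    rewrite plus_IZR, !mult_IZR.
    replace (IZR m * IZR k * w - (IZR m * IZR p + IZR s)) with (IZR s * (IZR m * b - 1)).
    - rewrite Rabs_mult, Hsa. lra.
    - replace (IZR s * (IZR m * b - 1)) with (IZR m * (IZR s * b) - IZR s) by ring. rewrite <- Hs. ring. }
  destruct (Rle_dec (1 - IZR j * b) (b / 2)) as [H|H].
  - exists (j * k)%Z. split; [nia|]. eapply Rle_trans; [apply Hm|]. rewrite Rabs_left1; lra.
  - exists ((j + 1) * k)%Z. split; [nia|]. eapply Rle_trans; [apply Hm|]. rewrite plus_IZR.
    rewrite Rabs_pos_eq; lra.
Qed.

Lemma orbit_dense w : (forall m, m <> 0%Z -> 0 < nd (IZR m * w)) ->
  forall x eps, 0 < eps -> exists k p, Rabs (IZR k * w - IZR p - x) < eps.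
Proof.
  intros Hpos x eps Heps.
  assert (Hsm : forall n, exists k, (1 <= k)%Z /\ nd (IZR k * w) <= (/ 2) ^ n).
  { induction n as [|n [k [Hk1 Hk2]]].
    - exists 1%Z. split; [lia|]. generalize (nd_half (1 * w)). simpl. lra.
    - destruct (nd_halving w k Hk1 Hpos) as [k' [H1 H2]]. exists k'. split; auto. simpl. lra. }
  destruct (pow_lt_1_zero (/ 2) ltac:(rewrite Rabs_pos_eq; lra) eps Heps) as [N HN].
  specialize (HN N ltac:(lia)). rewrite Rabs_pos_eq in HN by (apply Rlt_le, rpow_half_pos).
  destruct (Hsm N) as [k [Hk1 Hk2]]. destruct (nd_rep (IZR k * w)) as [p Hp].
  assert (Hb := Hpos k ltac:(lia)). set (be := IZR k * w - IZR p) in *.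
  assert (Hbe : be <> 0) by (intros H; rewrite H, Rabs_R0 in Hp; lra).
  destruct (archimed (x / be)) as [Ha1 Ha2]. set (j := up (x / be)) in *.
  exists (j * k)%Z, (j * p)%Z. rewrite !mult_IZR.
  replace (IZR j * IZR k * w - IZR j * IZR p - x) with ((IZR j - x / be) * be) by (unfold be; field; auto).
  rewrite Rabs_mult, Hp. rewrite Rabs_pos_eq by lra. nra.
Qed.

(** The spectrum is taken at phase 0. Translating windows gives all phases of the orbit of 0;
    density and the Lipschitz bound give the rest. *)
Lemma form_all_phases w V A :
  (forall m, m <> 0%Z -> 0 < nd (IZR m * w)) ->
  (forall t k, V (t + IZR k) = V t) ->
  0 <= A -> (forall t s, Rabs (V t - V s) <= A * Rabs (t - s)) ->
  (forall p n u, (0 < n)%nat -> 0 <= form (orb w V 0) p n u) ->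
  forall th p n u, (0 < n)%nat -> 0 <= form (orb w V th) p n u.
Proof.
  intros Hpos Hper HA Hlip H0 th p n u Hn.
  assert (Hk : forall k j, 0 <= form (orb w V (IZR k * w - IZR j)) p n u).
  { intros k j. specialize (H0 (p + k)%Z n (shiftz (- k) u) Hn).
    rewrite <- form_shift in H0.
    rewrite (form_ext _ (orb w V (IZR k * w - IZR j)) p n _ u) in H0; auto.
    intros i _. unfold shiftz, orb. split; [|f_equal; lia].
    rewrite <- (Hper (IZR k * w - IZR j + IZR i * w) j). f_equal. rewrite plus_IZR. ring. }
  set (X := zsum p n (fun k => u k ^ 2)).
  assert (HX : 0 <= X) by (apply zsum_nonneg; intros; apply pow2_ge_0).
  apply Rnot_lt_le. intros Hneg.
  set (eps := - form (orb w V th) p n u / (A * X + 1)).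
  assert (HAX : 0 <= A * X) by (apply Rmult_le_pos; auto).
  assert (Heps : 0 < eps) by (apply Rdiv_lt_0_compat; lra).
  destruct (orbit_dense w Hpos th eps Heps) as [k [j Hkj]].
  specialize (Hk k j). rewrite (form_diff (orb w V th)) in Hk.
  assert (Hd : zsum p n (fun i => (orb w V (IZR k * w - IZR j) i - orb w V th i) * u i ^ 2) <= A * eps * X).
  { unfold X. rewrite <- zsum_scal. apply zsum_le. intros i _.
    apply Rmult_le_compat_r; [apply pow2_ge_0|].
    eapply Rle_trans; [apply Rle_abs|]. eapply Rle_trans; [apply Hlip|].
    apply Rmult_le_compat_l; auto. left. eapply Rle_lt_trans; [|apply Hkj]. right. f_equal. ring. }
  assert (A * eps * X < eps * (A * X + 1)) by (assert (A * eps * X = eps * (A * X)) by ring; nra).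
  replace (eps * (A * X + 1)) with (- form (orb w V th) p n u) in H by (unfold eps; field; lra).
  lra.
Qed.

(** * Invariant directions *)

(** [al n] is the entry at the site [-n] of a solution on the left half-line; no equation is imposed
    at the site 0. *)
Definition left_sol (W : R -> R) (w th : R) (al : nat -> R) : Prop :=
  forall k, al (S (S k)) = W (th - INR (S k) * w) * al (S k) - al k.

(* [p] is the slope of the direction contracted by the backward cocycle of potential [W]. *)
Definition contracted (W : R -> R) (w : R) (p : R -> R) : Prop :=
  exists C q, 0 < C /\ 0 < q < 1 /\ forall th, exists al,
    left_sol W w th al /\ al 0%nat = p th /\ al 1%nat = 1 /\
    forall n, Rabs (al n) <= C * q ^ n * (1 + Rabs (p th)).

Lemma geom_lim (u : nat -> R) K q : 0 < q < 1 -> (forall n, Rabs (u n) <= K * q ^ n) ->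
  is_lim_seq u 0.
Proof.
  intros Hq H. apply is_lim_seq_abs_0.
  apply (is_lim_seq_le_le (fun _ => 0) _ (fun n => K * q ^ n)).
  - intros n. split; [apply Rabs_pos|auto].
  - apply is_lim_seq_const.
  - replace (Finite 0) with (Rbar_mult K 0) by (simpl; f_equal; ring).
    apply is_lim_seq_scal_l, is_lim_seq_geom. rewrite Rabs_pos_eq; lra.
Qed.

Lemma exp_geom mu n : exp (- mu * INR n) = exp (- mu) ^ n.
Proof. rewrite <- (Rpower_pow n) by apply exp_pos. unfold Rpower. rewrite ln_exp. f_equal. ring. Qed.

Lemma exp_neg_lt1 mu : 0 < mu -> 0 < exp (- mu) < 1.
Proof. intros H. split; [apply exp_pos|]. rewrite <- exp_0. apply exp_increasing. lra. Qed.

Lemma vnorm_fst x : Rabs (fst x) <= vnorm x.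
Proof.
  unfold vnorm. rewrite <- sqrt_Rsqr_abs. apply sqrt_le_1_alt. unfold Rsqr.
  generalize (pow2_ge_0 (snd x)). lra.
Qed.

Lemma vnorm_snd x : Rabs (snd x) <= vnorm x.
Proof.
  unfold vnorm. rewrite <- sqrt_Rsqr_abs. apply sqrt_le_1_alt. unfold Rsqr.
  generalize (pow2_ge_0 (fst x)). lra.
Qed.

Lemma vnorm_one y : vnorm (1, y) <= 1 + Rabs y.
Proof.
  unfold vnorm; simpl fst; simpl snd. rewrite <- (sqrt_Rsqr (1 + Rabs y)) by (generalize (Rabs_pos y); lra).
  apply sqrt_le_1_alt. unfold Rsqr. rewrite <- (pow2_abs y). generalize (Rabs_pos y). nra.
Qed.

Lemma contracted_unstable lam E w v p : is_unstable_fn lam E w v p ->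
  contracted (fun t => lam ^ 2 * v t - E) w p.
Proof.
  intros [C [mu [HC [Hmu H]]]]. exists C, (exp (- mu)). split; auto. split; [apply exp_neg_lt1; auto|].
  intros th. exists (fun n => snd (bwd lam E w v n th (1, p th))). split; [|split; [|split]]; auto.
  - intros k. cbn [bwd Ainv snd]. unfold Ainv. reflexivity.
  - intros n. rewrite <- exp_geom. eapply Rle_trans; [apply vnorm_snd|].
    eapply Rle_trans; [apply H|]. apply Rmult_le_compat_l; [|apply vnorm_one].
    apply Rlt_le, Rmult_lt_0_compat; auto. apply exp_pos.
Qed.

(** Reflection turns forward contraction into backward contraction. The first component at time [n]
    is the entry at the site [n - 1], which accounts for the phase [w - th] instead of [- th]. *)
Lemma stable_seq lam E w v p : is_stable_fn lam E w v p ->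
  exists C q, 0 < C /\ 0 < q < 1 /\ forall th, exists be,
    left_sol (fun t => lam ^ 2 * v (- t) - E) w (w - th) be /\ be 0%nat = 1 /\ be 1%nat = p th /\
    forall n, Rabs (be n) <= C * q ^ n * (1 + Rabs (p th)).
Proof.
  intros [C [mu [HC [Hmu H]]]]. exists C, (exp (- mu)). split; auto. split; [apply exp_neg_lt1; auto|].
  intros th. exists (fun n => fst (fwd lam E w v n th (1, p th))). split; [|split; [|split]]; auto.
  - intros k. cbn [fwd Amat fst]. unfold Amat. cbn [fst snd].
    replace (- (w - th - INR (S k) * w)) with (th + INR k * w) by (rewrite S_INR; ring). ring.
  - intros n. rewrite <- exp_geom. eapply Rle_trans; [apply vnorm_fst|].
    eapply Rle_trans; [apply H|]. apply Rmult_le_compat_l; [|apply vnorm_one].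
    apply Rlt_le, Rmult_lt_0_compat; auto. apply exp_pos.
Qed.

(** The Wronskian is constant and tends to 0. *)
Lemma left_sol_unique W w th al al' : left_sol W w th al -> left_sol W w th al' ->
  is_lim_seq al 0 -> is_lim_seq al' 0 -> al 0%nat * al' 1%nat = al 1%nat * al' 0%nat.
Proof.
  intros H H' L L'.
  assert (Hc : forall n, al n * al' (S n) - al (S n) * al' n = al 0%nat * al' 1%nat - al 1%nat * al' 0%nat).
  { induction n as [|n IH]; auto. rewrite H, H', <- IH. ring. }
  assert (Hl : is_lim_seq (fun n => al n * al' (S n) - al (S n) * al' n) 0).
  { replace (Finite 0) with (Finite (0 * 0 - 0 * 0)) by (f_equal; ring).
    apply is_lim_seq_minus'; apply is_lim_seq_mult'; auto.
    - apply (is_lim_seq_incr_1 al'); auto.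
    - apply (is_lim_seq_incr_1 al); auto. }
  apply (is_lim_seq_ext _ _ _ Hc) in Hl.
  assert (Hx := is_lim_seq_const (al 0%nat * al' 1%nat - al 1%nat * al' 0%nat)).
  apply is_lim_seq_unique in Hl. apply is_lim_seq_unique in Hx. rewrite Hl in Hx. injection Hx. lra.
Qed.

Lemma zsum_left f n : zsum (- Z.of_nat n) n (fun k => f (Z.to_nat (- k))) = rsum f n.
Proof.
  rewrite (zsum_refl n (- Z.of_nat n) (fun k => f (Z.to_nat k))).
  replace (- (- Z.of_nat n + Z.of_nat n - 1))%Z with 1%Z by lia.
  induction n as [|n IH]; auto. cbn [zsum rsum]. rewrite IH. f_equal. f_equal. lia.
Qed.

Lemma rsum_mono f n m : (forall k, 0 <= f k) -> (n <= m)%nat -> rsum f n <= rsum f m.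
Proof.
  intros Hf H. induction H as [|m H IH]; [lra|]. cbn [rsum]. specialize (Hf (S m)). lra.
Qed.

(* Test the form with a decaying solution cut at its first entry. *)
Lemma left_sol_positive W w e th al : 0 < e ->
  (forall p n u, (0 < n)%nat -> e * zsum p n (fun k => u k ^ 2) <= form (orb w W th) p n u) ->
  left_sol W w th al -> is_lim_seq al 0 ->
  forall m, e * rsum (fun k => al k ^ 2) m <= al 0%nat * al 1%nat.
Proof.
  intros He Hf Hal Hlim m.
  assert (Hl : is_lim_seq (fun n => al 0%nat * al 1%nat + al (n + S m)%nat * al (S (n + S m))) (al 0%nat * al 1%nat)).
  { replace (Finite (al 0%nat * al 1%nat)) with (Finite (al 0%nat * al 1%nat + 0 * 0)) by (f_equal; ring).
    apply is_lim_seq_plus'; [apply is_lim_seq_const|]. apply is_lim_seq_mult'.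
    - apply (is_lim_seq_incr_n al (S m)); auto.
    - apply (is_lim_seq_ext (fun n => al (n + S (S m))%nat)); [intros; f_equal; lia|].
      apply (is_lim_seq_incr_n al (S (S m))); auto. }
  refine (is_lim_seq_le (fun _ => e * rsum (fun k => al k ^ 2) m) _ _ _ _ (is_lim_seq_const _) Hl).
  intros n. set (N := (n + S m)%nat). pose (u := fun k : Z => al (Z.to_nat (- k))).
  specialize (Hf (- Z.of_nat N)%Z N u ltac:(unfold N; lia)).
  rewrite form_defect in Hf. rewrite (zsum_zero _ _ (fun k => u k * _)) in Hf.
  2:{ intros k Hk. unfold u. pose (j := Z.to_nat (- k - 1)).
      replace (Z.to_nat (- (k + 1))) with j by (unfold j; lia).
      replace (Z.to_nat (- (k - 1))) with (S (S j)) by (unfold j; lia).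
      replace (Z.to_nat (- k)) with (S j) by (unfold j; lia).
      rewrite Hal. unfold orb. replace (th + IZR k * w) with (th - INR (S j) * w); [ring|].
      rewrite INR_IZR_INZ. replace (Z.of_nat (S j)) with (- k)%Z by (unfold j; lia). rewrite opp_IZR. ring. }
  unfold u in Hf. rewrite (zsum_left (fun k => al k ^ 2)) in Hf.
  replace (Z.to_nat (- (- Z.of_nat N - 1))) with (S N) in Hf by lia.
  replace (Z.to_nat (- - Z.of_nat N)) with N in Hf by lia.
  replace (Z.to_nat (- (- Z.of_nat N + Z.of_nat N - 1))) with 1%nat in Hf by lia.
  replace (Z.to_nat (- (- Z.of_nat N + Z.of_nat N))) with 0%nat in Hf by lia.
  assert (Hs : rsum (fun k => al k ^ 2) m <= rsum (fun k => al k ^ 2) N).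
  { apply rsum_mono; [intros; apply pow2_ge_0|unfold N; lia]. }
  apply Rle_trans with (e * rsum (fun k => al k ^ 2) N); [apply Rmult_le_compat_l; lra|]. lra.
Qed.

(** The entry at the site [-n] of the solution that decays to the left, normalized to 1 at the site
    0, when [p] is its slope. *)
Fixpoint chi (p : R -> R) (w t : R) (n : nat) : R :=
  match n with O => 1 | S k => chi p w t k / p (t - INR k * w) end.

Section Contracted.
Variables (W : R -> R) (w B e : R) (p : R -> R).
Hypothesis HWper : forall t k, W (t + IZR k) = W t.
Hypothesis HWB : forall t, W t <= B.
Hypothesis He : 0 < e.
Hypothesis Hform : forall th p n u, (0 < n)%nat ->
  e * zsum p n (fun k => u k ^ 2) <= form (orb w W th) p n u.
Hypothesis Hp : contracted W w p.

Lemma contracted_lim th : exists al, left_sol W w th al /\ al 0%nat = p th /\ al 1%nat = 1 /\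
  is_lim_seq al 0.
Proof.
  destruct Hp as [C [q [HC [Hq H]]]]. destruct (H th) as [al [H1 [H2 [H3 H4]]]].
  exists al. repeat split; auto. apply (geom_lim al (C * (1 + Rabs (p th))) q); auto.
  intros n. specialize (H4 n). lra.
Qed.

Lemma contracted_pos th : e <= p th.
Proof.
  destruct (contracted_lim th) as [al [H1 [H2 [H3 H4]]]].
  generalize (left_sol_positive W w e th al He (Hform th) H1 H4 1). cbn [rsum]. rewrite H2, H3. lra.
Qed.

Lemma contracted_gt0 th : 0 < p th.
Proof. generalize (contracted_pos th). lra. Qed.

(** The decaying solution at [th], extended by one site to the right through the equation, decays as
    a solution at [th + w]; uniqueness then compares the slopes. *)
Lemma contracted_inv th : p (th + w) = W th - / p th.
Proof.
  destruct (contracted_lim th) as [al [H1 [H2 [H3 H4]]]].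
  destruct (contracted_lim (th + w)) as [al' [H1' [H2' [H3' H4']]]].
  assert (Hpt := contracted_gt0 th).
  pose (ga := fun n => match n with O => W th * p th - 1 | S k => al k end).
  assert (Hg : left_sol W w (th + w) ga).
  { intros [|k].
    - simpl. rewrite H2, H3. replace (th + w - 1 * w) with th by ring. ring.
    - change (al (S (S k)) = W (th + w - INR (S (S k)) * w) * al (S k) - al k).
      rewrite H1. do 3 f_equal. rewrite (S_INR (S k)). ring. }
  assert (Hgl : is_lim_seq ga 0).
  { apply is_lim_seq_incr_1. apply (is_lim_seq_ext al); auto. }
  assert (H := left_sol_unique W w (th + w) ga al' Hg H1' Hgl H4').
  simpl in H. rewrite H2', H3', H2 in H.
  apply (Rmult_eq_reg_l (p th)); [|lra]. rewrite <- H. field. lra.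
Qed.

Lemma contracted_period th k : p (th + IZR k) = p th.
Proof.
  destruct (contracted_lim th) as [al [H1 [H2 [H3 H4]]]].
  destruct (contracted_lim (th + IZR k)) as [al' [H1' [H2' [H3' H4']]]].
  assert (Hl : left_sol W w th al').
  { intros j. rewrite H1'. do 2 f_equal. rewrite <- (HWper (th - INR (S j) * w) k). f_equal. ring. }
  generalize (left_sol_unique W w th al al' H1 Hl H4 H4'). rewrite H2, H3, H2', H3'. lra.
Qed.

Lemma contracted_inv' th : p th = W (th - w) - / p (th - w).
Proof. rewrite <- contracted_inv. f_equal. ring. Qed.

Lemma contracted_lt th : p th < B.
Proof.
  rewrite contracted_inv'. assert (H := contracted_gt0 (th - w)).
  apply Rinv_0_lt_compat in H. specialize (HWB (th - w)). lra.
Qed.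

Lemma contracted_inv_lt th : / p th < B.
Proof.
  assert (H := contracted_inv th). assert (H' := contracted_gt0 (th + w)). specialize (HWB th). lra.
Qed.

Lemma contracted_B_pos : 0 < B.
Proof. generalize (contracted_gt0 0) (contracted_lt 0). lra. Qed.

Lemma chi_pos t n : 0 < chi p w t n.
Proof. induction n; simpl; [lra|]. apply Rdiv_lt_0_compat; auto. apply contracted_gt0. Qed.

Lemma chi_eq t n : chi p w t (S (S n)) = W (t - INR (S n) * w) * chi p w t (S n) - chi p w t n.
Proof.
  cbn [chi].
  assert (H := contracted_inv (t - INR (S n) * w)).
  replace (t - INR (S n) * w + w) with (t - INR n * w) in H by (rewrite S_INR; ring).
  assert (H1 := contracted_gt0 (t - INR n * w)). assert (H2 := contracted_gt0 (t - INR (S n) * w)).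
  replace (W (t - INR (S n) * w)) with (p (t - INR n * w) + / p (t - INR (S n) * w)) by lra.
  field. lra.
Qed.

Lemma chi_shift t n : chi p w t (S n) = / p t * chi p w (t - w) n.
Proof.
  induction n as [|n IH].
  - simpl. rewrite Rmult_0_l, Rminus_0_r. unfold Rdiv. ring.
  - change (chi p w t (S (S n))) with (chi p w t (S n) / p (t - INR (S n) * w)). rewrite IH.
    cbn [chi]. replace (t - w - INR n * w) with (t - INR (S n) * w) by (rewrite S_INR; ring).
    unfold Rdiv. ring.
Qed.

Lemma chi_seq t al : left_sol W w t al -> al 0%nat = p t -> al 1%nat = 1 ->
  forall n, al n = p t * chi p w t n.
Proof.
  intros H H0 H1 n. assert (Hpt := contracted_gt0 t).
  enough (al n = p t * chi p w t n /\ al (S n) = p t * chi p w t (S n)) by tauto.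
  induction n as [|n [IH1 IH2]].
  - split; [simpl; lra|]. simpl. rewrite Rmult_0_l, Rminus_0_r, H1. field. lra.
  - split; auto. rewrite chi_eq, H, IH1, IH2. ring.
Qed.

Lemma chi_decay : exists K q, 0 < K /\ 0 < q < 1 /\ forall t n, chi p w t n <= K * q ^ n.
Proof.
  destruct Hp as [C [q [HC [Hq H]]]]. exists (C * (1 + B) * B), q.
  assert (HB := contracted_B_pos).
  split; [apply Rmult_lt_0_compat; [apply Rmult_lt_0_compat|]; lra|]. split; auto.
  intros t n. destruct (H t) as [al [H1 [H2 [H3 H4]]]].
  assert (Hpt := contracted_gt0 t). assert (Hlt := contracted_lt t). assert (Hil := contracted_inv_lt t).
  specialize (H4 n). rewrite (chi_seq t al H1 H2 H3 n) in H4.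
  assert (Hc := chi_pos t n).
  rewrite Rabs_pos_eq in H4 by (apply Rlt_le, Rmult_lt_0_compat; auto).
  rewrite (Rabs_pos_eq (p t)) in H4 by lra.
  assert (Hq0 : 0 < q ^ n) by (apply pow_lt; lra).
  assert (0 < C * q ^ n) by (apply Rmult_lt_0_compat; auto).
  assert (p t * chi p w t n <= C * q ^ n * (1 + B)).
  { eapply Rle_trans; [apply H4|]. apply Rmult_le_compat_l; lra. }
  replace (chi p w t n) with (/ p t * (p t * chi p w t n)) by (field; lra).
  replace (C * (1 + B) * B * q ^ n) with (B * (C * q ^ n * (1 + B))) by ring.
  apply Rmult_le_compat; try lra.
  - apply Rlt_le, Rinv_0_lt_compat; auto.
  - apply Rlt_le, Rmult_lt_0_compat; auto.
Qed.

Lemma chi_lim t : is_lim_seq (chi p w t) 0.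
Proof.
  destruct chi_decay as [K [q [HK [Hq H]]]]. apply (geom_lim _ K q); auto.
  intros n. rewrite Rabs_pos_eq by (apply Rlt_le, chi_pos). auto.
Qed.

Lemma chi_sum t n : e * sum_f_R0 (fun k => chi p w (t - w) k ^ 2) n <= p t.
Proof.
  destruct (contracted_lim t) as [al [H1 [H2 [H3 H4]]]].
  assert (H := left_sol_positive W w e t al He (Hform t) H1 H4 (S n)). rewrite H2, H3 in H.
  replace (rsum (fun k => al k ^ 2) (S n)) with (sum_f_R0 (fun k => chi p w (t - w) k ^ 2) n) in H; [lra|].
  clear H. assert (E : forall k, al (S k) = chi p w (t - w) k).
  { intros k. rewrite (chi_seq t al H1 H2 H3), chi_shift.
    assert (Hpt := contracted_gt0 t). field. lra. }
  induction n as [|n IH].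
  - cbn [rsum sum_f_R0]. rewrite <- E. ring.
  - rewrite tech5, IH, <- E. reflexivity.
Qed.

(* Tangent line inequality for the concave map x -> - 1/x, iterated along the orbit. *)
Lemma contracted_concave t s n :
  p (t + s) - p t <= sum_f_R0 (fun k => (W (t + s - INR (S k) * w) - W (t - INR (S k) * w))
                                         * chi p w (t - w) k ^ 2) n
     + chi p w (t - w) (S n) ^ 2 * (p (t + s - INR (S n) * w) - p (t - INR (S n) * w)).
Proof.
  assert (Hstep : forall x, p (x + s) - p x <= (W (x + s - w) - W (x - w))
      + / p (x - w) ^ 2 * (p (x + s - w) - p (x - w))).
  { intros x. rewrite (contracted_inv' (x + s)), (contracted_inv' x).
    assert (H1 := contracted_gt0 (x - w)). assert (H2 := contracted_gt0 (x + s - w)).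
    set (a := p (x - w)) in *. set (b := p (x + s - w)) in *.
    assert (0 <= / b * (b / a - 1) ^ 2) by (apply Rmult_le_pos; [apply Rlt_le, Rinv_0_lt_compat; auto|apply pow2_ge_0]).
    replace (/ b * (b / a - 1) ^ 2) with (/ a ^ 2 * (b - a) + / b - / a) in H by (field; lra). lra. }
  induction n as [|n IH].
  - cbn [sum_f_R0 chi]. specialize (Hstep t). simpl INR. rewrite Rmult_1_l, Rmult_0_l, Rminus_0_r.
    replace (1 / p (t - w)) with (/ p (t - w)) by (unfold Rdiv; ring).
    rewrite pow_inv. rewrite pow1. lra.
  - rewrite tech5.
    specialize (Hstep (t - INR (S n) * w)).
    change (chi p w (t - w) (S (S n))) with (chi p w (t - w) (S n) / p (t - w - INR (S n) * w)).
    replace (t - w - INR (S n) * w) with (t - INR (S n) * w - w) by ring.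
    replace (t + s - INR (S (S n)) * w) with (t - INR (S n) * w + s - w) by (rewrite (S_INR (S n)); ring).
    replace (t - INR (S (S n)) * w) with (t - INR (S n) * w - w) by (rewrite (S_INR (S n)); ring).
    replace (t - INR (S n) * w + s) with (t + s - INR (S n) * w) in * by ring.
    set (c := chi p w (t - w) (S n)) in *.
    assert (Hc : 0 <= c ^ 2) by apply pow2_ge_0.
    apply (Rmult_le_compat_l _ _ _ Hc) in Hstep.
    replace ((c / p (t - INR (S n) * w - w)) ^ 2) with (c ^ 2 * / p (t - INR (S n) * w - w) ^ 2)
      by (unfold Rdiv; rewrite Rpow_mult_distr, pow_inv; ring).
    lra.
Qed.
End Contracted.

(** * Regularity of invariant directions *)

Lemma geom_tail (a : nat -> R) (l K r : R) : 0 < r < 1 -> (forall k, Rabs (a k) <= K * r ^ k) ->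
  is_lim_seq (sum_f_R0 a) l -> forall n, Rabs (l - sum_f_R0 a n) <= K * r ^ S n / (1 - r).
Proof.
  intros Hr Ha Hl n.
  assert (HK : 0 <= K) by (specialize (Ha 0%nat); generalize (Rabs_pos (a 0%nat)); simpl in Ha; lra).
  assert (Hm : forall m, Rabs (sum_f_R0 a (n + m) - sum_f_R0 a n) <= K * r ^ S n * (1 - r ^ m) / (1 - r)).
  { induction m as [|m IH].
    - rewrite Nat.add_0_r, Rminus_diag, Rabs_R0. simpl. right. field. lra.
    - rewrite Nat.add_succ_r, tech5.
      replace (sum_f_R0 a (n + m) + a (S (n + m)) - sum_f_R0 a n)
        with ((sum_f_R0 a (n + m) - sum_f_R0 a n) + a (S (n + m))) by ring.
      eapply Rle_trans; [apply Rabs_triang|]. specialize (Ha (S (n + m))).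
      replace (K * r ^ S n * (1 - r ^ S m) / (1 - r))
        with (K * r ^ S n * (1 - r ^ m) / (1 - r) + K * r ^ S (n + m)).
      + lra.
      + replace (S (n + m)) with (S n + m)%nat by lia. rewrite pow_add. simpl. field. lra. }
  assert (Hlim : is_lim_seq (fun m => Rabs (sum_f_R0 a (n + m) - sum_f_R0 a n)) (Rabs (l - sum_f_R0 a n))).
  { apply (is_lim_seq_abs (fun m => sum_f_R0 a (n + m) - sum_f_R0 a n) (l - sum_f_R0 a n)).
    apply is_lim_seq_minus'; [|apply is_lim_seq_const].
    apply (is_lim_seq_ext (fun m => sum_f_R0 a (m + n))); [intros; f_equal; lia|].
    apply (is_lim_seq_incr_n (sum_f_R0 a) n); auto. }
  apply (lim_le _ _ _ Hlim). intros m. eapply Rle_trans; [apply Hm|].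
  unfold Rdiv. apply Rmult_le_compat_r; [apply Rlt_le, Rinv_0_lt_compat; lra|].
  assert (0 < r ^ m) by (apply pow_lt; lra). assert (0 < r ^ S n) by (apply pow_lt; lra).
  assert (0 <= K * r ^ S n) by (apply Rmult_le_pos; lra). nra.
Qed.

Lemma series_continuity (f : nat -> R -> R) (F : R -> R) K r : 0 < r < 1 ->
  (forall k, continuity (f k)) -> (forall k t, Rabs (f k t) <= K * r ^ k) ->
  (forall t, is_lim_seq (sum_f_R0 (fun k => f k t)) (F t)) -> continuity F.
Proof.
  intros Hr Hf Hb Hl x.
  apply (CVU_continuity (fun n t => sum_f_R0 (fun k => f k t) n) F x (mkposreal 1 Rlt_0_1)).
  - intros eps Heps.
    assert (HK : 0 <= K) by (specialize (Hb 0%nat 0); generalize (Rabs_pos (f 0%nat 0)); simpl in Hb; lra).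
    destruct (pow_lt_1_zero r ltac:(rewrite Rabs_pos_eq; lra) (eps * (1 - r) / (K + 1))
      ltac:(apply Rdiv_lt_0_compat; [apply Rmult_lt_0_compat; lra|lra])) as [N HN].
    exists N. intros n y Hn _.
    eapply Rle_lt_trans; [apply (geom_tail (fun k => f k y) (F y) K r Hr (fun k => Hb k y) (Hl y) n)|].
    specialize (HN (S n) ltac:(lia)). rewrite Rabs_pos_eq in HN by (apply pow_le; lra).
    apply (Rmult_lt_reg_r (1 - r)); [lra|].
    unfold Rdiv. rewrite Rmult_assoc, Rinv_l, Rmult_1_r by lra.
    assert (0 < r ^ S n) by (apply pow_lt; lra).
    apply Rle_lt_trans with ((K + 1) * r ^ S n); [apply Rmult_le_compat_r; lra|].
    apply (Rmult_lt_compat_l (K + 1)) in HN; [|lra].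
    replace ((K + 1) * (eps * (1 - r) / (K + 1))) with (eps * (1 - r)) in HN by (field; lra). lra.
  - intros n y _. induction n as [|n IH]; [apply Hf|].
    apply continuity_pt_plus; [apply IH|apply Hf].
  - unfold Boule. rewrite Rminus_diag, Rabs_R0. simpl. lra.
Qed.

Lemma periodic_reduce x : exists k, 0 <= x - IZR k <= 1.
Proof. exists (up x - 1)%Z. rewrite minus_IZR. destruct (archimed x). lra. Qed.

Lemma periodic_max f : continuity f -> (forall t k, f (t + IZR k) = f t) -> exists m, is_max_value f m.
Proof.
  intros Hc Hper. destruct (continuity_ab_maj f 0 1 Rle_0_1 (fun c _ => Hc c)) as [x [Hx _]].
  exists (f x). split; [exists x; auto|]. intros t. destruct (periodic_reduce t) as [k Hk].
  specialize (Hx _ Hk). rewrite <- (Hper (t - IZR k) k) in Hx.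
  replace (t - IZR k + IZR k) with t in Hx by ring. auto.
Qed.

Lemma continuity_abs f : continuity f -> continuity (fun t => Rabs (f t)).
Proof. intros H. apply (continuity_comp f Rabs); auto. apply Rcontinuity_abs. Qed.

Section Regularity.
Variables (W W1 : R -> R) (w B e A1 A2 : R) (p : R -> R).
Hypothesis HWper : forall t k, W (t + IZR k) = W t.
Hypothesis HW1per : forall t k, W1 (t + IZR k) = W1 t.
Hypothesis HWB : forall t, W t <= B.
Hypothesis HA1 : 0 <= A1.
Hypothesis HA2 : 0 < A2.
Hypothesis HWlip : forall t s, Rabs (W t - W s) <= A1 * Rabs (t - s).
Hypothesis HW1 : forall t, Rabs (W1 t) <= A1.
Hypothesis HW1c : continuity W1.
Hypothesis HWtay : forall t s, W (t + s) <= W t + s * W1 t + A2 / 2 * s ^ 2.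
Hypothesis He : 0 < e.
Hypothesis Hform : forall th p n u, (0 < n)%nat ->
  e * zsum p n (fun k => u k ^ 2) <= form (orb w W th) p n u.
Hypothesis Hp : contracted W w p.

Let c (t : R) (k : nat) := chi p w (t - w) k.
Let S0 := B / e.

(** This is how the distance [e] to the spectrum enters the derivative bounds: the second derivative
    from above costs [S0 = B / e], and Landau's inequality reduces it to a square root. *)
Lemma chi_sq_sum t n : 0 <= sum_f_R0 (fun k => c t k ^ 2) n <= S0.
Proof.
  split; [apply cond_pos_sum; intros; apply pow2_ge_0|].
  assert (H1 := chi_sum W w e p He Hform Hp t n).
  assert (H2 := contracted_lt W w B e p HWB He Hform Hp t).
  unfold S0. apply (Rmult_le_reg_l e); auto. replace (e * (B / e)) with B by (field; lra). unfold c. lra.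
Qed.

Lemma S0_pos : 0 < S0.
Proof. apply Rdiv_lt_0_compat; auto. apply (contracted_B_pos W w B e p); auto. Qed.

(** The remainder of the iterated tangent inequality is a difference of slopes, below [B], times a
    squared entry of the decaying solution, which tends to 0. *)
Lemma concave_limit t s X :
  (forall n, sum_f_R0 (fun k => (W (t + s - INR (S k) * w) - W (t - INR (S k) * w)) * c t k ^ 2) n <= X n) ->
  forall l : R, is_lim_seq X l -> p (t + s) - p t <= l.
Proof.
  intros HX l Hl.
  assert (Hlim : is_lim_seq (fun n => X n + B * (c t (S n) * c t (S n))) (l + B * (0 * 0))).
  { apply is_lim_seq_plus'; auto.
    apply (is_lim_seq_scal_l (fun n => c t (S n) * c t (S n)) B (Finite (0 * 0))).
    assert (H := proj1 (is_lim_seq_incr_1 _ _) (chi_lim W w B e p HWB He Hform Hp (t - w))).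
    apply is_lim_seq_mult'; auto. }
  replace l with (l + B * (0 * 0)) by ring.
  refine (is_lim_seq_le (fun _ => p (t + s) - p t) _ _ _ _ (is_lim_seq_const _) Hlim).
  intros n. eapply Rle_trans; [apply (contracted_concave W w e p He Hform Hp t s n)|].
  apply Rplus_le_compat; [apply HX|]. fold (c t (S n)).
  assert (H1 := contracted_lt W w B e p HWB He Hform Hp (t + s - INR (S n) * w)).
  assert (H2 := contracted_gt0 W w e p He Hform Hp (t - INR (S n) * w)).
  replace (B * (c t (S n) * c t (S n))) with (c t (S n) ^ 2 * B) by ring.
  apply Rmult_le_compat_l; [apply pow2_ge_0|lra].
Qed.

Lemma sum_le_sum f g n : (forall k, f k <= g k) -> sum_f_R0 f n <= sum_f_R0 g n.
Proof. intros H. apply sum_Rle. intros; apply H. Qed.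

Lemma contracted_lip t s : Rabs (p t - p s) <= A1 * S0 * Rabs (t - s).
Proof.
  assert (Hup : forall t s, p (t + s) - p t <= A1 * S0 * Rabs s).
  { clear t s. intros t s. apply (concave_limit t s (fun _ => A1 * S0 * Rabs s)); [|apply is_lim_seq_const].
    intros n. eapply Rle_trans; [apply (sum_le_sum _ (fun k => c t k ^ 2 * (A1 * Rabs s)))|].
    - intros k. rewrite Rmult_comm. apply Rmult_le_compat_l; [apply pow2_ge_0|].
      eapply Rle_trans; [apply Rle_abs|]. eapply Rle_trans; [apply HWlip|].
      right. f_equal. f_equal. ring.
    - rewrite <- scal_sum. destruct (chi_sq_sum t n) as [_ H].
      replace (A1 * S0 * Rabs s) with (A1 * Rabs s * S0) by ring.
      apply Rmult_le_compat_l; auto. apply Rmult_le_pos; auto. apply Rabs_pos. }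
  assert (H1 := Hup s (t - s)). assert (H2 := Hup t (s - t)).
  replace (s + (t - s)) with t in H1 by ring. replace (t + (s - t)) with s in H2 by ring.
  rewrite (Rabs_minus_sym s t) in H2. apply Rabs_le. lra.
Qed.

Lemma contracted_continuity : continuity p.
Proof.
  intros x eps Heps. assert (HS := S0_pos).
  exists (eps / (A1 * S0 + 1)).
  assert (HAS : 0 <= A1 * S0) by (apply Rmult_le_pos; lra).
  split; [apply Rdiv_lt_0_compat; lra|]. intros y [_ Hy]. simpl in *. unfold Rdist in *.
  eapply Rle_lt_trans; [apply contracted_lip|].
  apply Rle_lt_trans with (A1 * S0 * (eps / (A1 * S0 + 1))); [apply Rmult_le_compat_l; lra|].
  apply Rlt_le_trans with ((A1 * S0 + 1) * (eps / (A1 * S0 + 1))).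
  - apply Rmult_lt_compat_r; [apply Rdiv_lt_0_compat|]; lra.
  - right. field. lra.
Qed.

Lemma continuity_shift f a : continuity f -> continuity (fun t => f (t - a)).
Proof.
  intros H. apply (continuity_comp (fun t => t - a) f); auto.
  intros x. apply derivable_continuous_pt. apply derivable_pt_minus;
  [apply derivable_pt_id|apply derivable_pt_const].
Qed.

Lemma chi_continuity k : continuity (fun t => c t k).
Proof.
  unfold c. induction k as [|k IH].
  - intros x. apply continuity_pt_const. intros a b; reflexivity.
  - apply (continuity_mult (fun t => chi p w (t - w) k) (fun t => / p (t - w - INR k * w))); auto.
    apply (continuity_inv (fun t => p (t - w - INR k * w))).
    + apply (continuity_shift (fun t => p (t - INR k * w))). apply continuity_shift, contracted_continuity.
    + intros t. apply Rgt_not_eq, (contracted_gt0 W w e p He Hform Hp).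
Qed.

(** The invariance relation differentiated along the backward orbit: each step adds a value of [W1]
    and multiplies by the derivative [1 / p^2] of [- 1 / p]. *)
Definition dslope (t : R) : R := Series (fun k => W1 (t - INR (S k) * w) * chi p w (t - w) k ^ 2).

Let term (k : nat) (t : R) := W1 (t - INR (S k) * w) * c t k ^ 2.

Lemma term_bound : exists K r, 0 < r < 1 /\ forall k t, Rabs (term k t) <= K * r ^ k.
Proof.
  destruct (chi_decay W w B e p HWB He Hform Hp) as [K [q [HK [Hq H]]]].
  exists (A1 * K ^ 2), (q ^ 2). split; [split; nra|]. intros k t. unfold term.
  rewrite Rabs_mult, (Rabs_pos_eq (c t k ^ 2)) by apply pow2_ge_0.
  replace (A1 * K ^ 2 * (q ^ 2) ^ k) with (A1 * (K * q ^ k) ^ 2).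
  - apply Rmult_le_compat; auto; [apply Rabs_pos|apply pow2_ge_0|].
    apply pow_incr. split; [apply Rlt_le, (chi_pos W w e p He Hform Hp)|apply H].
  - rewrite Rpow_mult_distr, <- !pow_mult, Nat.mul_comm. ring.
Qed.

Lemma dslope_lim t : is_lim_seq (sum_f_R0 (fun k => term k t)) (dslope t).
Proof.
  destruct term_bound as [K [r [Hr H]]].
  assert (Hex : ex_series (fun k => term k t)).
  { apply (ex_series_le (K := R_AbsRing) (V := R_CompleteNormedModule) _ (fun k => K * r ^ k)).
    - intros k. apply H.
    - apply (ex_series_scal_l K (fun k => r ^ k)). apply ex_series_geom. rewrite Rabs_pos_eq; lra. }
  apply Series_correct in Hex. unfold is_series in Hex.
  apply (is_lim_seq_ext (sum_n (fun k => term k t))); [apply sum_n_Reals|]. exact Hex.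
Qed.

Lemma dslope_continuity : continuity dslope.
Proof.
  destruct term_bound as [K [r [Hr H]]].
  apply (series_continuity term dslope K r Hr); auto.
  - intros k. unfold term.
    apply (continuity_mult (fun t => W1 (t - INR (S k) * w)) (fun t => c t k ^ 2)).
    + apply continuity_shift; auto.
    + apply (continuity_comp (fun t => c t k) (fun x => x ^ 2)); [apply chi_continuity|].
      apply derivable_continuous, derivable_pow.
  - apply dslope_lim.
Qed.

Lemma contracted_taylor t s : p (t + s) <= p t + s * dslope t + A2 * S0 / 2 * s ^ 2.
Proof.
  enough (p (t + s) - p t <= s * dslope t + A2 * S0 / 2 * s ^ 2) by lra.
  apply (concave_limit t s (fun n => s * sum_f_R0 (fun k => term k t) n + A2 * S0 / 2 * s ^ 2)).
  - intros n.
    eapply Rle_trans; [apply (sum_le_sum _ (fun k => term k t * s + c t k ^ 2 * (A2 / 2 * s ^ 2)))|].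
    + intros k. unfold term. assert (H := HWtay (t - INR (S k) * w) s).
      replace (t - INR (S k) * w + s) with (t + s - INR (S k) * w) in H by ring.
      assert (Hc : 0 <= c t k ^ 2) by apply pow2_ge_0.
      replace (W1 (t - INR (S k) * w) * c t k ^ 2 * s + c t k ^ 2 * (A2 / 2 * s ^ 2))
        with ((s * W1 (t - INR (S k) * w) + A2 / 2 * s ^ 2) * c t k ^ 2) by ring.
      apply Rmult_le_compat_r; lra.
    + rewrite plus_sum, <- !scal_sum. apply Rplus_le_compat_l.
      replace (A2 * S0 / 2 * s ^ 2) with (A2 / 2 * s ^ 2 * S0) by field.
      apply Rmult_le_compat_l; [|apply chi_sq_sum].
      apply Rmult_le_pos; [lra|apply pow2_ge_0].
  - apply is_lim_seq_plus'; [|apply is_lim_seq_const].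
    exact (is_lim_seq_scal_l _ s _ (dslope_lim t)).
Qed.

(** The Taylor bound holds from above only. Used at [t] with step [h] and at [t + h] with step
    [- h], it encloses the increment between [h dslope (t+h)] and [h dslope t] up to a quadratic
    error, and [dslope] is continuous. *)
Lemma contracted_derivative t : derivable_pt_lim p t (dslope t).
Proof.
  intros eps Heps. assert (HS := S0_pos).
  set (Q := A2 * S0). assert (HQ : 0 < Q) by (apply Rmult_lt_0_compat; auto).
  destruct (dslope_continuity t (eps / 2) ltac:(lra)) as [d [Hd Hcont]].
  assert (Hdel : 0 < Rmin d (eps / Q)) by (apply Rmin_pos; [lra|apply Rdiv_lt_0_compat; lra]).
  exists (mkposreal _ Hdel). intros h Hh0 Hh. simpl in Hh.
  assert (Hh1 : Rabs h < d) by (eapply Rlt_le_trans; [apply Hh|apply Rmin_l]).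
  assert (Hh2 : Rabs h < eps / Q) by (eapply Rlt_le_trans; [apply Hh|apply Rmin_r]).
  assert (H1 := contracted_taylor t h). assert (H2 := contracted_taylor (t + h) (- h)).
  replace (t + h + - h) with t in H2 by ring. fold Q in H1, H2.
  assert (H3 : Rabs (dslope (t + h) - dslope t) < eps / 2).
  { destruct (Req_dec h 0) as [->|_]; [contradiction|].
    apply (Hcont (t + h)). split; [split; [exact I|lra]|]. simpl. unfold Rdist.
    replace (t + h - t) with h by ring. auto. }
  assert (Hha : 0 < Rabs h) by (apply Rabs_pos_lt; auto).
  assert (H4 : Rabs (p (t + h) - p t - h * dslope t) <= Rabs h * (eps / 2) + Q / 2 * h ^ 2).
  { assert (H5 : Rabs (h * (dslope (t + h) - dslope t)) <= Rabs h * (eps / 2)).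
    { rewrite Rabs_mult. apply Rmult_le_compat_l; lra. }
    apply Rabs_le_between in H5. assert (0 <= Rabs h * (eps / 2)) by (apply Rmult_le_pos; lra).
    replace ((- h) ^ 2) with (h ^ 2) in H2 by ring. apply Rabs_le. lra. }
  replace ((p (t + h) - p t) / h - dslope t) with ((p (t + h) - p t - h * dslope t) * / h) by (field; auto).
  rewrite Rabs_mult, Rabs_inv.
  apply (Rmult_lt_reg_r (Rabs h)); auto. rewrite Rmult_assoc, Rinv_l, Rmult_1_r by lra.
  eapply Rle_lt_trans; [apply H4|]. rewrite <- (pow2_abs h).
  assert (Q * Rabs h < eps).
  { apply (Rmult_lt_compat_l Q) in Hh2; auto. replace (Q * (eps / Q)) with eps in Hh2 by (field; lra). auto. }
  nra.
Qed.

(* Landau's inequality for a positive function whose second derivative is bounded above. *)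
Lemma dslope_bound t : dslope t ^ 2 <= 2 * (A2 * S0) * B.
Proof.
  assert (HS := S0_pos). set (Q := A2 * S0). assert (HQ : 0 < Q) by (apply Rmult_lt_0_compat; auto).
  assert (H1 := contracted_taylor t (- dslope t / Q)). fold Q in H1.
  assert (H2 := contracted_gt0 W w e p He Hform Hp (t + - dslope t / Q)).
  assert (H3 := contracted_lt W w B e p HWB He Hform Hp t).
  replace (- dslope t / Q * dslope t) with (- (dslope t ^ 2 / Q)) in H1 by (field; lra).
  replace (Q / 2 * (- dslope t / Q) ^ 2) with (dslope t ^ 2 / Q / 2) in H1 by (field; lra).
  assert (H4 : dslope t ^ 2 / Q <= 2 * B) by lra.
  apply (Rmult_le_compat_l Q) in H4; [|lra].
  replace (Q * (dslope t ^ 2 / Q)) with (dslope t ^ 2) in H4 by (field; lra). lra.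
Qed.

Lemma dslope_period t k : dslope (t + IZR k) = dslope t.
Proof.
  unfold dslope. apply Series_ext. intros n. f_equal.
  - rewrite <- (HW1per (t - INR (S n) * w) k). f_equal. ring.
  - f_equal. induction n as [|n IH]; auto. cbn [chi]. rewrite IH. f_equal.
    rewrite <- (contracted_period W w p HWper Hp (t - w - INR n * w) k). f_equal. ring.
Qed.
End Regularity.

(** * The gap between the invariant directions *)

Definition rev (W : R -> R) (t : R) : R := W (- t).

Lemma orb_rev w W th : orb w (rev W) th = refl (orb w W (- th)).
Proof. extensionality k. unfold orb, rev, refl. f_equal. rewrite opp_IZR. ring. Qed.

Lemma form_rev W w e :
  (forall th p n u, (0 < n)%nat -> e * zsum p n (fun k => u k ^ 2) <= form (orb w W th) p n u) ->
  forall th p n u, (0 < n)%nat -> e * zsum p n (fun k => u k ^ 2) <= form (orb w (rev W) th) p n u.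
Proof.
  intros H th p n u Hn. rewrite orb_rev.
  specialize (H (- th) (- (p + Z.of_nat n - 1))%Z n (refl u) Hn).
  rewrite <- (zsum_refl n p (fun k => refl u k ^ 2)) in H.
  rewrite (zsum_ext p n _ (fun k => u k ^ 2)) in H by (intros; unfold refl; rewrite Z.opp_involutive; auto).
  rewrite <- form_refl, refl_refl in H. auto.
Qed.

Section Pair.
Variables (W : R -> R) (w B e : R) (p r : R -> R).
Hypothesis HWper : forall t k, W (t + IZR k) = W t.
Hypothesis HWB : forall t, W t <= B.
Hypothesis He : 0 < e.
Hypothesis Hform : forall th p n u, (0 < n)%nat ->
  e * zsum p n (fun k => u k ^ 2) <= form (orb w W th) p n u.
Hypothesis Hp : contracted W w p.
Hypothesis Hr : contracted (rev W) w r.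

Let Hformr := form_rev W w e Hform.
Let HWBr : forall t, rev W t <= B := fun t => HWB (- t).

Definition phi (th : R) (k : Z) : R :=
  if Z_le_dec 0 k then chi r w (- th) (Z.to_nat k) else chi p w th (Z.to_nat (- k)).

(* With [p] the unstable slope and [r t = 1 / psi^s (w - t)], this is [psi^u - psi^s] at [th + w],
   the inverse of the diagonal of the Green function. *)
Definition gap (th : R) : R := W th - / p th - / r (- th).

Lemma pair_p_pos t : 0 < p t.
Proof. apply (contracted_gt0 W w e p He Hform Hp). Qed.

Lemma pair_r_pos t : 0 < r t.
Proof. apply (contracted_gt0 (rev W) w e r He Hformr Hr). Qed.

Lemma phi_nat th n : phi th (Z.of_nat n) = chi r w (- th) n.
Proof. unfold phi. destruct (Z_le_dec 0 (Z.of_nat n)); [|lia]. f_equal. lia. Qed.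

Lemma phi_neg th n : phi th (- Z.of_nat n) = chi p w th n.
Proof.
  unfold phi. destruct (Z_le_dec 0 (- Z.of_nat n)).
  - destruct n; [reflexivity|lia].
  - f_equal. lia.
Qed.

Lemma phi_pos th k : 0 < phi th k.
Proof.
  unfold phi. destruct (Z_le_dec 0 k).
  - apply (chi_pos (rev W) w e r He Hformr Hr).
  - apply (chi_pos W w e p He Hform Hp).
Qed.

Lemma phi_0 th : phi th 0 = 1.
Proof. apply (phi_nat th 0). Qed.

Lemma phi_1 th : phi th 1 = / r (- th).
Proof.
  rewrite (phi_nat th 1 : phi th 1 = _). simpl. rewrite Rmult_0_l, Rminus_0_r. unfold Rdiv. ring.
Qed.

Lemma phi_m1 th : phi th (-1) = / p th.
Proof.
  rewrite (phi_neg th 1 : phi th (-1) = _). simpl. rewrite Rmult_0_l, Rminus_0_r. unfold Rdiv. ring.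
Qed.

Lemma phi_eq th k : k <> 0%Z -> orb w W th k * phi th k = phi th (k + 1)%Z + phi th (k - 1)%Z.
Proof.
  intros Hk. destruct (Z_lt_dec 0 k) as [Hlt|Hge].
  - pose (n := Z.to_nat (k - 1)).
    replace (k + 1)%Z with (Z.of_nat (S (S n))) by (unfold n; lia).
    replace (k - 1)%Z with (Z.of_nat n) by (unfold n; lia).
    replace k with (Z.of_nat (S n)) by (unfold n; lia).
    rewrite !phi_nat, (chi_eq (rev W) w e r He Hformr Hr). unfold rev, orb.
    replace (- (- th - INR (S n) * w)) with (th + IZR (Z.of_nat (S n)) * w); [ring|].
    rewrite <- INR_IZR_INZ. ring.
  - pose (n := Z.to_nat (- k - 1)).
    replace (k + 1)%Z with (- Z.of_nat n)%Z by (unfold n; lia).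
    replace (k - 1)%Z with (- Z.of_nat (S (S n)))%Z by (unfold n; lia).
    replace k with (- Z.of_nat (S n))%Z by (unfold n; lia).
    rewrite !phi_neg, (chi_eq W w e p He Hform Hp). unfold orb.
    rewrite opp_IZR, <- INR_IZR_INZ.
    replace (th + - INR (S n) * w) with (th - INR (S n) * w) by ring. ring.
Qed.

Lemma phi_defect th : defect (orb w W th) (phi th) = gap th.
Proof.
  unfold defect, gap. rewrite phi_1, phi_m1. unfold orb. rewrite Rmult_0_l, Rplus_0_r. ring.
Qed.

Definition bdry th (N : nat) : R :=
  phi th (- Z.of_nat N - 1) * phi th (- Z.of_nat N) + phi th (Z.of_nat N) * phi th (Z.of_nat N + 1).

Lemma phi_form th N :
  form (orb w W th) (- Z.of_nat N) (2 * N + 1) (phi th) = gap th + bdry th N.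
Proof.
  rewrite form_defect, (zsum_single _ _ _ 0%Z).
  - rewrite phi_0, <- phi_defect. unfold defect, bdry.
    replace (- Z.of_nat N + Z.of_nat (2 * N + 1) - 1)%Z with (Z.of_nat N) by lia.
    replace (- Z.of_nat N + Z.of_nat (2 * N + 1))%Z with (Z.of_nat N + 1)%Z by lia.
    replace (0 + 1)%Z with 1%Z by lia. replace (0 - 1)%Z with (-1)%Z by lia. ring.
  - lia.
  - intros k _ Hk. rewrite phi_eq by auto. ring.
Qed.

Lemma bdry_lim th : is_lim_seq (bdry th) 0.
Proof.
  assert (H1 := chi_lim W w B e p HWB He Hform Hp th).
  assert (H2 := chi_lim (rev W) w B e r HWBr He Hformr Hr (- th)).
  apply (is_lim_seq_ext (fun n => chi p w th (S n) * chi p w th n + chi r w (- th) n * chi r w (- th) (S n))).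
  - intros n. unfold bdry. rewrite <- !phi_neg, <- !phi_nat.
    replace (- Z.of_nat (S n))%Z with (- Z.of_nat n - 1)%Z by lia.
    replace (Z.of_nat (S n)) with (Z.of_nat n + 1)%Z by lia. reflexivity.
  - replace (Finite 0) with (Finite (0 * 0 + 0 * 0)) by (f_equal; ring).
    apply is_lim_seq_plus'; apply is_lim_seq_mult'; auto.
    + apply (is_lim_seq_incr_1 (chi p w th)); auto.
    + apply (is_lim_seq_incr_1 (chi r w (- th))); auto.
Qed.

Lemma form_limit th x a (N0 : nat) :
  (forall N, (N0 <= N)%nat -> x <= a + bdry th N) -> x <= a.
Proof.
  intros H.
  assert (Hl : is_lim_seq (fun N => a + bdry th (N + N0)%nat) (a + 0)).
  { apply is_lim_seq_plus'; [apply is_lim_seq_const|]. apply (is_lim_seq_incr_n (bdry th) N0), bdry_lim. }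
  replace a with (a + 0) by ring.
  refine (is_lim_seq_le (fun _ => x) _ _ _ _ (is_lim_seq_const _) Hl).
  intros N. apply H; lia.
Qed.

Definition phi_sum th N : R := zsum (- Z.of_nat N) (2 * N + 1) (fun k => phi th k ^ 2).

Lemma phi_sum_bound th N : e * phi_sum th N <= gap th.
Proof.
  apply (form_limit th _ _ N). intros M HM. rewrite <- phi_form.
  eapply Rle_trans; [|apply Hform; lia]. apply Rmult_le_compat_l; [lra|].
  apply zsum_sub_le; [intros; apply pow2_ge_0| |]; lia.
Qed.

Lemma gap_ge th : e <= gap th.
Proof.
  assert (H := phi_sum_bound th 0). unfold phi_sum in H. cbn [zsum] in H. simpl in H.
  rewrite phi_0 in H. lra.
Qed.

(** Barta's inequality with ground state [phi th] and a weight at the site 0, the only one where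
    [phi th] is not a solution. *)
Lemma gap_form th q n u : (q <= 0 < q + Z.of_nat n)%Z ->
  gap th * u 0%Z ^ 2 <= form (orb w W th) q n u.
Proof.
  intros Hq.
  assert (H := barta (orb w W th) (phi th) (fun k => if Z.eq_dec k 0 then gap th else 0) u q n ltac:(lia)).
  rewrite (zsum_single _ _ _ 0%Z) in H; [| lia |].
  2:{ intros k _ Hk. destruct (Z.eq_dec k 0); [easy|ring]. }
  destruct (Z.eq_dec 0 0); [|easy]. apply H; clear H.
  - intros; apply phi_pos.
  - apply Rlt_le, phi_pos.
  - apply Rlt_le, phi_pos.
  - intros k Hk. destruct (Z.eq_dec k 0) as [->|Hk0].
    + rewrite <- phi_defect, phi_0. unfold defect.
      replace (0 + 1)%Z with 1%Z by lia. replace (0 - 1)%Z with (-1)%Z by lia. lra.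
    + rewrite phi_eq by auto. lra.
Qed.

Lemma gap_form_shift th m q n u : (q <= m < q + Z.of_nat n)%Z ->
  gap (th + IZR m * w) * u m ^ 2 <= form (orb w W th) q n u.
Proof.
  intros H. assert (Hg := gap_form (th + IZR m * w) (q - m) n (shiftz m u) ltac:(lia)).
  unfold shiftz at 1 in Hg. rewrite Z.add_0_l in Hg. rewrite <- shiftz_orb in Hg.
  unfold shiftz in Hg. rewrite (form_shift (orb w W th) (q - m) n u m) in Hg.
  replace (q - m + m)%Z with q in Hg by lia. auto.
Qed.

(** Seen from the site [m], [phi th] is a trial function for the phase [th + m w] with central value
    [phi th m]. At a minimizer of the gap this forces [phi th m <= 1]. *)
Lemma gap_phi th m : gap (th + IZR m * w) * phi th m ^ 2 <= gap th.
Proof.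
  apply (form_limit th _ _ (Z.to_nat (Z.abs m))). intros N HN. rewrite <- phi_form.
  apply gap_form_shift. lia.
Qed.

Lemma minimizer_cfg th : (forall t, gap th <= gap t) -> cfg (orb w W th) (phi th).
Proof.
  intros Hmin. split; [|split].
  - intros k. split; [apply Rlt_le, phi_pos|].
    assert (H1 := gap_phi th k). assert (H2 := Hmin (th + IZR k * w)).
    assert (H3 := gap_ge th). assert (H4 := phi_pos th k).
    apply Rnot_lt_le. intros Hlt.
    assert (1 < phi th k ^ 2) by nra.
    assert (gap th * phi th k ^ 2 <= gap (th + IZR k * w) * phi th k ^ 2)
      by (apply Rmult_le_compat_r; lra).
    nra.
  - apply phi_0.
  - intros k Hk. apply Req_le, phi_eq; auto.
Qed.

Lemma gap_eq th : gap th = p (th + w) - / r (- th).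
Proof. unfold gap. rewrite (contracted_inv W w e p He Hform Hp). ring. Qed.

Lemma gap_period th k : gap (th + IZR k) = gap th.
Proof.
  unfold gap. rewrite HWper, (contracted_period W w p HWper Hp).
  replace (- (th + IZR k)) with (- th + IZR (- k)) by (rewrite opp_IZR; ring).
  rewrite (contracted_period (rev W) w r); auto.
  intros t j. unfold rev. rewrite <- (HWper (- t) (- j)). f_equal. rewrite opp_IZR. ring.
Qed.

(* Averaging the two invariant slopes gives a strict supersolution. *)
Lemma gap_coercive d : 0 < d -> (forall t, d <= gap t) ->
  forall th q n u, (0 < n)%nat ->
  d ^ 2 / (4 * B ^ 3) * zsum q n (fun k => u k ^ 2) <= form (orb w W th) q n u.
Proof.
  intros Hd Hgap th q n u Hn. rewrite <- zsum_scal.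
  pose (x := fun k => p (th + IZR k * w)). pose (z := fun k => / r (w - th - IZR k * w)).
  assert (Hx : forall k, 0 < x k < B).
  { intros k. split; [apply pair_p_pos|apply (contracted_lt W w B e p); auto]. }
  assert (Hz : forall k, 0 < z k < B).
  { intros k. split; [apply Rinv_0_lt_compat, pair_r_pos|].
    apply (contracted_inv_lt (rev W) w B e r HWBr He Hformr Hr). }
  assert (Hxz : forall k, d <= x k - z k).
  { intros k. unfold x, z. specialize (Hgap (th + IZR k * w - w)). rewrite gap_eq in Hgap.
    replace (th + IZR k * w - w + w) with (th + IZR k * w) in Hgap by ring.
    replace (- (th + IZR k * w - w)) with (w - th - IZR k * w) in Hgap by ring. auto. }
  assert (Wx : forall k, orb w W th k = x (k + 1)%Z + / x k).
  { intros k. unfold orb, x. replace (th + IZR (k + 1) * w) with (th + IZR k * w + w) by (rewrite plus_IZR; ring).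
    rewrite (contracted_inv W w e p He Hform Hp). ring. }
  assert (Wz : forall k, orb w W th k = z (k + 1)%Z + / z k).
  { intros k. unfold orb, z. rewrite Rinv_inv.
    replace (w - th - IZR (k + 1) * w) with (- th - IZR k * w) by (rewrite plus_IZR; ring).
    replace (w - th - IZR k * w) with (- th - IZR k * w + w) by ring.
    rewrite (contracted_inv (rev W) w e r He Hformr Hr). unfold rev.
    replace (- (- th - IZR k * w)) with (th + IZR k * w) by ring. ring. }
  pose (y := fun k => (x k + z k) / 2).
  assert (Hy : forall k, 0 < y k) by (intros k; specialize (Hx k); specialize (Hz k); unfold y; lra).
  pose (g := fun k => zprod q (Z.to_nat (k - q + 1)) y).
  assert (Hg : forall k, 0 < g k) by (intros k; apply zprod_pos; auto).
  assert (Hg1 : forall k, (q - 1 <= k)%Z -> g (k + 1)%Z = g k * y (k + 1)%Z).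
  { intros k Hk. unfold g. replace (Z.to_nat (k + 1 - q + 1)) with (S (Z.to_nat (k - q + 1))) by lia.
    cbn [zprod]. do 2 f_equal. lia. }
  apply (barta _ g (fun _ => d ^ 2 / (4 * B ^ 3))); auto.
  - apply Rlt_le, Hg.
  - apply Rlt_le, Hg.
  - intros k Hk. rewrite (Hg1 k) by lia. assert (H := Hg1 (k - 1)%Z ltac:(lia)).
    replace (k - 1 + 1)%Z with k in H by lia. rewrite H.
    assert (H1 := Hg (k - 1)%Z). assert (Hyk := Hy k).
    assert (Hkey : d ^ 2 / (4 * B ^ 3) <= orb w W th k - y (k + 1)%Z - / y k).
    { assert (E : orb w W th k = (x (k + 1)%Z + / x k + (z (k + 1)%Z + / z k)) / 2)
        by (generalize (Wx k) (Wz k); lra).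
      specialize (Hx k) as Hxk. specialize (Hz k) as Hzk. specialize (Hxz k) as Hdk.
      (* The strict convexity of [1 / x] between [x k] and [z k], made explicit. The denominator is
         at most [2 * B^2 * 2B], whence [4 B^3]. *)
      assert (E2 : orb w W th k - y (k + 1)%Z - / y k
         = (x k - z k) ^ 2 * / (2 * (x k * z k * (x k + z k)))).
      { rewrite E. unfold y. field. lra. }
      rewrite E2. unfold Rdiv. apply Rmult_le_compat.
      - apply pow2_ge_0.
      - apply Rlt_le, Rinv_0_lt_compat. apply Rmult_lt_0_compat; [lra|]. apply pow_lt; lra.
      - apply pow_incr; lra.
      - assert (0 < x k * z k) by (apply Rmult_lt_0_compat; lra).
        assert (x k * z k <= B * B) by (apply Rmult_le_compat; lra).
        apply Rinv_le_contravar.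
        + apply Rmult_lt_0_compat; [lra|]. apply Rmult_lt_0_compat; lra.
        + assert (x k * z k * (x k + z k) <= B * B * (B + B)) by (apply Rmult_le_compat; lra).
          simpl. lra. }
    assert (H2 : 0 < g (k - 1)%Z * y k) by (apply Rmult_lt_0_compat; auto).
    apply Rle_trans with ((orb w W th k - y (k + 1)%Z - / y k) * (g (k - 1)%Z * y k)).
    + apply Rmult_le_compat_r; lra.
    + right. field. lra.
Qed.

(* The function [phi] of the potential [W] serves as a trial function for [W']. *)
Lemma gap_energy_step W' h delta S th :
  (forall t, W' t = W t + h) -> 0 <= h ->
  (forall t q n u, (q <= 0 < q + Z.of_nat n)%Z -> delta * u 0%Z ^ 2 <= form (orb w W' t) q n u) ->
  (forall N, phi_sum th N <= S) ->
  delta <= gap th + h * S.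
Proof.
  intros HW' Hh HT HS. apply (form_limit th _ _ 0). intros N _.
  assert (H := HT th (- Z.of_nat N)%Z (2 * N + 1)%nat (phi th) ltac:(lia)).
  rewrite phi_0, (form_diff (orb w W th)), phi_form in H.
  rewrite (zsum_ext _ _ _ (fun k => h * phi th k ^ 2)) in H by (intros; unfold orb; rewrite HW'; ring).
  rewrite zsum_scal in H. fold (phi_sum th N) in H.
  assert (h * phi_sum th N <= h * S) by (apply Rmult_le_compat_l; auto). lra.
Qed.
End Pair.

(** * Lower bound for the derivative of the invariant directions *)

(** The solution that follows the slope [p], continued to the right of the site 0; [chi] gives its
    entries on the left. *)
Fixpoint grow (p : R -> R) (w t : R) (n : nat) : R :=
  match n with O => 1 | S k => grow p w t k * p (t + INR (S k) * w) end.

Lemma pow_one_plus y n : 0 <= y -> (1 + y) ^ n * (1 - INR n * y) <= 1.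
Proof.
  intros Hy. induction n as [|n IH]; [simpl; lra|].
  assert (0 <= (1 + y) ^ n) by (apply pow_le; lra).
  assert (0 <= INR n) by apply pos_INR.
  cbn [pow]. rewrite S_INR.
  assert ((1 + y) * (1 - (INR n + 1) * y) <= 1 - INR n * y) by nra.
  apply Rle_trans with ((1 + y) ^ n * ((1 + y) * (1 - (INR n + 1) * y))); [right; ring|].
  apply Rle_trans with ((1 + y) ^ n * (1 - INR n * y)); auto. apply Rmult_le_compat_l; auto.
Qed.

Lemma pow_one_minus y n : 0 <= y <= 1 -> 1 - INR n * y <= (1 - y) ^ n.
Proof.
  intros Hy. induction n as [|n IH]; [simpl; lra|].
  rewrite S_INR. cbn [pow]. assert (0 <= INR n) by apply pos_INR.
  apply Rle_trans with ((1 - y) * (1 - INR n * y)); [nra|]. apply Rmult_le_compat_l; lra.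
Qed.

Lemma first_below (f : nat -> R) d R0 : f R0 <= d ->
  exists N, (N <= R0)%nat /\ f N <= d /\ forall n, (n < N)%nat -> d < f n.
Proof.
  induction R0 as [R0 IH] using lt_wf_ind. intros H.
  destruct (classic (exists n, (n < R0)%nat /\ f n <= d)) as [[n [Hn Hf]]|Hno].
  - destruct (IH n Hn Hf) as [N [H1 [H2 H3]]]. exists N. repeat split; auto; lia.
  - exists R0. repeat split; auto. intros n Hn. apply Rnot_le_lt. intros Hle. apply Hno. exists n; auto.
Qed.

Section Lower.
Variables (W : R -> R) (w B e : R) (p r : R -> R).
Hypothesis HWB : forall t, W t <= B.
Hypothesis He : 0 < e.
Hypothesis Hform : forall th p n u, (0 < n)%nat ->
  e * zsum p n (fun k => u k ^ 2) <= form (orb w W th) p n u.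
Hypothesis Hp : contracted W w p.
Hypothesis Hr : contracted (rev W) w r.
Variables (th c M s rho : R) (R0 : nat).
Let delta := gap W p r th.
Hypothesis Hrho : 0 < rho <= 1.
Hypothesis Hdec : forall n, phi w p r th (Z.of_nat n) <= rho ^ n /\ phi w p r th (- Z.of_nat n) <= rho ^ n.
Hypothesis Hc : 0 < c.
Hypothesis Hsep : forall t u, cfg (orb w W t) u -> 0 < nd (t - th) ->
  delta + c * nd (t - th) ^ 2 <= defect (orb w W t) u.
Hypothesis HM : forall t t', Rabs (p t - p t') <= M * Rabs (t - t').
Hypothesis HM0 : 0 < M.
Hypothesis Hs : 0 < s <= / 2.
Hypothesis HR0 : rho ^ R0 <= delta.
Hypothesis Hsm : forall m, m <> 0%Z -> (Z.abs m <= Z.of_nat R0)%Z -> 2 * s <= nd (IZR m * w).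
Hypothesis HsM : 2 * (INR R0 + 1) * (B * M * s) <= 1.

Let U := orb w W (th + s).

Lemma lower_pos t : 0 < p t.
Proof. apply (contracted_gt0 W w e p He Hform Hp). Qed.

Lemma lower_pos_form t : pos_form (orb w W t).
Proof. exists e. split; auto. Qed.

(** Separation is applied at the site [m] of minimal defect. Its phase is [th + s + m w], at
    distance at least [s] from [th], because [nd (m w) >= 2 s] for all nonzero [m] in the window. *)
Lemma window_defect N : (N <= R0)%nat ->
  c * s ^ 2 <= wdefect U (- Z.of_nat R0) (Z.of_nat N) 0.
Proof.
  intros HN.
  assert (HU : pos_form U) by apply lower_pos_form.
  destruct (finite_argmin (wdefect U (- Z.of_nat R0) (Z.of_nat N)) (- Z.of_nat R0) (Z.of_nat N) ltac:(lia))
    as [m [Hm Hmin]].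
  eapply Rle_trans; [|apply (Hmin 0%Z ltac:(lia))].
  destruct (wsol_cfg U _ _ m HU Hm Hmin) as [H1 H2].
  assert (Hns : nd s = s) by (rewrite nd_small; rewrite Rabs_pos_eq; lra).
  assert (Hnd : s <= nd (s + IZR m * w)).
  { destruct (Z.eq_dec m 0) as [->|Hm0].
    - rewrite Rmult_0_l, Rplus_0_r, Hns. lra.
    - specialize (Hsm m Hm0 ltac:(lia)).
      assert (H := nd_triang (s + IZR m * w) (- s)). rewrite nd_opp, Hns in H.
      replace (s + IZR m * w + - s) with (IZR m * w) in H by ring. lra. }
  change (fun k : Z => U (k + m)%Z) with (shiftz m U) in *.
  rewrite (shiftz_orb w W (th + s) m : shiftz m U = _) in H1, H2.
  assert (H := Hsep (th + s + IZR m * w) _ H1).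
  replace (th + s + IZR m * w - th) with (s + IZR m * w) in H by ring.
  specialize (H ltac:(lra)). rewrite H2 in H.
  assert (c * s ^ 2 <= c * nd (s + IZR m * w) ^ 2).
  { apply Rmult_le_compat_l; [lra|]. apply pow_incr. lra. }
  assert (0 < delta) by (generalize (gap_ge W w B e p r HWB He Hform Hp Hr th); unfold delta; lra).
  lra.
Qed.

Definition uhat (t : R) (k : Z) : R :=
  if Z_le_dec 0 k then grow p w t (Z.to_nat k) else chi p w t (Z.to_nat (- k)).

Lemma uhat_nat t n : uhat t (Z.of_nat n) = grow p w t n.
Proof. unfold uhat. destruct (Z_le_dec 0 (Z.of_nat n)); [|lia]. f_equal. lia. Qed.

Lemma uhat_neg t n : uhat t (- Z.of_nat n) = chi p w t n.
Proof.
  unfold uhat. destruct (Z_le_dec 0 (- Z.of_nat n)).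
  - destruct n; [reflexivity|lia].
  - f_equal. lia.
Qed.

Lemma uhat_step t k : uhat t (k + 1)%Z = uhat t k * p (t + IZR (k + 1) * w).
Proof.
  destruct (Z_le_dec 0 k).
  - pose (n := Z.to_nat k). replace (k + 1)%Z with (Z.of_nat (S n)) by (unfold n; lia).
    replace k with (Z.of_nat n) by (unfold n; lia). rewrite !uhat_nat, <- INR_IZR_INZ. reflexivity.
  - pose (n' := Z.to_nat (- k - 1)). replace (k + 1)%Z with (- Z.of_nat n')%Z by (unfold n'; lia).
    replace k with (- Z.of_nat (S n'))%Z by (unfold n'; lia). rewrite !uhat_neg. cbn [chi].
    rewrite opp_IZR, <- INR_IZR_INZ. replace (t + - INR n' * w) with (t - INR n' * w) by ring.
    assert (H := lower_pos (t - INR n' * w)). field. lra.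
Qed.

Lemma uhat_form t N :
  form (orb w W t) (- Z.of_nat R0) (R0 + N + 1) (uhat t)
  = chi p w t R0 * chi p w t (S R0) + grow p w t N * grow p w t (S N).
Proof.
  rewrite form_defect, zsum_zero.
  - replace (- Z.of_nat R0 - 1)%Z with (- Z.of_nat (S R0))%Z by lia.
    replace (- Z.of_nat R0 + Z.of_nat (R0 + N + 1) - 1)%Z with (Z.of_nat N) by lia.
    replace (- Z.of_nat R0 + Z.of_nat (R0 + N + 1))%Z with (Z.of_nat (S N)) by lia.
    rewrite !uhat_neg, !uhat_nat. ring.
  - intros k _. assert (H1 := uhat_step t k). assert (H2 := uhat_step t (k - 1)).
    replace (k - 1 + 1)%Z with k in H2 by lia.
    assert (H3 := contracted_inv W w e p He Hform Hp (t + IZR k * w)).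
    replace (t + IZR k * w + w) with (t + IZR (k + 1) * w) in H3 by (rewrite plus_IZR; ring).
    assert (Hk := lower_pos (t + IZR k * w)).
    unfold orb. rewrite H1, H3.
    replace (uhat t (k - 1)%Z) with (/ p (t + IZR k * w) * uhat t k) by (rewrite H2; field; lra). ring.
Qed.

Lemma grow_pos t n : 0 < grow p w t n.
Proof. induction n; simpl; [lra|]. apply Rmult_lt_0_compat; auto. apply lower_pos. Qed.

Lemma lower_y_small : 0 <= B * M * s /\ forall n, (n <= S R0)%nat -> INR n * (B * M * s) <= / 2.
Proof.
  assert (HB := contracted_B_pos W w B e p HWB He Hform Hp).
  assert (Hy : 0 <= B * M * s) by (apply Rmult_le_pos; [apply Rmult_le_pos|]; lra).
  split; auto. intros n Hn. apply le_INR in Hn. rewrite S_INR in Hn.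
  assert (INR n * (B * M * s) <= (INR R0 + 1) * (B * M * s)) by (apply Rmult_le_compat_r; auto). lra.
Qed.

Lemma p_shift_bounds t :
  p t * (1 - B * M * s) <= p (t + s) <= p t * (1 + B * M * s).
Proof.
  assert (H := HM (t + s) t). replace (t + s - t) with s in H by ring.
  rewrite (Rabs_pos_eq s) in H by lra. apply Rabs_le_between in H.
  assert (Hil := contracted_inv_lt W w B e p HWB He Hform Hp t). assert (Hpt := lower_pos t).
  assert (1 <= p t * B).
  { apply (Rmult_lt_compat_l (p t)) in Hil; auto. rewrite Rinv_r in Hil; lra. }
  assert (0 <= M * s) by (apply Rmult_le_pos; lra).
  assert (M * s <= p t * (B * M * s)).
  { replace (p t * (B * M * s)) with ((p t * B) * (M * s)) by ring. nra. }
  lra.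
Qed.

(** Since [p] exceeds [1 / B], a Lipschitz constant [M] changes each factor by a relative error of
    at most [B M s]; [HsM] keeps the accumulated error over [R0 + 1] factors below 1/2. *)
Lemma grow_shift n : (n <= S R0)%nat -> grow p w (th + s) n <= 2 * grow p w th n.
Proof.
  intros Hn. destruct lower_y_small as [Hy Hyn]. set (y := B * M * s) in *.
  assert (H : forall m, grow p w (th + s) m <= grow p w th m * (1 + y) ^ m).
  { induction m as [|m IH]; [simpl; lra|]. cbn [grow pow].
    replace (th + s + INR (S m) * w) with (th + INR (S m) * w + s) by ring.
    destruct (p_shift_bounds (th + INR (S m) * w)) as [_ H]. fold y in H.
    assert (H1 := grow_pos (th + s) m). assert (H2 := lower_pos (th + INR (S m) * w + s)).
    apply Rle_trans with ((grow p w th m * (1 + y) ^ m) * (p (th + INR (S m) * w) * (1 + y))).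
    - apply Rmult_le_compat; lra.
    - right. ring. }
  specialize (Hyn n Hn). assert (H3 := pow_one_plus y n Hy).
  assert (0 < (1 + y) ^ n) by (apply pow_lt; lra).
  assert ((1 + y) ^ n <= 2) by nra.
  eapply Rle_trans; [apply H|]. rewrite Rmult_comm. apply Rmult_le_compat_r; [|auto].
  apply Rlt_le, grow_pos.
Qed.

Lemma chi_shift_bound n : (n <= S R0)%nat -> chi p w (th + s) n <= 2 * chi p w th n.
Proof.
  intros Hn. destruct lower_y_small as [Hy Hyn].
  assert (Hy1 := Hyn 1%nat ltac:(lia)). simpl in Hy1. set (y := B * M * s) in *.
  assert (Hcp : forall t m, 0 < chi p w t m) by (intros; apply (chi_pos W w e p He Hform Hp)).
  assert (H : forall m, chi p w (th + s) m * (1 - y) ^ m <= chi p w th m).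
  { induction m as [|m IH]; [simpl; lra|]. cbn [chi pow].
    replace (th + s - INR m * w) with (th - INR m * w + s) by ring.
    destruct (p_shift_bounds (th - INR m * w)) as [H _]. fold y in H.
    assert (H1 := Hcp (th + s) m). assert (H2 := lower_pos (th - INR m * w + s)).
    assert (H3 := lower_pos (th - INR m * w)).
    assert (H4 : (1 - y) / p (th - INR m * w + s) <= / p (th - INR m * w)).
    { apply (Rmult_le_reg_r (p (th - INR m * w) * p (th - INR m * w + s)));
        [apply Rmult_lt_0_compat; auto|].
      replace ((1 - y) / p (th - INR m * w + s) * (p (th - INR m * w) * p (th - INR m * w + s)))
        with (p (th - INR m * w) * (1 - y)) by (field; lra).
      replace (/ p (th - INR m * w) * (p (th - INR m * w) * p (th - INR m * w + s)))
        with (p (th - INR m * w + s)) by (field; lra). lra. }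
    apply Rle_trans with ((chi p w (th + s) m * (1 - y) ^ m) * ((1 - y) / p (th - INR m * w + s))).
    - right. field. lra.
    - unfold Rdiv at 2. apply Rmult_le_compat; auto.
      + apply Rmult_le_pos; [lra|apply pow_le; lra].
      + apply Rdiv_le_0_compat; lra. }
  specialize (Hyn n Hn). assert (H3 := pow_one_minus y n ltac:(lra)).
  specialize (H n). assert (H4 := Hcp (th + s) n). nra.
Qed.

(** The Wronskian of [grow] and [phi] is [delta], so the quotient of the two increases by
    [delta / (phi n * phi (n+1))] per step, less than 1 before [N]. Hence [grow] is at most
    [(n+1) phi] up to [N], where the product of consecutive values of [phi] has dropped to
    [delta]. *)
Lemma grow_resonant N : (forall n, (n < N)%nat -> delta < phi w p r th (Z.of_nat n) * phi w p r th (Z.of_nat (S n))) ->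
  phi w p r th (Z.of_nat N) * phi w p r th (Z.of_nat (S N)) <= delta ->
  grow p w th N * grow p w th (S N) <= 2 * (INR N + 1) ^ 2 * delta.
Proof.
  set (f := fun n => phi w p r th (Z.of_nat n)). set (u := grow p w th).
  change (forall n, (n < N)%nat -> delta < phi w p r th (Z.of_nat n) * phi w p r th (Z.of_nat (S n)))
    with (forall n, (n < N)%nat -> delta < f n * f (S n)).
  change (phi w p r th (Z.of_nat N) * phi w p r th (Z.of_nat (S N))) with (f N * f (S N)).
  intros HN1 HN2.
  assert (Hf : forall n, 0 < f n) by (intros; apply (phi_pos W w e p r He Hform Hp Hr)).
  assert (Hu : forall n, 0 < u n) by apply grow_pos.
  assert (Hd : 0 < delta) by (generalize (gap_ge W w B e p r HWB He Hform Hp Hr th); unfold delta; lra).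
  assert (Hw : forall n, u (S n) * f n - u n * f (S n) = delta).
  { induction n as [|n IH].
    - unfold f, u. rewrite (phi_1 w p r th : phi w p r th (Z.of_nat 1) = _), (phi_0 w p r th : phi w p r th (Z.of_nat 0) = _).
      simpl. unfold delta. rewrite (gap_eq W w e p r He Hform Hp). rewrite !Rmult_1_l. ring.
    - rewrite <- IH.
      assert (H1 := phi_eq W w e p r He Hform Hp Hr th (Z.of_nat (S n)) ltac:(lia)).
      replace (Z.of_nat (S n) + 1)%Z with (Z.of_nat (S (S n))) in H1 by lia.
      replace (Z.of_nat (S n) - 1)%Z with (Z.of_nat n) in H1 by lia. fold (f (S n)) (f n) (f (S (S n))) in H1.
      assert (H2 : u (S (S n)) = orb w W th (Z.of_nat (S n)) * u (S n) - u n).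
      { unfold u. cbn [grow]. unfold orb. rewrite <- INR_IZR_INZ.
        assert (H3 := contracted_inv W w e p He Hform Hp (th + INR (S n) * w)).
        replace (th + INR (S n) * w + w) with (th + INR (S (S n)) * w) in H3 by (rewrite (S_INR (S n)); ring).
        rewrite H3. assert (H4 := lower_pos (th + INR (S n) * w)). field. lra. }
      rewrite H2. replace (f (S (S n))) with (orb w W th (Z.of_nat (S n)) * f (S n) - f n) by lra. ring. }
  assert (Hle : forall n, (n <= N)%nat -> u n <= (INR n + 1) * f n).
  { induction n as [|n IH]; intros Hn.
    - unfold u, f. rewrite (phi_0 w p r th : phi w p r th (Z.of_nat 0) = _). simpl. lra.
    - specialize (IH ltac:(lia)). specialize (HN1 n ltac:(lia)). specialize (Hw n). rewrite S_INR.
      assert (H1 := Hf n). assert (H2 := Hf (S n)).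
      apply (Rmult_le_reg_r (f n)); auto.
      assert (u n * f (S n) <= (INR n + 1) * f n * f (S n)) by (apply Rmult_le_compat_r; lra). lra. }
  specialize (Hle N ltac:(lia)). specialize (Hw N).
  assert (HI : 0 <= INR N) by apply pos_INR.
  assert (H1 := Hf N). assert (H2 := Hf (S N)). assert (H3 := Hu N). assert (H4 := Hu (S N)).
  assert (E1 : u N * u (S N) <= (INR N + 1) * (f N * u (S N))).
  { apply Rle_trans with ((INR N + 1) * f N * u (S N)); [apply Rmult_le_compat_r; lra|right; ring]. }
  assert (E2 : u N * f (S N) <= (INR N + 1) * (f N * f (S N))).
  { apply Rle_trans with ((INR N + 1) * f N * f (S N)); [apply Rmult_le_compat_r; lra|right; ring]. }
  assert (E3 : (INR N + 1) * (f N * f (S N)) <= (INR N + 1) * delta) by (apply Rmult_le_compat_l; lra).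
  assert (E4 : f N * u (S N) <= delta + (INR N + 1) * delta) by lra.
  assert (E5 : (INR N + 1) * (f N * u (S N)) <= (INR N + 1) * (delta + (INR N + 1) * delta))
    by (apply Rmult_le_compat_l; lra).
  assert (E6 : 0 <= INR N * delta) by (apply Rmult_le_pos; lra).
  assert (E7 : 0 <= INR N * (INR N * delta)) by (apply Rmult_le_pos; lra).
  lra.
Qed.

(** The trial function [uhat (th + s)] solves the equation at every site, so its energy on the
    window is made of boundary products alone: at most [4 delta] on the left, by decay over [R0]
    steps, and [8 (N+1)^2 delta] on the right, where the window is stopped at the first [N] at which
    [phi N * phi (N+1)] is at most [delta]. *)
Theorem slope_lower_bound : c * s ^ 2 <= 12 * (INR R0 + 1) ^ 2 * delta.
Proof.
  set (f := fun n => phi w p r th (Z.of_nat n) * phi w p r th (Z.of_nat (S n))).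
  assert (Hfp : forall k, 0 < phi w p r th k) by (apply (phi_pos W w e p r He Hform Hp Hr)).
  assert (Hd : 0 < delta) by (generalize (gap_ge W w B e p r HWB He Hform Hp Hr th); unfold delta; lra).
  assert (Hr0 : rho ^ S R0 <= 1) by (rewrite <- (pow1 (S R0)); apply pow_incr; lra).
  assert (Hr1 : 0 < rho ^ R0) by (apply pow_lt; lra).
  assert (Hr2 : 0 < rho ^ S R0) by (apply pow_lt; lra).
  assert (HfR : f R0 <= delta).
  { unfold f. destruct (Hdec R0) as [H1 _]. destruct (Hdec (S R0)) as [H2 _].
    apply Rle_trans with (rho ^ R0 * rho ^ S R0); [apply Rmult_le_compat; auto; apply Rlt_le, Hfp|nra]. }
  destruct (first_below f delta R0 HfR) as [N [HN1 [HN2 HN3]]].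
  assert (Hwin := window_defect N HN1).
  assert (HU : pos_form U) by apply lower_pos_form.
  assert (H1 := wdefect_form U (- Z.of_nat R0) (Z.of_nat N) 0 (uhat (th + s)) HU ltac:(lia)).
  replace (Z.to_nat (Z.of_nat N - - Z.of_nat R0 + 1)) with (R0 + N + 1)%nat in H1 by lia.
  unfold U in H1 at 2. rewrite uhat_form in H1.
  rewrite (uhat_nat (th + s) 0 : uhat (th + s) 0 = _) in H1.
  change (grow p w (th + s) 0) with 1 in H1. rewrite pow1, Rmult_1_r in H1.
  assert (G1 := grow_shift N ltac:(lia)). assert (G2 := grow_shift (S N) ltac:(lia)).
  assert (C1 := chi_shift_bound R0 ltac:(lia)). assert (C2 := chi_shift_bound (S R0) ltac:(lia)).
  assert (Hgp := grow_pos). 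
  assert (Hcp : forall t m, 0 < chi p w t m) by (intros; apply (chi_pos W w e p He Hform Hp)).
  assert (G3 : grow p w (th + s) N * grow p w (th + s) (S N) <= 4 * (2 * (INR N + 1) ^ 2 * delta)).
  { apply Rle_trans with ((2 * grow p w th N) * (2 * grow p w th (S N))).
    - apply Rmult_le_compat; auto; apply Rlt_le, Hgp.
    - assert (H := grow_resonant N HN3 HN2). lra. }
  assert (C3 : chi p w (th + s) R0 * chi p w (th + s) (S R0) <= 4 * delta).
  { apply Rle_trans with ((2 * chi p w th R0) * (2 * chi p w th (S R0))).
    - apply Rmult_le_compat; auto; apply Rlt_le, Hcp.
    - destruct (Hdec R0) as [_ D1]. destruct (Hdec (S R0)) as [_ D2].
      rewrite phi_neg in D1, D2.
      assert (chi p w th R0 * chi p w th (S R0) <= rho ^ R0 * rho ^ S R0)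
        by (apply Rmult_le_compat; auto; apply Rlt_le, Hcp).
      assert (rho ^ R0 * rho ^ S R0 <= delta) by nra. lra. }
  assert (HNR : (INR N + 1) ^ 2 * delta <= (INR R0 + 1) ^ 2 * delta).
  { apply Rmult_le_compat_r; [lra|]. apply pow_incr. apply le_INR in HN1. generalize (pos_INR N). lra. }
  assert (1 * delta <= (INR R0 + 1) ^ 2 * delta).
  { apply Rmult_le_compat_r; [lra|]. apply pow_R1_Rle. generalize (pos_INR R0). lra. }
  lra.
Qed.
End Lower.

(** * The potential *)

Lemma taylor_lower f f1 f2 c x y :
  (forall t, derivable_pt_lim f t (f1 t)) -> (forall t, derivable_pt_lim f1 t (f2 t)) ->
  (forall t, Rmin x y <= t <= Rmax x y -> c <= f2 t) ->
  f x + f1 x * (y - x) + c / 2 * (y - x) ^ 2 <= f y.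
Proof.
  intros H1 H2 Hc.
  set (g := fun t => f t - f x - f1 x * (t - x) - c / 2 * (t - x) ^ 2).
  set (g1 := fun t => f1 t - f1 x - c * (t - x)).
  assert (Hg : forall t, derivable_pt_lim g t (g1 t)).
  { intros t. apply is_derive_Reals. unfold g, g1.
    assert (Hf : is_derive f t (f1 t)) by (apply is_derive_Reals; auto).
    auto_derive.
    - exists (f1 t). auto.
    - replace (Derive (fun x0 : R => f x0) t) with (f1 t)
        by (symmetry; apply is_derive_unique; auto). field. }
  assert (Hmono : forall a b, a <= b -> Rmin x y <= a -> b <= Rmax x y -> c * (b - a) <= f1 b - f1 a).
  { intros a b Hab Ha Hb. destruct (Rle_lt_or_eq_dec a b Hab) as [Hlt|Heq].
    - destruct (MVT_cor2 f1 f2 a b Hlt (fun t _ => H2 t)) as [t [Ht1 Ht2]].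
      rewrite Ht1. apply Rmult_le_compat_r; [lra|]. apply Hc; lra.
    - subst b. lra. }
  enough (0 <= g y) by (unfold g in *; lra).
  assert (Hgx : g x = 0) by (unfold g; ring).
  destruct (Rtotal_order x y) as [Hlt|[Heq|Hlt]].
  - destruct (MVT_cor2 g g1 x y Hlt (fun t _ => Hg t)) as [t [Ht1 Ht2]]. rewrite Hgx in Ht1.
    rewrite Rmin_left, Rmax_right in Hmono by lra.
    specialize (Hmono x t ltac:(lra) ltac:(lra) ltac:(lra)).
    assert (0 <= g1 t * (y - x)) by (apply Rmult_le_pos; unfold g1; lra). lra.
  - subst y. lra.
  - destruct (MVT_cor2 g g1 y x Hlt (fun t _ => Hg t)) as [t [Ht1 Ht2]]. rewrite Hgx in Ht1.
    rewrite Rmin_right, Rmax_left in Hmono by lra.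
    specialize (Hmono t x ltac:(lra) ltac:(lra) ltac:(lra)).
    assert (g1 t * (x - y) <= 0).
    { assert (0 <= - g1 t * (x - y)) by (apply Rmult_le_pos; unfold g1; lra). lra. }
    lra.
Qed.

Lemma taylor_upper f f1 f2 c x y :
  (forall t, derivable_pt_lim f t (f1 t)) -> (forall t, derivable_pt_lim f1 t (f2 t)) ->
  (forall t, Rmin x y <= t <= Rmax x y -> f2 t <= c) ->
  f y <= f x + f1 x * (y - x) + c / 2 * (y - x) ^ 2.
Proof.
  intros H1 H2 Hc.
  assert (H := taylor_lower (fun t => - f t) (fun t => - f1 t) (fun t => - f2 t) (- c) x y
    (fun t => derivable_pt_lim_opp f t _ (H1 t)) (fun t => derivable_pt_lim_opp f1 t _ (H2 t))
    ltac:(intros t Ht; specialize (Hc t Ht); lra)).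
  cbv beta in H. lra.
Qed.

Lemma derivative_lip f f1 A : (forall t, derivable_pt_lim f t (f1 t)) ->
  (forall t, Rabs (f1 t) <= A) -> forall t s, Rabs (f t - f s) <= A * Rabs (t - s).
Proof.
  intros H HA. assert (Hlt : forall t s, s < t -> Rabs (f t - f s) <= A * Rabs (t - s)).
  { intros t s Hst. destruct (MVT_cor2 f f1 s t Hst (fun x _ => H x)) as [x [Hx _]].
    rewrite Hx, Rabs_mult. apply Rmult_le_compat_r; [apply Rabs_pos|auto]. }
  intros t s. destruct (Rtotal_order s t) as [Hl|[->|Hl]]; auto.
  - rewrite !Rminus_diag, Rabs_R0. lra.
  - rewrite (Rabs_minus_sym (f t)), (Rabs_minus_sym t). auto.
Qed.

Lemma periodic1_Z (f : R -> R) : (forall x, f (x + 1) = f x) -> forall t k, f (t + IZR k) = f t.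
Proof.
  intros H.
  assert (Hn : forall n t, f (t + INR n) = f t).
  { induction n as [|n IH]; intros t; [simpl; f_equal; ring|].
    rewrite S_INR. replace (t + (INR n + 1)) with (t + INR n + 1) by ring. rewrite H; auto. }
  intros t k. destruct (Z_le_dec 0 k).
  - replace (IZR k) with (INR (Z.to_nat k)) by (rewrite INR_IZR_INZ; f_equal; lia). auto.
  - rewrite <- (Hn (Z.to_nat (- k)) (t + IZR k)). f_equal. rewrite INR_IZR_INZ.
    rewrite Z2Nat.id by lia. rewrite opp_IZR. ring.
Qed.

Lemma periodic_derivative (f f1 : R -> R) : (forall x, f (x + 1) = f x) ->
  (forall t, derivable_pt_lim f t (f1 t)) -> forall x, f1 (x + 1) = f1 x.
Proof.
  intros Hper H x. apply (uniqueness_limite f x); auto.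
  intros eps Heps. destruct (H (x + 1) eps Heps) as [d Hd]. exists d. intros h Hh1 Hh2.
  specialize (Hd h Hh1 Hh2). rewrite Hper in Hd.
  replace (x + 1 + h) with (x + h + 1) in Hd by ring. rewrite Hper in Hd. auto.
Qed.

Lemma derivable_continuity f f1 : (forall t, derivable_pt_lim f t (f1 t)) -> continuity f.
Proof. intros H t. apply derivable_continuous_pt. exists (f1 t). apply H. Qed.

Lemma periodic_bounded f : continuity f -> (forall x, f (x + 1) = f x) ->
  exists A, 0 < A /\ forall t, Rabs (f t) <= A.
Proof.
  intros Hc Hper. destruct (periodic_max (fun t => Rabs (f t))) as [m [_ Hm]].
  - apply continuity_abs; auto.
  - intros t k. f_equal. apply periodic1_Z; auto.
  - exists (m + 1). split; [|intros t; specialize (Hm t); lra].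
    specialize (Hm 0). generalize (Rabs_pos (f 0)). lra.
Qed.

Record potential (v v1 v2 : R -> R) (tmin Av A1 A2 cv rv c0 : R) : Prop := {
  pot_per : forall t k, v (t + IZR k) = v t;
  pot_per1 : forall t k, v1 (t + IZR k) = v1 t;
  pot_cont1 : continuity v1;
  pot_pos : 0 < Av /\ 0 < A1 /\ 0 < A2 /\ 0 < cv /\ 0 < rv /\ 0 < c0;
  pot_bound : forall t, Rabs (v t) <= Av;
  pot_bound1 : forall t, Rabs (v1 t) <= A1;
  pot_lip : forall t s, Rabs (v t - v s) <= A1 * Rabs (t - s);
  pot_taylor : forall t s, v (t + s) <= v t + s * v1 t + A2 / 2 * s ^ 2;
  pot_mid : forall t h, Rabs (v (t - h) + v (t + h) - 2 * v t) <= A2 * h ^ 2;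
  pot_conv : forall t h, Rabs (t - tmin) + Rabs h <= rv -> cv * h ^ 2 <= v (t - h) + v (t + h) - 2 * v t;
  pot_low : forall t, v tmin + c0 * nd (t - tmin) ^ 2 <= v t
}.

Lemma Rmin_Rmax_bound x y a d : Rabs (x - a) <= d -> Rabs (y - a) <= d ->
  forall t, Rmin x y <= t <= Rmax x y -> Rabs (t - a) <= d.
Proof.
  intros Hx Hy t Ht. apply Rabs_le_between in Hx, Hy. apply Rabs_le.
  destruct (Rle_dec x y); [rewrite Rmin_left, Rmax_right in Ht by lra|rewrite Rmin_right, Rmax_left in Ht by lra]; lra.
Qed.

Lemma potential_exists v v1 v2 tmin :
  periodic1 v -> C2_with v v1 v2 -> unique_min_mod1 v tmin -> 0 < v2 tmin ->
  exists Av A1 A2 cv rv c0, potential v v1 v2 tmin Av A1 A2 cv rv c0.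
Proof.
  intros Hper [Hd1 [Hd2 Hc2]] [Hmin Huniq] Hnd.
  assert (Hper1 := periodic_derivative v v1 Hper Hd1).
  assert (Hper2 := periodic_derivative v1 v2 Hper1 Hd2).
  assert (Hc0 := derivable_continuity v v1 Hd1). assert (Hc1 := derivable_continuity v1 v2 Hd2).
  destruct (periodic_bounded v Hc0 Hper) as [Av [HAv Hv]].
  destruct (periodic_bounded v1 Hc1 Hper1) as [A1 [HA1 Hv1]].
  destruct (periodic_bounded v2 Hc2 Hper2) as [A2 [HA2 Hv2]].
  set (cv := v2 tmin / 2).
  assert (Hrv : exists rv, 0 < rv <= / 2 /\ forall t, Rabs (t - tmin) <= rv -> cv <= v2 t).
  { destruct (Hc2 tmin cv ltac:(unfold cv; lra)) as [d [Hd H]].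
    assert (Hmp : 0 < Rmin d 1) by (apply Rmin_pos; lra).
    exists (Rmin d 1 / 2). split; [generalize (Rmin_r d 1); lra|]. intros t Ht.
    destruct (Req_dec t tmin) as [->|Hne]; [unfold cv; lra|].
    specialize (H t). simpl in H. unfold Rdist in H.
    assert (Hlt : Rabs (v2 t - v2 tmin) < cv).
    { apply H. split; [split; [exact I|auto]|]. generalize (Rmin_l d 1); lra. }
    apply Rabs_lt_between in Hlt. unfold cv in *. lra. }
  destruct Hrv as [rv [Hrv Hcv]].
  assert (Hcvp : 0 < cv) by (unfold cv; lra).
  assert (Hv1min : v1 tmin = 0).
  { assert (Hx : forall s, 0 <= v1 tmin * s + A2 / 2 * s ^ 2).
    { intros s. assert (H := taylor_upper v v1 v2 A2 tmin (tmin + s) Hd1 Hd2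
        ltac:(intros t _; generalize (Hv2 t) (Rle_abs (v2 t)); lra)).
      specialize (Hmin (tmin + s)). replace (tmin + s - tmin) with s in H by ring. lra. }
    specialize (Hx (- v1 tmin / A2)).
    replace (v1 tmin * (- v1 tmin / A2) + A2 / 2 * (- v1 tmin / A2) ^ 2) with (- (v1 tmin ^ 2 / (2 * A2))) in Hx
      by (field; lra).
    destruct (Req_dec (v1 tmin) 0) as [|Hne]; auto. exfalso.
    assert (0 < v1 tmin ^ 2 / (2 * A2)) by (apply Rdiv_lt_0_compat; [nra|lra]). lra. }
  assert (Hnear : forall t, Rabs (t - tmin) <= rv -> v tmin + cv / 2 * (t - tmin) ^ 2 <= v t).
  { intros t Ht. assert (H := taylor_lower v v1 v2 cv tmin t Hd1 Hd2). rewrite Hv1min in H.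
    assert (Hb : forall x, Rmin tmin t <= x <= Rmax tmin t -> cv <= v2 x).
    { intros x Hx. apply Hcv. apply (Rmin_Rmax_bound tmin t); auto. rewrite Rminus_diag, Rabs_R0. lra. }
    specialize (H Hb). lra. }
  (* Uniqueness of the minimum makes it strict on the compact arc at distance at least [rv] from
     [tmin]. *)
  assert (Hfar : exists m1, 0 < m1 /\ forall t, rv <= nd (t - tmin) -> v tmin + m1 <= v t).
  { destruct (continuity_ab_min v (tmin + rv) (tmin + 1 - rv) ltac:(lra) (fun c _ => Hc0 c)) as [x [Hx Hxr]].
    exists (v x - v tmin). split.
    - destruct (Rle_lt_or_eq_dec _ _ (Hmin x)) as [H|H]; [lra|].
      destruct (Huniq x (eq_sym H)) as [k Hk]. exfalso.
      assert (H1 : (0 < k)%Z) by (apply lt_IZR; lra). assert (H2 : (k < 1)%Z) by (apply lt_IZR; lra). lia.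
    - intros t Ht. destruct (periodic_reduce (t - tmin)) as [k Hk].
      rewrite <- (periodic1_Z v Hper t (- k)). rewrite opp_IZR.
      enough (v x <= v (t + - IZR k)) by lra. apply Hx.
      assert (H1 := nd_le (t - tmin) k). assert (H2 := nd_le (t - tmin) (k + 1)). rewrite plus_IZR in H2.
      rewrite Rabs_pos_eq in H1 by lra. rewrite Rabs_left1 in H2 by lra. lra. }
  destruct Hfar as [m1 [Hm1 Hfar]].
  (* [cv / 2] serves near [tmin] by Taylor's formula, [m1] elsewhere because [nd^2] is at most 1. *)
  set (c0 := Rmin (cv / 2) m1).
  assert (Hc0p : 0 < c0) by (apply Rmin_pos; lra).
  exists Av, A1, A2, cv, rv, c0. constructor; auto.
  - apply periodic1_Z; auto.
  - apply periodic1_Z; auto.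
  - repeat split; auto; lra.
  - apply (derivative_lip v v1); auto.
  - intros t s. assert (H := taylor_upper v v1 v2 A2 t (t + s) Hd1 Hd2
        ltac:(intros x _; generalize (Hv2 x) (Rle_abs (v2 x)); lra)).
    replace (t + s - t) with s in H by ring. lra.
  - intros t h.
    assert (U : forall s, v (t + s) <= v t + v1 t * s + A2 / 2 * s ^ 2).
    { intros s. assert (H := taylor_upper v v1 v2 A2 t (t + s) Hd1 Hd2
        ltac:(intros x _; generalize (Hv2 x) (Rle_abs (v2 x)); lra)).
      replace (t + s - t) with s in H by ring. lra. }
    assert (L : forall s, v t + v1 t * s + (- A2) / 2 * s ^ 2 <= v (t + s)).
    { intros s. assert (H := taylor_lower v v1 v2 (- A2) t (t + s) Hd1 Hd2
        ltac:(intros x _; specialize (Hv2 x); apply Rabs_le_between in Hv2; lra)).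
      replace (t + s - t) with s in H by ring. lra. }
    assert (U1 := U h). assert (U2 := U (- h)). assert (L1 := L h). assert (L2 := L (- h)).
    change (t - h) with (t + - h). replace ((- h) ^ 2) with (h ^ 2) in * by ring. apply Rabs_le. lra.
  - intros t h Hth.
    assert (Hb : forall s, Rabs s <= Rabs h -> v t + v1 t * s + cv / 2 * s ^ 2 <= v (t + s)).
    { intros s Hs. assert (H := taylor_lower v v1 v2 cv t (t + s) Hd1 Hd2).
      replace (t + s - t) with s in H by ring. apply H. intros x Hx. apply Hcv.
      apply (Rmin_Rmax_bound t (t + s)); auto.
      - generalize (Rabs_pos h); lra.
      - replace (t + s - tmin) with ((t - tmin) + s) by ring. generalize (Rabs_triang (t - tmin) s). lra. }
    assert (H1 := Hb h ltac:(lra)). assert (H2 := Hb (- h) ltac:(rewrite Rabs_Ropp; lra)).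
    change (t - h) with (t + - h). replace ((- h) ^ 2) with (h ^ 2) in H2 by ring. lra.
  - intros t. destruct (Rle_dec rv (nd (t - tmin))) as [H|H].
    + specialize (Hfar t H).
      assert (nd (t - tmin) ^ 2 <= 1).
      { generalize (nd_half (t - tmin)) (nd_pos (t - tmin)). nra. }
      assert (0 <= nd (t - tmin) ^ 2) by apply pow2_ge_0.
      assert (c0 <= m1) by apply Rmin_r. nra.
    + destruct (nd_rep (t - tmin)) as [k Hk].
      rewrite <- (periodic1_Z v Hper t (- k)), opp_IZR.
      assert (Hn := Hnear (t + - IZR k)).
      replace (t + - IZR k - tmin) with (t - tmin - IZR k) in Hn by ring.
      rewrite <- (pow2_abs (t - tmin - IZR k)), Hk in Hn. specialize (Hn ltac:(lra)).
      assert (c0 <= cv / 2) by apply Rmin_l. assert (0 <= nd (t - tmin) ^ 2) by apply pow2_ge_0. nra.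
Qed.

(** * Logarithmic estimates *)

Lemma ln_le_linear y a : 0 < y -> 0 < a -> ln y <= a * y - ln a.
Proof.
  intros Hy Ha. assert (H : 0 < a * y) by (apply Rmult_lt_0_compat; auto).
  replace (ln y) with (ln (a * y) - ln a) by (rewrite ln_mult by auto; ring).
  assert (ln (a * y) <= a * y); [|lra].
  rewrite <- (ln_exp (a * y)) at 2. apply ln_le; auto. generalize (exp_ineq1_le (a * y)). lra.
Qed.

(** The Diophantine bound is polynomial in [|m|] and beats [2^-k] as long as [|m|] is linear in [k].
    This keeps the windows of the dyadic induction free of resonances. *)
Lemma dioph_scale w kappa tau : diophantine w kappa tau ->
  exists k0, forall k m, (k0 <= k)%nat -> m <> 0%Z -> (Z.abs m <= 2 * Z.of_nat k + 4)%Z ->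
  2 * (/ 2) ^ k <= nd (IZR m * w).
Proof.
  intros Hd. assert (Hd' := Hd). destruct Hd' as [Hk [Ht _]].
  assert (Hln2 : 0 < ln 2) by (rewrite <- ln_1; apply ln_increasing; lra).
  (* With this slope, [tau ln |m|] for [|m| <= 2k + 4] is at most [k ln 2 / 2] plus a constant, so
     half of [k ln 2] is left over. *)
  set (a := ln 2 / (4 * tau)).
  assert (Ha : 0 < a) by (apply Rdiv_lt_0_compat; lra).
  set (K := (2 * ln 2 - ln kappa - tau * ln a) * 2 / ln 2).
  exists (Z.to_nat (up (Rabs K))). intros k m Hkk Hm Hmk.
  assert (HK : K <= INR k).
  { apply Rle_trans with (Rabs K); [apply Rle_abs|].
    apply Rle_trans with (INR (Z.to_nat (up (Rabs K)))); [|apply le_INR; auto].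
    rewrite INR_IZR_INZ, Z2Nat.id.
    - destruct (archimed (Rabs K)); lra.
    - apply le_IZR. destruct (archimed (Rabs K)). generalize (Rabs_pos K). lra. }
  assert (H := dioph_nd w kappa tau Hd m Hm). left.
  eapply Rle_lt_trans; [|apply H].
  assert (Habs : 1 <= Rabs (IZR m)) by (rewrite <- abs_IZR; apply IZR_le; lia).
  assert (Hm4 : Rabs (IZR m) <= 2 * INR k + 4).
  { rewrite <- abs_IZR, INR_IZR_INZ, <- mult_IZR, <- plus_IZR. apply IZR_le. lia. }
  set (x := Rabs (IZR m)) in *.
  rewrite <- (exp_ln (2 * (/ 2) ^ k)) by (generalize (rpow_half_pos k); lra).
  rewrite <- (exp_ln kappa) by auto. unfold Rpower. rewrite <- exp_plus.
  assert (Hgoal : ln (2 * (/ 2) ^ k) <= ln kappa + - tau * ln x).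
  { rewrite ln_mult, ln_pow, ln_Rinv by (try lra; apply rpow_half_pos).
    assert (H1 := ln_le_linear x a ltac:(lra) Ha).
    assert (H2 : tau * ln x <= tau * (a * x - ln a)) by (apply Rmult_le_compat_l; lra).
    assert (H3 : tau * (a * x) = ln 2 / 4 * x) by (unfold a; field; lra).
    assert (H4 : ln 2 / 4 * x <= ln 2 / 4 * (2 * INR k + 4)) by (apply Rmult_le_compat_l; lra).
    assert (H5 : K * (ln 2 / 2) <= INR k * (ln 2 / 2)) by (apply Rmult_le_compat_r; lra).
    replace (K * (ln 2 / 2)) with (2 * ln 2 - ln kappa - tau * ln a) in H5 by (unfold K; field; lra). lra. }
  destruct Hgoal as [Hlt|Heq]; [left; apply exp_increasing; auto|rewrite Heq; lra].
Qed.

(** Bounds the number of steps, about [ln (1 / d)], after which the minimizer is below [d]. The 3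
    absorbs rounding and keeps [ln (loglen d)] positive for [d < 1]. *)
Definition loglen (d : R) : R := 3 - ln d.

Lemma loglen_gt d : 0 < d < 1 -> 3 < loglen d.
Proof. intros H. unfold loglen. assert (ln d < ln 1) by (apply ln_increasing; lra). rewrite ln_1 in H0. lra. Qed.

Lemma exp_loglen d : 0 < d -> d = exp (3 - loglen d).
Proof. intros H. unfold loglen. replace (3 - (3 - ln d)) with (ln d) by ring. rewrite exp_ln; auto. Qed.

Lemma Rpower_anti x y a : 0 < x <= y -> 0 < a -> Rpower y (- a) <= Rpower x (- a).
Proof.
  intros H Ha. unfold Rpower. assert (ln x <= ln y) by (apply ln_le; lra).
  assert (a * ln x <= a * ln y) by (apply Rmult_le_compat_l; lra).
  destruct (Rle_lt_or_eq_dec (- a * ln y) (- a * ln x)) as [Hl|Hl]; [lra| |].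
  - left. apply exp_increasing. auto.
  - rewrite Hl. lra.
Qed.

Lemma log_small K a : 0 < K -> 0 < a ->
  exists d0, 0 < d0 < 1 /\ forall d, 0 < d < d0 -> d * Rpower (loglen d) a < K.
Proof.
  intros HK Ha. set (b := / (2 * a)).
  assert (Hb : 0 < b) by (apply Rinv_0_lt_compat; lra).
  set (X := 2 * (3 - a * ln b - ln K)).
  exists (Rmin (/ 2) (exp (3 - Rabs X - 1))). split.
  - split; [apply Rmin_pos; [lra|apply exp_pos]|]. generalize (Rmin_l (/ 2) (exp (3 - Rabs X - 1))). lra.
  - intros d Hd.
    assert (Hd1 : d < / 2) by (generalize (Rmin_l (/ 2) (exp (3 - Rabs X - 1))); lra).
    assert (Hd2 : d < exp (3 - Rabs X - 1)) by (generalize (Rmin_r (/ 2) (exp (3 - Rabs X - 1))); lra).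
    assert (HL := loglen_gt d ltac:(lra)).
    assert (HLX : X < loglen d).
    { unfold loglen. apply ln_increasing in Hd2; [|lra]. rewrite ln_exp in Hd2. generalize (Rle_abs X). lra. }
    rewrite (exp_loglen d) at 1 by lra. set (L := loglen d) in *. unfold Rpower. rewrite <- exp_plus.
    rewrite <- (exp_ln K) by auto. apply exp_increasing.
    assert (H1 := ln_le_linear L b ltac:(lra) Hb).
    assert (H2 : a * ln L <= a * (b * L - ln b)) by (apply Rmult_le_compat_l; lra).
    assert (H3 : a * (b * L) = L / 2) by (unfold b; field; lra).
    unfold X in HLX. lra.
Qed.

Lemma log_ratio_lim e : 0 < e ->
  exists d0, 0 < d0 < 1 /\ forall d, 0 < d < d0 -> 4 * ln (loglen d) / (- ln d) < e.
Proof.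
  intros He. set (b := e / 8). assert (Hb : 0 < b) by (unfold b; lra).
  set (X := (12 * b - 4 * ln b) * 2 / e).
  exists (Rmin (/ 2) (exp (- Rabs X - 1))). split.
  - split; [apply Rmin_pos; [lra|apply exp_pos]|]. generalize (Rmin_l (/ 2) (exp (- Rabs X - 1))). lra.
  - intros d Hd.
    assert (Hd1 : d < / 2) by (generalize (Rmin_l (/ 2) (exp (- Rabs X - 1))); lra).
    assert (Hd2 : d < exp (- Rabs X - 1)) by (generalize (Rmin_r (/ 2) (exp (- Rabs X - 1))); lra).
    assert (HL := loglen_gt d ltac:(lra)).
    apply ln_increasing in Hd2; [|lra]. rewrite ln_exp in Hd2.
    set (x := - ln d) in *. assert (Hx : X < x) by (generalize (Rle_abs X); unfold x; lra).
    assert (Hx0 : 0 < x) by (generalize (Rabs_pos X); unfold x; lra).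
    replace (loglen d) with (x + 3) by (unfold loglen, x; ring).
    apply (Rmult_lt_reg_r x); auto. unfold Rdiv. rewrite Rmult_assoc, Rinv_l, Rmult_1_r by lra.
    assert (H1 := ln_le_linear (x + 3) b ltac:(lra) Hb).
    assert (H2 : X * (e / 2) < x * (e / 2)) by (apply Rmult_lt_compat_r; lra).
    replace (X * (e / 2)) with (12 * b - 4 * ln b) in H2 by (unfold X; field; lra).
    assert (4 * (b * x) = e / 2 * x) by (unfold b; field). lra.
Qed.

Section ExplicitLower.
Variables (W : R -> R) (w B e : R) (p r : R -> R).
Hypothesis HWB : forall t, W t <= B.
Hypothesis He : 0 < e.
Hypothesis Hform : forall th p n u, (0 < n)%nat ->
  e * zsum p n (fun k => u k ^ 2) <= form (orb w W th) p n u.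
Hypothesis Hp : contracted W w p.
Hypothesis Hr : contracted (rev W) w r.
Variables (kappa tau th c M rho : R).
Hypothesis Hdio : diophantine w kappa tau.
Let delta := gap W p r th.
Hypothesis Hdelta : 0 < delta < 1.
Hypothesis Hrho : 0 < rho <= / 16.
Hypothesis Hdec : forall n, phi w p r th (Z.of_nat n) <= rho ^ n /\ phi w p r th (- Z.of_nat n) <= rho ^ n.
Hypothesis Hc : 0 < c.
Hypothesis Hsep : forall t u, cfg (orb w W t) u -> 0 < nd (t - th) ->
  delta + c * nd (t - th) ^ 2 <= defect (orb w W t) u.
Hypothesis HM : forall t t', Rabs (p t - p t') <= M * Rabs (t - t').
Hypothesis HM0 : 0 < M.
Let L := loglen delta.
Let kap := Rmin kappa 1.
Hypothesis Hsmall : delta * Rpower L (2 + 2 * tau) < c * kap ^ 2 / 48.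

(** The shift [s] is limited by [s1], which excludes close returns within [L] steps, and by
    [s2 = 1 / (2 L B M)], which keeps the slopes comparable. If [s2] is the smaller, the bound on
    [s2^2] is the claim; if [s1] is, the bound on [s1^2] does not involve [M] and contradicts
    [Hsmall]. *)
Theorem slope_lower_explicit : sqrt (c / 48) / B * / (L ^ 2 * sqrt delta) <= M.
Proof.
  destruct Hdio as [Hk [Ht _]].
  assert (HB := contracted_B_pos W w B e p HWB He Hform Hp).
  assert (HL := loglen_gt delta Hdelta). fold L in HL.
  assert (Hkap : 0 < kap <= 1) by (split; [apply Rmin_pos; lra|apply Rmin_r]).
  set (R0 := Z.to_nat (up (- ln delta))).
  assert (Hup := archimed (- ln delta)).
  assert (Hln : ln delta < 0) by (unfold L, loglen in HL; lra).
  assert (HR0 : - ln delta < INR R0 <= - ln delta + 1).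
  { unfold R0. rewrite INR_IZR_INZ, Z2Nat.id; [lra|]. apply le_IZR. lra. }
  assert (HRL : INR R0 + 1 <= L) by (unfold L, loglen; lra).
  (* [rho <= 1/16 < 1/e], so [R0 > - ln delta] steps suffice. *)
  assert (Hrd : rho ^ R0 <= delta).
  { apply Rle_trans with ((/ 16) ^ R0); [apply pow_incr; lra|].
    rewrite <- (exp_ln delta) by lra.
    rewrite <- (Rpower_pow R0) by lra. unfold Rpower. left. apply exp_increasing.
    assert (Hl16 : ln (/ 16) < -1).
    { rewrite ln_Rinv by lra. enough (1 < ln 16) by lra.
      rewrite <- (ln_exp 1). apply ln_increasing; [apply exp_pos|]. generalize exp_le_3. lra. }
    assert (INR R0 * ln (/ 16) <= INR R0 * -1) by (apply Rmult_le_compat_l; [apply pos_INR|lra]). lra. }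
  set (s1 := kap / 2 * Rpower L (- tau)).
  set (s2 := / (2 * L * B * M)).
  assert (Hpw : 0 < Rpower L (- tau)) by apply exp_pos.
  assert (Hpw1 : Rpower L (- tau) <= 1).
  { rewrite <- (Rpower_O L) by lra. apply Rle_Rpower; lra. }
  assert (Hs1 : 0 < s1) by (apply Rmult_lt_0_compat; lra).
  assert (Hs1h : s1 <= / 2) by (unfold s1; nra).
  assert (HLBM : 0 < 2 * L * B * M) by (repeat apply Rmult_lt_0_compat; lra).
  assert (Hs2 : 0 < s2) by (apply Rinv_0_lt_compat; auto).
  assert (Hgen : forall s, 0 < s -> s <= s1 -> s <= s2 -> c * s ^ 2 <= 12 * L ^ 2 * delta).
  { intros s Hs0 Hsa Hsb.
    apply Rle_trans with (12 * (INR R0 + 1) ^ 2 * delta).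
    - apply (slope_lower_bound W w B e p r HWB He Hform Hp Hr th c M s rho R0); auto; try lra.
      + intros m Hm HmR.
        assert (H := dioph_nd w kappa tau Hdio m Hm).
        assert (Habs : 1 <= Rabs (IZR m)) by (rewrite <- abs_IZR; apply IZR_le; lia).
        assert (HmR' : Rabs (IZR m) <= L).
        { apply Rle_trans with (INR R0); [|lra]. rewrite <- abs_IZR, INR_IZR_INZ. apply IZR_le. auto. }
        assert (H1 := Rpower_anti (Rabs (IZR m)) L tau ltac:(lra) ltac:(lra)).
        assert (kap <= kappa) by apply Rmin_l.
        assert (kap * Rpower L (- tau) <= kappa * Rpower (Rabs (IZR m)) (- tau)).
        { apply Rmult_le_compat; lra. }
        unfold s1 in Hsa. lra.
      + apply Rle_trans with (2 * L * (B * M * s2)).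
        * assert (0 < B * M) by (apply Rmult_lt_0_compat; auto).
          apply Rmult_le_compat; try (generalize (pos_INR R0); lra).
          -- apply Rmult_le_pos; lra.
          -- apply Rmult_le_compat_l; lra.
        * right. unfold s2. field. lra.
    - apply Rmult_le_compat_r; [lra|]. apply Rmult_le_compat_l; [lra|].
      apply pow_incr. generalize (pos_INR R0). lra. }
  destruct (Rle_lt_dec s2 s1) as [H21|H12].
  - specialize (Hgen s2 Hs2 H21 ltac:(lra)).
    set (q := sqrt (c / 48)). set (d := sqrt delta).
    assert (Hq : 0 < q) by (apply sqrt_lt_R0; lra). assert (Hd : 0 < d) by (apply sqrt_lt_R0; lra).
    assert (Hq2 : c = 48 * q ^ 2) by (unfold q; rewrite pow2_sqrt; lra).
    assert (Hd2 : delta = d ^ 2) by (unfold d; rewrite pow2_sqrt; lra).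
    rewrite Hq2, Hd2 in Hgen.
    assert (Hle : q * s2 <= L * d / 2).
    { apply Rsqr_incr_0_var.
      - rewrite !Rsqr_pow2. nra.
      - apply Rmult_le_pos; [|lra]. apply Rmult_le_pos; lra. }
    unfold s2 in Hle.
    apply (Rmult_le_compat_r (2 * M / (L * d))) in Hle.
    2:{ apply Rlt_le, Rdiv_lt_0_compat; [lra|apply Rmult_lt_0_compat; lra]. }
    replace (L * d / 2 * (2 * M / (L * d))) with M in Hle by (field; lra).
    eapply Rle_trans; [|apply Hle]. right. field. lra.
  - exfalso. specialize (Hgen s1 Hs1 ltac:(lra) ltac:(lra)).
    set (y := Rpower L (- tau)) in *.
    assert (Hy2 : Rpower L (2 + 2 * tau) * y ^ 2 = L ^ 2).
    { unfold y. rewrite <- (Rpower_pow 2 (Rpower L (- tau))) by apply exp_pos.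
      rewrite Rpower_mult, <- Rpower_plus. rewrite <- (Rpower_pow 2 L) by lra. f_equal. simpl. ring. }
    assert (Hy20 : 0 < y ^ 2) by (apply pow_lt; auto).
    apply (Rmult_lt_compat_r (y ^ 2)) in Hsmall; auto.
    rewrite Rmult_assoc, Hy2 in Hsmall. unfold s1 in Hgen.
    replace (c * (kap / 2 * y) ^ 2) with (12 * (c * kap ^ 2 / 48 * y ^ 2)) in Hgen by field. lra.
Qed.
End ExplicitLower.

(** The origin of the exponent: [epsilon] is chosen so that the power equals the lower bound of the
    slope estimate exactly, the factor 4 being 2 from [loglen^2] and 2 from the square root. *)
Lemma Rpower_loglen d : 0 < d < 1 ->
  Rpower (/ sqrt d) (1 - 4 * ln (loglen d) / (- ln d)) = / (loglen d ^ 2 * sqrt d).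
Proof.
  intros Hd. assert (HL := loglen_gt d Hd).
  assert (Hln : ln d < 0) by (rewrite <- ln_1; apply ln_increasing; lra).
  assert (Hs : 0 < sqrt d) by (apply sqrt_lt_R0; lra).
  assert (Hl : ln d = 2 * ln (sqrt d)).
  { rewrite <- (sqrt_sqrt d) at 1 by lra. rewrite ln_mult by auto. ring. }
  unfold Rpower. rewrite ln_Rinv by auto.
  replace ((1 - 4 * ln (loglen d) / - ln d) * - ln (sqrt d))
    with (- (INR 2 * ln (loglen d)) + - ln (sqrt d)).
  - rewrite exp_plus, !exp_Ropp, (exp_ln (sqrt d)) by auto.
    change (exp (INR 2 * ln (loglen d))) with (Rpower (loglen d) (INR 2)).
    rewrite Rpower_pow, Rinv_mult by lra. reflexivity.
  - rewrite Hl in Hln |- *. simpl. field. lra.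
Qed.

(** * Reversal and [C^1] norms *)

Lemma rev_twice W : rev (rev W) = W.
Proof. extensionality t. unfold rev. f_equal. ring. Qed.

Lemma gap_rev W p r th : gap (rev W) r p (- th) = gap W p r th.
Proof. unfold gap, rev. rewrite Ropp_involutive. ring. Qed.

Lemma phi_rev w p r th k : phi w r p (- th) k = phi w p r th (- k).
Proof.
  unfold phi. rewrite Ropp_involutive. destruct (Z_le_dec 0 k), (Z_le_dec 0 (- k)); try lia.
  - replace k with 0%Z by lia. reflexivity.
  - f_equal. lia.
  - reflexivity.
Qed.

Lemma separation_rev w W th (c delta : R) :
  (forall t u, cfg (orb w W t) u -> 0 < nd (t - th) ->
     delta + c * nd (t - th) ^ 2 <= defect (orb w W t) u) ->
  forall t u, cfg (orb w (rev W) t) u -> 0 < nd (t - - th) ->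
     delta + c * nd (t - - th) ^ 2 <= defect (orb w (rev W) t) u.
Proof.
  intros H t u. rewrite orb_rev. intros Hu. apply cfg_refl in Hu. rewrite refl_refl in Hu.
  rewrite <- (refl_refl u), defect_refl.
  replace (t - - th) with (- (- t - th)) by ring. rewrite nd_opp. apply H; auto.
Qed.

Definition C1_data (p dp : R -> R) (b : R) : Prop :=
  (forall t, derivable_pt_lim p t (dp t)) /\ continuity dp /\
  (forall t k, dp (t + IZR k) = dp t) /\ is_max_value (fun t => Rabs (dp t)) b.

Lemma C1_data_lip p dp b : C1_data p dp b -> forall t s, Rabs (p t - p s) <= b * Rabs (t - s).
Proof.
  intros [H1 [_ [_ [_ Hb]]]] t s. apply (derivative_lip p dp); auto.
Qed.

Lemma contracted_C1 W W1 w B e A1 A2 p :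
  (forall t k, W (t + IZR k) = W t) -> (forall t k, W1 (t + IZR k) = W1 t) ->
  (forall t, W t <= B) -> 0 <= A1 -> 0 < A2 ->
  (forall t s, Rabs (W t - W s) <= A1 * Rabs (t - s)) ->
  (forall t, Rabs (W1 t) <= A1) -> continuity W1 ->
  (forall t s, W (t + s) <= W t + s * W1 t + A2 / 2 * s ^ 2) -> 0 < e ->
  (forall th p n u, (0 < n)%nat -> e * zsum p n (fun k => u k ^ 2) <= form (orb w W th) p n u) ->
  contracted W w p ->
  exists dp b, C1_data p dp b /\ 0 <= b /\ b ^ 2 <= 2 * (A2 * (B / e)) * B.
Proof.
  intros H1 H2 H3 H4 H5 H6 H7 H8 H9 H10 H11 H12.
  assert (Hc : continuity (dslope W1 w p)) by (apply (dslope_continuity W W1 w B e A1); auto).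
  assert (Hper : forall t k, dslope W1 w p (t + IZR k) = dslope W1 w p t)
    by (apply (dslope_period W); auto).
  destruct (periodic_max (fun t => Rabs (dslope W1 w p t))) as [b Hb].
  - apply continuity_abs; auto.
  - intros t k. rewrite Hper. reflexivity.
  - exists (dslope W1 w p), b. destruct Hb as [[t0 Ht0] Hb]. split; [|split].
    + split; [|split; [|split]]; auto.
      * intros t. apply (contracted_derivative W W1 w B e A1 A2); auto.
      * split; [exists t0|]; auto.
    + rewrite <- Ht0. apply Rabs_pos.
    + rewrite <- Ht0, RPow_abs, Rabs_pos_eq by apply pow2_ge_0.
      apply (dslope_bound W W1 w B e A1 A2); auto.
Qed.

Lemma C1_norm_of_data p dp b B : C1_data p dp b -> (forall t k, p (t + IZR k) = p t) ->
  (forall t, / B <= p t <= B) -> 0 < B ->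
  exists a, is_C1_norm p (a + b) /\ / B <= a <= B.
Proof.
  intros [H1 [H2 [H3 H4]]] Hper HB HB0.
  destruct (periodic_max (fun t => Rabs (p t))) as [a Ha].
  - apply continuity_abs. intros t. apply derivable_continuous_pt. exists (dp t). apply H1.
  - intros t k. rewrite Hper. reflexivity.
  - exists a. split.
    + exists dp. split; auto. split; auto. exists a, b. auto.
    + destruct Ha as [[t <-] _]. rewrite Rabs_pos_eq; auto.
      assert (0 < / B) by (apply Rinv_0_lt_compat; auto). specialize (HB t). lra.
Qed.

(** The derivative of [psi] at [t] is that of [r] at [w - t] times [psi t ^ 2], a factor between
    [1 / B^2] and [B^2]. *)
Lemma C1_data_inv w r dr b B psi : C1_data r dr b -> 0 < B ->
  (forall t k, r (t + IZR k) = r t) -> (forall t, 0 < psi t) -> (forall t, r t = / psi (w - t)) -> (forall t, / B <= psi t <= B) ->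
  exists dpsi bs, C1_data psi dpsi bs /\ b / B ^ 2 <= bs <= b * B ^ 2.
Proof.
  intros [H1 [H2 [H3 H4]]] HB0 Hper Hpos Hr HB.
  assert (Hrpos : forall t, 0 < r t) by (intros t; rewrite Hr; apply Rinv_0_lt_compat; auto).
  assert (Hpsi : psi = fun t => / r (w - t)).
  { extensionality t. rewrite Hr, Rinv_inv. f_equal. ring. }
  set (dpsi := fun t => dr (w - t) * / r (w - t) ^ 2).
  assert (Hd : forall t, derivable_pt_lim psi t (dpsi t)).
  { intros t. rewrite Hpsi. apply is_derive_Reals.
    assert (Hr1 : is_derive r (w - t) (dr (w - t))) by (apply is_derive_Reals; apply H1).
    assert (Hi : is_derive (fun x => w - x) t (-1)) by (auto_derive; auto; ring).
    assert (Hcomp := is_derive_comp r (fun x => w - x) t _ _ Hr1 Hi).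
    assert (Hinv := is_derive_inv _ _ _ Hcomp (Rgt_not_eq _ _ (Hrpos _))).
    replace (dpsi t) with (- scal (-1) (dr (w - t)) / r (w - t) ^ 2); auto.
    unfold dpsi, scal; simpl; unfold mult; simpl. field. apply Rgt_not_eq, Hrpos. }
  assert (Hsub : forall f, continuity f -> continuity (fun t => f (w - t))).
  { intros f Hf. apply (continuity_comp (fun t => w - t) f); auto.
    intros x. apply derivable_continuous_pt. apply derivable_pt_minus;
    [apply derivable_pt_const|apply derivable_pt_id]. }
  assert (Hrc : continuity r).
  { intros x. apply derivable_continuous_pt. exists (dr x). apply H1. }
  assert (Hc : continuity dpsi).
  { apply (continuity_mult (fun t => dr (w - t)) (fun t => / r (w - t) ^ 2)); auto.
    apply (continuity_inv (fun t => r (w - t) ^ 2)).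
    - apply (continuity_comp (fun t => r (w - t)) (fun x => x ^ 2)); auto.
      intros x. apply derivable_continuous_pt, derivable_pt_pow.
    - intros t. apply pow_nonzero, Rgt_not_eq, Hrpos. }
  assert (Eabs : forall t, Rabs (dpsi t) = Rabs (dr (w - t)) * psi t ^ 2).
  { intros t. unfold dpsi. rewrite Rabs_mult, Hr. replace (w - (w - t)) with t by ring.
    rewrite pow_inv, Rinv_inv, (Rabs_pos_eq (psi t ^ 2)) by apply pow2_ge_0. reflexivity. }
  destruct H4 as [[t0 Ht0] Hb].
  assert (Hb0 : 0 <= b) by (rewrite <- Ht0; apply Rabs_pos).
  assert (Hi : 0 < / B) by (apply Rinv_0_lt_compat; auto).
  assert (Hsq : forall t, / B ^ 2 <= psi t ^ 2 <= B ^ 2).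
  { intros t. rewrite <- pow_inv. specialize (HB t). split; apply pow_incr; lra. }
  assert (Hdper : forall t k, dpsi (t + IZR k) = dpsi t).
  { intros t k. unfold dpsi. replace (w - (t + IZR k)) with (w - t + IZR (- k)) by (rewrite opp_IZR; ring).
    rewrite H3, Hper. reflexivity. }
  destruct (periodic_max (fun t => Rabs (dpsi t))) as [bs Hbs].
  - apply continuity_abs; auto.
  - intros t k. rewrite Hdper. reflexivity.
  - exists dpsi, bs. split; [split; [|split; [|split]]; auto|].
    destruct Hbs as [[t1 Ht1] Hbs]. split.
    + eapply Rle_trans; [|apply (Hbs (w - t0))]. rewrite Eabs.
      replace (w - (w - t0)) with t0 by ring. rewrite Ht0. apply Rmult_le_compat_l; auto. apply Hsq.
    + rewrite <- Ht1, Eabs. specialize (Hb (w - t1)). specialize (Hsq t1).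
      apply Rmult_le_compat; auto; [apply Rabs_pos|apply pow2_ge_0|apply Hsq].
Qed.

(** * Large coupling *)

Record strong_coupling (Lam c0 c1 cv rv A0 A1 A2 cw : R) (k0 : nat) : Prop := {
  sc_c1 : 0 < c1;
  sc_c0 : 8 * c1 <= c0;
  sc_cv : 32 * c1 <= cv;
  sc_one : 1 <= Lam;
  sc_lam : 1 <= c1 * Lam;
  sc_rv : 40 <= c0 * Lam * (rv / 3) ^ 2;
  sc_k0 : 40 < c0 * Lam * (/ 4) ^ (k0 + 1);
  sc_rho : 2 / (c1 * Lam * cw ^ 8) <= / 16;
  sc_x : 2 * (2 / (c1 * Lam * cw ^ 8) * (2 / (c1 * Lam * cw ^ 8) * (Lam * A0))) ^ 2 <= / 2;
  sc_B : 1 <= 2 / (c1 * Lam * cw ^ 8) * (Lam * A0);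
  sc_small : A2 * (2 / (c1 * Lam * cw ^ 8)) ^ 2 + 16 * A1 ^ 2 * (Lam * (2 / (c1 * Lam * cw ^ 8)))
     * (2 / (c1 * Lam * cw ^ 8) * (2 / (c1 * Lam * cw ^ 8) * (Lam * A0))) ^ 2 <= cv / 8
}.

(** [c1] depends on [c0] and [cv] only. Then [rho = C2 / Lam] with [C2] independent of [Lam], so
    [rho Lam A0 = C2 A0] exceeds 1 for every [Lam], and each remaining requirement follows from a
    lower bound on [Lam], one of 1 and the [X1], ..., [X6]. The 41 in [X3] makes a strict
    inequality. *)
Lemma strong_coupling_exists c0 cv rv A0 A1 A2 cw k0 :
  0 < c0 -> 0 < cv -> 0 < rv -> 3 <= A0 -> 0 < A1 -> 0 < A2 -> 0 < cw <= 1 ->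
  exists c1 Lam0, 1 <= Lam0 /\ forall Lam, Lam0 < Lam -> strong_coupling Lam c0 c1 cv rv A0 A1 A2 cw k0.
Proof.
  intros Hc0 Hcv Hrv HA0 HA1 HA2 Hcw.
  set (c1 := Rmin 1 (Rmin (c0 / 8) (cv / 32))).
  assert (Hc1 : 0 < c1) by (unfold c1; repeat apply Rmin_pos; lra).
  assert (Hc11 : c1 <= 1) by apply Rmin_l.
  assert (Hc12 : c1 <= c0 / 8) by (eapply Rle_trans; [apply Rmin_r|apply Rmin_l]).
  assert (Hc13 : c1 <= cv / 32) by (eapply Rle_trans; [apply Rmin_r|apply Rmin_r]).
  assert (Hcw8 : 0 < cw ^ 8 <= 1).
  { split; [apply pow_lt; lra|]. rewrite <- (pow1 8). apply pow_incr; lra. }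
  set (C2 := 2 / (c1 * cw ^ 8)).
  assert (Hcc : 0 < c1 * cw ^ 8 <= 1) by (split; [apply Rmult_lt_0_compat; lra|nra]).
  assert (HC2 : 2 <= C2).
  { unfold C2. apply (Rmult_le_reg_r (c1 * cw ^ 8)); [lra|].
    unfold Rdiv. rewrite Rmult_assoc, Rinv_l by lra. lra. }
  set (X1 := / c1). set (X2 := 40 * / (c0 * (rv / 3) ^ 2)). set (X3 := 41 * / (c0 * (/ 4) ^ (k0 + 1))).
  set (X4 := 16 * C2). set (X5 := 2 * (C2 ^ 2 * A0)).
  set (X6 := 8 * / cv * (A2 * C2 + 16 * A1 ^ 2 * C2 * (C2 ^ 2 * A0))).
  assert (Hrv2 : 0 < c0 * (rv / 3) ^ 2) by (apply Rmult_lt_0_compat; [auto|apply pow_lt; lra]).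
  assert (Hk2 : 0 < c0 * (/ 4) ^ (k0 + 1)) by (apply Rmult_lt_0_compat; [auto|apply pow_lt; lra]).
  assert (H1 : 0 < X1) by (apply Rinv_0_lt_compat; auto).
  assert (H2 : 0 < X2) by (apply Rmult_lt_0_compat; [lra|apply Rinv_0_lt_compat; auto]).
  assert (H3 : 0 < X3) by (apply Rmult_lt_0_compat; [lra|apply Rinv_0_lt_compat; auto]).
  assert (H4 : 0 < X4) by (unfold X4; lra).
  assert (HC22 : 0 < C2 ^ 2 * A0) by (apply Rmult_lt_0_compat; [apply pow_lt|]; lra).
  assert (H5 : 0 < X5) by (unfold X5; lra).
  assert (HA12 : 0 < A1 ^ 2) by (apply pow_lt; auto).
  assert (HS : 0 < A2 * C2 + 16 * A1 ^ 2 * C2 * (C2 ^ 2 * A0)).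
  { apply Rplus_lt_0_compat; [apply Rmult_lt_0_compat; lra|].
    apply Rmult_lt_0_compat; auto. apply Rmult_lt_0_compat; lra. }
  assert (H6 : 0 < X6).
  { unfold X6. apply Rmult_lt_0_compat; auto. apply Rmult_lt_0_compat; [lra|apply Rinv_0_lt_compat; auto]. }
  exists c1, (1 + X1 + X2 + X3 + X4 + X5 + X6). split; [lra|]. intros Lam HL.
  assert (HLp : 0 < Lam) by lra.
  assert (Hi : 0 < / Lam) by (apply Rinv_0_lt_compat; auto).
  assert (Erho : 2 / (c1 * Lam * cw ^ 8) = C2 * / Lam) by (unfold C2; field; lra).
  assert (Ey : C2 * / Lam * (C2 * / Lam * (Lam * A0)) = C2 ^ 2 * A0 * / Lam) by (field; lra).
  assert (Hlow : forall X, 0 < X -> X <= Lam -> X * / Lam <= 1).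
  { intros X HX HXL. apply (Rmult_le_reg_r Lam); auto. rewrite Rmult_assoc, Rinv_l; lra. }
  assert (Hrho : C2 * / Lam <= / 16).
  { assert (H := Hlow X4 H4 ltac:(lra)). unfold X4 in H. lra. }
  assert (Hy : C2 ^ 2 * A0 * / Lam <= / 2).
  { assert (H := Hlow X5 H5 ltac:(lra)). unfold X5 in H. lra. }
  assert (Hr0 : 0 < C2 * / Lam) by (apply Rmult_lt_0_compat; lra).
  assert (Hy0 : 0 < C2 ^ 2 * A0 * / Lam) by (apply Rmult_lt_0_compat; lra).
  constructor; rewrite ?Erho, ?Ey; auto; try lra.
  - assert (c1 * X1 <= c1 * Lam) by (apply Rmult_le_compat_l; lra).
    unfold X1 in H. rewrite Rinv_r in H; lra.
  - assert (c0 * (rv / 3) ^ 2 * X2 <= c0 * (rv / 3) ^ 2 * Lam) by (apply Rmult_le_compat_l; lra).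
    unfold X2 in H. replace (c0 * (rv / 3) ^ 2 * (40 * / (c0 * (rv / 3) ^ 2))) with 40 in H by (field; split; apply Rgt_not_eq; lra). lra.
  - assert (c0 * (/ 4) ^ (k0 + 1) * X3 <= c0 * (/ 4) ^ (k0 + 1) * Lam) by (apply Rmult_le_compat_l; lra).
    unfold X3 in H. rewrite <- Rmult_assoc, (Rmult_comm _ 41), Rmult_assoc, Rinv_r in H by lra. lra.
  - assert ((C2 ^ 2 * A0 * / Lam) ^ 2 <= (/ 2) ^ 2) by (apply pow_incr; lra). simpl in *. lra.
  - replace (C2 * / Lam * (Lam * A0)) with (C2 * A0) by (field; lra). nra.
  - assert (Hs : (C2 * / Lam) ^ 2 <= C2 * / Lam) by nra.
    assert (Hs2 : (C2 ^ 2 * A0 * / Lam) ^ 2 <= C2 ^ 2 * A0 * / Lam) by nra.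
    replace (Lam * (C2 * / Lam)) with C2 by (field; lra).
    apply Rle_trans with (A2 * (C2 * / Lam) + 16 * A1 ^ 2 * C2 * (C2 ^ 2 * A0 * / Lam)).
    + apply Rplus_le_compat; apply Rmult_le_compat_l; try lra.
      apply Rmult_le_pos; [apply Rmult_le_pos|]; lra.
    + assert (H := Hlow X6 H6 ltac:(lra)). unfold X6 in H.
      apply (Rmult_le_compat_l (cv / 8)) in H; [|lra].
      replace (cv / 8 * (8 * / cv * (A2 * C2 + 16 * A1 ^ 2 * C2 * (C2 ^ 2 * A0)) * / Lam))
        with (A2 * (C2 * / Lam) + 16 * A1 ^ 2 * C2 * (C2 ^ 2 * A0 * / Lam)) in H by (field; lra). lra.
Qed.

(** * The Schrödinger cocycle at large coupling *)

Section Model.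
Variables (w kappa tau : R) (v v1 v2 : R -> R) (tmin Av A1 A2 cv rv c0 cw : R) (k0 : nat).
Variables (c1 lam E0 : R) (psiu psis : R -> R -> R).
Hypothesis Hdio : diophantine w kappa tau.
Hypothesis Hpot : potential v v1 v2 tmin Av A1 A2 cv rv c0.
Hypothesis Hcw : 0 < cw <= 1.
Hypothesis Hprod : forall n, cw ^ n <= rprod (fun i => nd (INR i * w)) n.
Hypothesis Hk0 : forall k m, (k0 <= k)%nat -> m <> 0%Z -> (Z.abs m <= 2 * Z.of_nat k + 4)%Z ->
  2 * (/ 2) ^ k <= nd (IZR m * w).
Let A0 := 2 * Av + 3.
Let Lam := lam ^ 2.
Hypothesis Hsc : strong_coupling Lam c0 c1 cv rv A0 A1 A2 cw k0.
Hypothesis HE0 : is_min_spectrum lam w v E0.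
Hypothesis Hpsi : forall E, E < E0 ->
  is_unstable_fn lam E w v (psiu E) /\ is_stable_fn lam E w v (psis E).

Let W (E t : R) := lam ^ 2 * v t - E.
Let B := Lam * A0.
Let rho := 2 / (c1 * Lam * cw ^ 8).

(** What the explicit lower bound for the slope asks of the minimal gap. *)
Definition small_gap (d : R) : Prop :=
  0 < d < 1 /\ d * Rpower (loglen d) (2 + 2 * tau) < c1 * Lam * Rmin kappa 1 ^ 2 / 48.

Lemma model_nd_pos m : m <> 0%Z -> 0 < nd (IZR m * w).
Proof. apply (dioph_nd_pos w kappa tau Hdio). Qed.

Lemma model_lam : 1 <= Lam.
Proof. apply Hsc. Qed.

Lemma model_resolvent E : E < E0 -> resolvent lam w v 0 E.
Proof.
  intros HE. apply NNPP. intros Hn. destruct HE0 as [_ H]. specialize (H E Hn). lra.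
Qed.

Lemma model_V_bound k : Rabs (lam ^ 2 * v (0 + IZR k * w)) <= Lam * Av.
Proof.
  rewrite Rabs_mult, (Rabs_pos_eq (lam ^ 2)) by apply pow2_ge_0.
  apply Rmult_le_compat_l; [apply pow2_ge_0|]. apply Hpot.
Qed.

Lemma model_W_per E t k : W E (t + IZR k) = W E t.
Proof. unfold W. rewrite (pot_per _ _ _ _ _ _ _ _ _ _ Hpot). reflexivity. Qed.

Lemma model_W_lip E t s : Rabs (W E t - W E s) <= Lam * A1 * Rabs (t - s).
Proof.
  unfold W. replace (lam ^ 2 * v t - E - (lam ^ 2 * v s - E)) with (Lam * (v t - v s)) by (unfold Lam; ring).
  rewrite Rabs_mult, (Rabs_pos_eq Lam) by apply pow2_ge_0. rewrite Rmult_assoc.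
  apply Rmult_le_compat_l; [apply pow2_ge_0|]. apply Hpot.
Qed.

Lemma model_form0 th p n u : (0 < n)%nat -> 0 <= form (orb w (W E0) th) p n u.
Proof.
  apply (form_all_phases w (W E0) (Lam * A1)).
  - apply model_nd_pos.
  - apply model_W_per.
  - apply Rmult_le_pos; [apply pow2_ge_0|]. destruct (pot_pos _ _ _ _ _ _ _ _ _ _ Hpot). lra.
  - apply model_W_lip.
  - intros p' n' u' Hn'.
    exact (form_nonneg_of_resolvent lam w v (Lam * Av) model_V_bound E0 model_resolvent p' n' u' Hn').
Qed.

Lemma model_form_shift E th p n u : form (orb w (W E) th) p n u
  = form (orb w (W E0) th) p n u + (E0 - E) * zsum p n (fun k => u k ^ 2).
Proof.
  rewrite (form_diff (orb w (W E0) th)). f_equal. rewrite <- zsum_scal. apply zsum_ext.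
  intros k _. unfold orb, W. ring.
Qed.

Lemma model_form E : E < E0 -> forall th p n u, (0 < n)%nat ->
  (E0 - E) * zsum p n (fun k => u k ^ 2) <= form (orb w (W E) th) p n u.
Proof.
  intros HE th p n u Hn. rewrite model_form_shift. generalize (model_form0 th p n u Hn). lra.
Qed.

Lemma model_E0_upper : E0 <= lam ^ 2 * v tmin.
Proof.
  assert (H := model_form0 tmin 0 1 (fun _ => 1) ltac:(lia)). rewrite form_one in H.
  unfold orb, W in H. rewrite Rmult_0_l, Rplus_0_r in H. lra.
Qed.

Lemma model_not_coercive c : 0 < c ->
  ~ (forall p n u, (0 < n)%nat -> c * zsum p n (fun k => u k ^ 2) <= form (orb w (W E0) 0) p n u).
Proof.
  intros Hc H. destruct HE0 as [Hs _]. apply Hs.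
  apply (coercive_resolvent lam w v (Lam * Av) model_V_bound E0 c Hc H model_resolvent).
Qed.

Lemma model_v_min t : v tmin <= v t.
Proof.
  assert (H := pot_low _ _ _ _ _ _ _ _ _ _ Hpot t).
  destruct (pot_pos _ _ _ _ _ _ _ _ _ _ Hpot) as [_ [_ [_ [_ [_ Hc0]]]]].
  assert (0 <= c0 * nd (t - tmin) ^ 2) by (apply Rmult_le_pos; [lra|apply pow2_ge_0]). lra.
Qed.

(** Otherwise the potential minus [E0] would exceed 2 by a fixed margin, and the form at [E0] would
    be coercive. *)
Lemma model_E0_lower : lam ^ 2 * v tmin - 2 <= E0.
Proof.
  apply Rnot_lt_le. intros Hlt.
  apply (model_not_coercive (lam ^ 2 * v tmin - 2 - E0)); [lra|]. intros p n u Hn.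
  apply form_lower; auto. intros k. unfold orb, W.
  assert (lam ^ 2 * v tmin <= lam ^ 2 * v (0 + IZR k * w)); [|lra].
  apply Rmult_le_compat_l; [apply pow2_ge_0|apply model_v_min].
Qed.

Definition slope_r E t := / psis E (w - t).

Lemma model_contracted E : E < E0 -> contracted (W E) w (psiu E).
Proof. intros HE. apply contracted_unstable. apply Hpsi; auto. Qed.

Lemma model_psis E : E < E0 -> (forall t, 0 < psis E t) /\ contracted (rev (W E)) w (slope_r E).
Proof.
  intros HE. destruct (stable_seq lam E w v (psis E) (proj2 (Hpsi E HE))) as [C [q [HC [Hq Hseq]]]].
  assert (He : 0 < E0 - E) by lra.
  assert (Hlim : forall be K, (forall n, Rabs (be n) <= C * q ^ n * K) -> is_lim_seq be 0).
  { intros be K Hb. apply (geom_lim be (C * K) q); auto. intros n. specialize (Hb n). lra. }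
  assert (Hpos : forall t, 0 < psis E t).
  { intros t. destruct (Hseq t) as [be [H1 [H2 [H3 H4]]]].
    (* Two terms of the sum are needed: they give [(E0 - E) (x^2 + (y x - 1)^2) <= x], whose first
       part yields [x >= 0] and whose second excludes [x = 0]. *)
    assert (H5 := left_sol_positive (rev (W E)) w (E0 - E) (w - t) be He
      (form_rev (W E) w (E0 - E) (model_form E HE) (w - t)) H1 (Hlim be _ H4) 2).
    cbn [rsum] in H5. rewrite H2, H3, (H1 0%nat), H2, H3 in H5.
    set (x := psis E t) in *. set (y := lam ^ 2 * v (- (w - t - INR 1 * w)) - E) in *.
    apply Rnot_le_lt. intros Hx.
    assert (0 <= (E0 - E) * x ^ 2) by (apply Rmult_le_pos; [lra|apply pow2_ge_0]).
    assert (0 <= (E0 - E) * (y * x - 1) ^ 2) by (apply Rmult_le_pos; [lra|apply pow2_ge_0]).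
    assert (Hx0 : x = 0) by lra. rewrite Hx0 in H5.
    replace (y * 0 - 1) with (-1) in H5 by ring. simpl in H5. lra. }
  split; auto. exists C, q. split; auto. split; auto. intros t.
  destruct (Hseq (w - t)) as [be [H1 [H2 [H3 H4]]]].
  replace (w - (w - t)) with t in H1 by ring.
  assert (Hp := Hpos (w - t)). set (x := psis E (w - t)) in *.
  exists (fun n => be n / x). split; [|split; [|split]].
  - intros k. rewrite (H1 k). unfold rev, W. field. lra.
  - unfold slope_r. fold x. rewrite H2. field. lra.
  - rewrite H3. field. lra.
  - intros n. unfold slope_r. fold x. unfold Rdiv. rewrite Rabs_mult.
    rewrite (Rabs_pos_eq (/ x)) by (apply Rlt_le, Rinv_0_lt_compat; auto).
    specialize (H4 n). rewrite (Rabs_pos_eq x) in H4 by lra.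
    apply (Rmult_le_compat_r (/ x)) in H4; [|apply Rlt_le, Rinv_0_lt_compat; auto].
    eapply Rle_trans; [apply H4|]. right. field. lra.
Qed.

Definition mgap E := gap (W E) (psiu E) (slope_r E).

Lemma model_gap E t : E < E0 -> mgap E (t - w) = psiu E t - psis E t.
Proof.
  intros HE. unfold mgap. rewrite (gap_eq (W E) w (E0 - E)); auto; try lra.
  - replace (t - w + w) with t by ring. unfold slope_r. replace (w - - (t - w)) with t by ring.
    rewrite Rinv_inv. reflexivity.
  - apply model_form; auto.
  - apply model_contracted; auto.
Qed.

Lemma energy_B : 3 <= B.
Proof.
  unfold B, A0. assert (HL := model_lam). destruct (pot_pos _ _ _ _ _ _ _ _ _ _ Hpot) as [HAv _]. nra.
Qed.

Let m0 := sqrt (c1 * Lam / 48) / B.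

(** The summands bound the maximum of the slope, bound its derivative from above, and invert the
    lower bound [m0]. The stable slope is a reciprocal, which costs a factor [B^2] in the last
    two. *)
Definition C1_const : R := B + 2 * B ^ 3 * sqrt (Lam * A2) + B ^ 2 / m0.

Lemma m0_pos : 0 < m0.
Proof.
  assert (HB := energy_B).
  apply Rdiv_lt_0_compat; [apply sqrt_lt_R0|]; generalize (sc_lam _ _ _ _ _ _ _ _ _ _ Hsc); lra.
Qed.

Lemma C1_const_pos : 0 < C1_const.
Proof.
  assert (HB := energy_B). assert (H0 := m0_pos).
  assert (HB2 : 0 < B ^ 2) by (apply pow_lt; lra). assert (HB3 : 0 < B ^ 3) by (apply pow_lt; lra).
  assert (H1 : 0 <= 2 * B ^ 3 * sqrt (Lam * A2)) by (apply Rmult_le_pos; [lra|apply sqrt_pos]).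
  assert (H2 : 0 < B ^ 2 / m0) by (apply Rdiv_lt_0_compat; auto).
  unfold C1_const. lra.
Qed.

Section AtEnergy.
Variable E : R.
Hypothesis HE : E0 - 1 < E < E0.

Let HEl : E < E0 := proj2 HE.
Let He : 0 < E0 - E.
Proof. lra. Qed.

(** [E0] lies at most 2 below the minimum of the potential and [E] at most 1 below [E0]. This 3 is
    also the upper bound for [delta]. *)
Lemma energy_bounds : 0 < W E tmin <= 3.
Proof. unfold W. generalize model_E0_upper model_E0_lower. lra. Qed.

Lemma energy_W_low t : Lam * c0 * nd (t - tmin) ^ 2 <= W E t.
Proof.
  assert (H := pot_low _ _ _ _ _ _ _ _ _ _ Hpot t). assert (H' := energy_bounds). unfold W in *.
  assert (lam ^ 2 * (v tmin + c0 * nd (t - tmin) ^ 2) <= lam ^ 2 * v t)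
    by (apply Rmult_le_compat_l; [apply pow2_ge_0|auto]).
  unfold Lam. lra.
Qed.

Lemma energy_W_up t : W E t <= B.
Proof.
  assert (H1 := energy_bounds). assert (HL := model_lam).
  assert (H2 := pot_bound _ _ _ _ _ _ _ _ _ _ Hpot t). assert (H3 := pot_bound _ _ _ _ _ _ _ _ _ _ Hpot tmin).
  apply Rabs_le_between in H2, H3. unfold W in *. unfold B, A0.
  change (lam ^ 2) with Lam in H1 |- *.
  assert (Lam * (v t - v tmin) <= Lam * (2 * Av)) by (apply Rmult_le_compat_l; lra). lra.
Qed.

Lemma energy_W_mid t h : Rabs (W E (t - h) + W E (t + h) - 2 * W E t) <= Lam * A2 * h ^ 2.
Proof.
  unfold W. replace (lam ^ 2 * v (t - h) - E + (lam ^ 2 * v (t + h) - E) - 2 * (lam ^ 2 * v t - E))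
    with (Lam * (v (t - h) + v (t + h) - 2 * v t)) by (unfold Lam; ring).
  rewrite Rabs_mult, (Rabs_pos_eq Lam) by apply pow2_ge_0. rewrite Rmult_assoc.
  apply Rmult_le_compat_l; [apply pow2_ge_0|]. apply Hpot.
Qed.

Lemma energy_W_conv t h : Rabs (t - tmin) + Rabs h <= rv ->
  Lam * cv * h ^ 2 <= W E (t - h) + W E (t + h) - 2 * W E t.
Proof.
  intros H. unfold W. replace (lam ^ 2 * v (t - h) - E + (lam ^ 2 * v (t + h) - E) - 2 * (lam ^ 2 * v t - E))
    with (Lam * (v (t - h) + v (t + h) - 2 * v t)) by (unfold Lam; ring).
  rewrite Rmult_assoc. apply Rmult_le_compat_l; [apply pow2_ge_0|].
  apply (pot_conv _ _ _ _ _ _ _ _ _ _ Hpot); auto.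
Qed.

Let Hf := model_form E HEl.
Let Hp := model_contracted E HEl.
Let Hr := proj2 (model_psis E HEl).

Lemma energy_continuity_u : continuity (psiu E).
Proof.
  apply (contracted_continuity (W E) w B (E0 - E) (Lam * A1)); auto.
  - apply energy_W_up.
  - apply Rmult_le_pos; [apply pow2_ge_0|]. destruct (pot_pos _ _ _ _ _ _ _ _ _ _ Hpot). lra.
  - apply model_W_lip.
Qed.

Lemma rev_W_up t : rev (W E) t <= B.
Proof. apply energy_W_up. Qed.

Lemma rev_W_lip t s : Rabs (rev (W E) t - rev (W E) s) <= Lam * A1 * Rabs (t - s).
Proof.
  unfold rev. eapply Rle_trans; [apply model_W_lip|]. right. f_equal.
  rewrite <- (Rabs_Ropp (t - s)). f_equal. ring.
Qed.

Lemma energy_continuity_r : continuity (slope_r E).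
Proof.
  apply (contracted_continuity (rev (W E)) w B (E0 - E) (Lam * A1)); auto.
  - apply rev_W_up.
  - apply Rmult_le_pos; [apply pow2_ge_0|]. destruct (pot_pos _ _ _ _ _ _ _ _ _ _ Hpot). lra.
  - apply rev_W_lip.
  - apply form_rev; auto.
Qed.

Lemma energy_gap_period t k : mgap E (t + IZR k) = mgap E t.
Proof. apply (gap_period (W E) w); auto. apply model_W_per. Qed.

Lemma energy_minimizer : exists th, forall t, mgap E th <= mgap E t.
Proof.
  assert (Hc : continuity (mgap E)).
  { assert (Ec : mgap E = fun t => psiu E (t - - w) - / slope_r E (- t)).
    { extensionality t. unfold mgap. rewrite (gap_eq (W E) w (E0 - E)); auto.
      f_equal. f_equal. ring. }
    rewrite Ec. apply (continuity_minus (fun t => psiu E (t - - w)) (fun t => / slope_r E (- t))).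
    - apply continuity_shift, energy_continuity_u.
    - apply (continuity_inv (fun t => slope_r E (- t))).
      + apply (continuity_comp (fun t => - t) (slope_r E)).
        * apply (continuity_opp id). apply derivable_continuous, derivable_id.
        * apply energy_continuity_r.
      + intros t. apply Rgt_not_eq. apply (pair_r_pos (W E) w (E0 - E) (slope_r E)); auto. }
  destruct (periodic_max (fun t => - mgap E t)) as [m [[th Hth] Hm]].
  - apply (continuity_opp (mgap E)); auto.
  - intros t k. f_equal. apply energy_gap_period.
  - exists th. intros t. specialize (Hm t). lra.
Qed.

Variable th : R.
Hypothesis Hth : forall t, mgap E th <= mgap E t.
Let delta := mgap E th.

Lemma energy_delta : E0 - E <= delta <= 3.
Proof.
  split.
  - apply (gap_ge (W E) w B (E0 - E)); auto. apply energy_W_up.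
  - eapply Rle_trans; [apply (Hth tmin)|]. unfold mgap, gap.
    assert (H1 := pair_p_pos (W E) w (E0 - E) (psiu E) He Hf Hp tmin).
    assert (H2 := pair_r_pos (W E) w (E0 - E) (slope_r E) He Hf Hr (- tmin)).
    apply Rinv_0_lt_compat in H1, H2. generalize energy_bounds. lra.
Qed.

Lemma energy_trial t q n u : (q <= 0 < q + Z.of_nat n)%Z ->
  delta * u 0%Z ^ 2 <= form (orb w (W E) t) q n u.
Proof.
  intros Hq. eapply Rle_trans; [|apply (gap_form (W E) w (E0 - E) (psiu E) (slope_r E)); auto].
  apply Rmult_le_compat_r; [apply pow2_ge_0|apply Hth].
Qed.

Lemma energy_pos_form t : pos_form (orb w (W E) t).
Proof. exists (E0 - E). split; auto. Qed.

Let ph := phi w (psiu E) (slope_r E).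

Lemma energy_cfg : cfg (orb w (W E) th) (ph th) /\ defect (orb w (W E) th) (ph th) = delta.
Proof.
  split.
  - apply (minimizer_cfg (W E) w B (E0 - E)); auto. apply energy_W_up.
  - apply phi_defect.
Qed.

Lemma energy_separation t u : cfg (orb w (W E) t) u -> 0 < nd (t - th) ->
  delta + c1 * Lam * nd (t - th) ^ 2 <= defect (orb w (W E) t) u.
Proof.
  intros Hu Hnd. destruct energy_cfg as [Hc Hd]. destruct energy_delta as [D1 D2].
  destruct (pot_pos _ _ _ _ _ _ _ _ _ _ Hpot) as [P1 [P2 [P3 [P4 [P5 P6]]]]].
  destruct Hsc as [S1 S2 S3 S4 S5 S6 S7 S8 S9 S10 S11].
  apply (separation w tmin Lam c0 c1 cv rv A0 A1 A2 cw delta (W E) k0) with (u := ph th); auto; try lra.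
  - apply model_W_per.
  - apply energy_W_low.
  - apply energy_W_up.
  - apply model_W_lip.
  - apply energy_W_mid.
  - apply energy_W_conv.
  - apply energy_pos_form.
  - apply energy_trial.
  - rewrite Hd. assert (0 < c1 * Lam * nd (t - th) ^ 2) by (apply Rmult_lt_0_compat; [lra|apply pow_lt; auto]). lra.
Qed.

Lemma energy_decay n : ph th (Z.of_nat n) <= rho ^ n /\ ph th (- Z.of_nat n) <= rho ^ n.
Proof.
  destruct energy_cfg as [Hc Hd]. destruct energy_delta as [D1 D2].
  destruct (pot_pos _ _ _ _ _ _ _ _ _ _ Hpot) as [P1 [P2 [P3 [P4 [P5 P6]]]]].
  destruct Hsc as [S1 S2 S3 S4 S5 S6 S7 S8 S9 S10 S11].
  apply (minimizer_decay w tmin Lam c0 c1 cv rv A0 A1 A2 cw delta (W E) k0) with (th := th); auto; try lra.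
  - apply model_W_per.
  - apply energy_W_low.
  - apply energy_W_up.
  - apply model_W_lip.
  - apply energy_W_mid.
  - apply energy_W_conv.
  - apply energy_pos_form.
  - apply energy_trial.
Qed.

Lemma energy_unique t : mgap E t = delta -> exists k : Z, t = th + IZR k.
Proof.
  intros Ht. destruct (Rle_lt_or_eq_dec _ _ (nd_pos (t - th))) as [Hnd|Hnd].
  - exfalso.
    assert (Hc : cfg (orb w (W E) t) (ph t)).
    { apply (minimizer_cfg (W E) w B (E0 - E)); auto; [apply energy_W_up|].
      intros s. fold (mgap E t) (mgap E s). rewrite Ht. apply Hth. }
    assert (H := energy_separation t (ph t) Hc Hnd).
    unfold ph in H. rewrite phi_defect in H. fold (mgap E t) in H. rewrite Ht in H.
    destruct Hsc as [S1 S2 S3 S4 S5 S6 S7 S8 S9 S10 S11].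
    assert (0 < c1 * Lam * nd (t - th) ^ 2) by (apply Rmult_lt_0_compat; [lra|apply pow_lt; auto]). lra.
  - destruct (nd_rep (t - th)) as [k Hk]. exists k. rewrite <- Hnd in Hk.
    destruct (Req_dec (t - th - IZR k) 0) as [H|H]; [lra|]. apply Rabs_no_R0 in H. lra.
Qed.

Lemma rho_small : 0 < rho <= / 16.
Proof.
  destruct Hsc as [S1 S2 S3 S4 S5 S6 S7 S8 S9 S10 S11]. split; [|auto].
  apply (rho_pos cw (c1 * Lam)); auto.
Qed.

(** The square norm of the minimizer is 1 from the center plus two small geometric series. It
    becomes the Lipschitz constant of the minimal gap in the energy. *)
Lemma energy_phi_sum N : phi_sum w (psiu E) (slope_r E) th N <= 2.
Proof.
  destruct rho_small as [R1 R2]. unfold phi_sum. fold ph.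
  set (g := fun k => ph th k ^ 2).
  assert (Hpos : forall k, 0 < ph th k) by (intros k; apply (phi_pos (W E) w (E0 - E)); auto).
  assert (Hs : zsum (- Z.of_nat N) (N + (1 + N)) g = zsum 1 N (fun j => g (- j)%Z) + g 0%Z + zsum 1 N g).
  { rewrite !zsum_split. rewrite (zsum_refl N 1 g). cbn [zsum].
    replace (- (1 + Z.of_nat N - 1))%Z with (- Z.of_nat N)%Z by lia.
    replace (- Z.of_nat N + Z.of_nat N + Z.of_nat 0)%Z with 0%Z by lia.
    replace (- Z.of_nat N + Z.of_nat N + Z.of_nat 1)%Z with 1%Z by lia. ring. }
  replace (2 * N + 1)%nat with (N + (1 + N))%nat by lia. rewrite Hs.
  assert (Hr2 : 0 <= rho ^ 2 <= / 2) by (split; [apply pow2_ge_0|nra]).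
  assert (Hg := geom_zsum (rho ^ 2) N Hr2).
  assert (Hb : forall k, (1 <= k)%Z -> g k <= (rho ^ 2) ^ Z.to_nat k /\ g (- k)%Z <= (rho ^ 2) ^ Z.to_nat k).
  { intros k Hk. rewrite <- pow_mult, Nat.mul_comm, pow_mult. unfold g.
    destruct (energy_decay (Z.to_nat k)) as [D1 D2]. rewrite Z2Nat.id in D1, D2 by lia.
    split; apply pow_incr; split; auto; apply Rlt_le, Hpos. }
  assert (H1 : zsum 1 N g <= 2 * rho ^ 2).
  { eapply Rle_trans; [|apply Hg]. apply zsum_le. intros k Hk. apply Hb; lia. }
  assert (H2 : zsum 1 N (fun j => g (- j)%Z) <= 2 * rho ^ 2).
  { eapply Rle_trans; [|apply Hg]. apply zsum_le. intros k Hk. apply Hb; lia. }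
  assert (H3 : g 0%Z = 1) by (unfold g, ph; rewrite phi_0; ring).
  assert (rho ^ 2 <= / 16) by nra. lra.
Qed.
Let energy_A : 0 <= Lam * A1 /\ 0 < Lam * A2.
Proof.
  destruct (pot_pos _ _ _ _ _ _ _ _ _ _ Hpot) as [_ [P2 [P3 _]]]. assert (HL := model_lam).
  split; [apply Rmult_le_pos|apply Rmult_lt_0_compat]; lra.
Qed.

Lemma energy_u_bounds t : / B <= psiu E t <= B.
Proof.
  assert (H1 := contracted_lt (W E) w B (E0 - E) (psiu E) energy_W_up He Hf Hp t).
  assert (H2 := contracted_inv_lt (W E) w B (E0 - E) (psiu E) energy_W_up He Hf Hp t).
  assert (H3 := pair_p_pos (W E) w (E0 - E) (psiu E) He Hf Hp t).
  split; [|lra]. rewrite <- (Rinv_inv (psiu E t)).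
  apply Rinv_le_contravar; [apply Rinv_0_lt_compat|]; lra.
Qed.

Lemma energy_s_bounds t : / B <= psis E t <= B.
Proof.
  assert (Hfr := form_rev (W E) w (E0 - E) Hf).
  assert (H1 := contracted_lt (rev (W E)) w B (E0 - E) (slope_r E) rev_W_up He Hfr Hr (w - t)).
  assert (H2 := contracted_inv_lt (rev (W E)) w B (E0 - E) (slope_r E) rev_W_up He Hfr Hr (w - t)).
  assert (H3 := proj1 (model_psis E HEl) t).
  unfold slope_r in H1, H2. replace (w - (w - t)) with t in H1, H2 by ring. rewrite Rinv_inv in H2.
  split; [|lra]. rewrite <- (Rinv_inv (psis E t)).
  apply Rinv_le_contravar; [apply Rinv_0_lt_compat|]; lra.
Qed.

Lemma energy_C1_u : exists dp b, C1_data (psiu E) dp b /\ 0 <= b /\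
  b ^ 2 <= 2 * (Lam * A2 * (B / (E0 - E))) * B.
Proof.
  destruct energy_A as [HA1 HA2].
  apply (contracted_C1 (W E) (fun t => Lam * v1 t) w B (E0 - E) (Lam * A1)); auto.
  - apply model_W_per.
  - intros t k. rewrite (pot_per1 _ _ _ _ _ _ _ _ _ _ Hpot). reflexivity.
  - apply energy_W_up.
  - apply model_W_lip.
  - intros t. rewrite Rabs_mult, (Rabs_pos_eq Lam) by apply pow2_ge_0.
    apply Rmult_le_compat_l; [apply pow2_ge_0|apply Hpot].
  - apply (continuity_scal v1). apply Hpot.
  - intros t s. unfold W. change (lam ^ 2) with Lam.
    assert (H := pot_taylor _ _ _ _ _ _ _ _ _ _ Hpot t s).
    apply (Rmult_le_compat_l Lam) in H; [lra|apply pow2_ge_0].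
Qed.

Lemma energy_C1_r : exists dp b, C1_data (slope_r E) dp b /\ 0 <= b /\
  b ^ 2 <= 2 * (Lam * A2 * (B / (E0 - E))) * B.
Proof.
  destruct energy_A as [HA1 HA2].
  apply (contracted_C1 (rev (W E)) (fun t => - Lam * v1 (- t)) w B (E0 - E) (Lam * A1)); auto.
  - intros t k. unfold rev. replace (- (t + IZR k)) with (- t + IZR (- k)) by (rewrite opp_IZR; ring).
    apply model_W_per.
  - intros t k. replace (- (t + IZR k)) with (- t + IZR (- k)) by (rewrite opp_IZR; ring).
    rewrite (pot_per1 _ _ _ _ _ _ _ _ _ _ Hpot). reflexivity.
  - apply rev_W_up.
  - apply rev_W_lip.
  - intros t. rewrite Rabs_mult, Rabs_Ropp, (Rabs_pos_eq Lam) by apply pow2_ge_0.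
    apply Rmult_le_compat_l; [apply pow2_ge_0|apply Hpot].
  - apply (continuity_scal (fun t => v1 (- t))).
    apply (continuity_comp (fun t => - t) v1); [|apply Hpot].
    apply (continuity_opp id). apply derivable_continuous, derivable_id.
  - intros t s. unfold rev, W. change (lam ^ 2) with Lam.
    assert (H := pot_taylor _ _ _ _ _ _ _ _ _ _ Hpot (- t) (- s)).
    replace (- t + - s) with (- (t + s)) in H by ring.
    apply (Rmult_le_compat_l Lam) in H; [|apply pow2_ge_0].
    replace ((- s) ^ 2) with (s ^ 2) in H by ring. lra.
  - apply form_rev; auto.
Qed.

Hypothesis Hsmall : small_gap delta.
Hypothesis Hhalf : delta <= 2 * (E0 - E).

Let Q := / (loglen delta ^ 2 * sqrt delta).
Lemma energy_lower_u M : 0 < M -> (forall t s, Rabs (psiu E t - psiu E s) <= M * Rabs (t - s)) ->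
  m0 * Q <= M.
Proof.
  intros HM HL. destruct Hsmall as [Hd Hs].
  apply (slope_lower_explicit (W E) w B (E0 - E) (psiu E) (slope_r E) energy_W_up He Hf Hp Hr
    kappa tau th (c1 * Lam) M rho); auto.
  - apply rho_small.
  - apply energy_decay.
  - generalize (sc_lam _ _ _ _ _ _ _ _ _ _ Hsc). lra.
  - apply energy_separation.
Qed.

(** The estimate for the unstable slope, applied to the reflected potential, whose gap is minimal at
    [- th]. *)
Lemma energy_lower_r M : 0 < M -> (forall t s, Rabs (slope_r E t - slope_r E s) <= M * Rabs (t - s)) ->
  m0 * Q <= M.
Proof.
  intros HM HL. destruct Hsmall as [Hd Hs].
  assert (Hp' : contracted (rev (rev (W E))) w (psiu E)) by (rewrite rev_twice; auto).
  assert (Eg : gap (rev (W E)) (slope_r E) (psiu E) (- th) = delta) by apply gap_rev.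
  unfold Q, m0. rewrite <- Eg.
  apply (slope_lower_explicit (rev (W E)) w B (E0 - E) (slope_r E) (psiu E) rev_W_up He
    (form_rev (W E) w (E0 - E) Hf) Hr Hp' kappa tau (- th) (c1 * Lam) M rho); rewrite ?Eg; auto.
  - apply rho_small.
  - intros n. rewrite !phi_rev, Z.opp_involutive. destruct (energy_decay n). auto.
  - generalize (sc_lam _ _ _ _ _ _ _ _ _ _ Hsc). lra.
  - apply separation_rev. apply energy_separation.
Qed.

(** [Hhalf] converts [1 / (E0 - E)] into at most [2 / delta]. *)
Lemma energy_b_upper b : 0 <= b -> b ^ 2 <= 2 * (Lam * A2 * (B / (E0 - E))) * B ->
  b <= 2 * B * sqrt (Lam * A2) * / sqrt delta.
Proof.
  intros Hb Hb2. destruct Hsmall as [Hd _]. destruct energy_A as [_ HA]. assert (HB := energy_B).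
  assert (Hsd : 0 < sqrt delta) by (apply sqrt_lt_R0; lra).
  assert (Hs : 0 < sqrt (Lam * A2)) by (apply sqrt_lt_R0; lra).
  apply Rsqr_incr_0_var.
  2:{ apply Rmult_le_pos; [|apply Rlt_le, Rinv_0_lt_compat; auto]. apply Rmult_le_pos; lra. }
  rewrite !Rsqr_pow2, !Rpow_mult_distr, pow_inv, !pow2_sqrt by lra.
  eapply Rle_trans; [apply Hb2|].
  assert (Hi : / (E0 - E) <= 2 * / delta).
  { replace (2 * / delta) with (/ (delta / 2)) by (field; lra). apply Rinv_le_contravar; lra. }
  replace (2 * (Lam * A2 * (B / (E0 - E))) * B) with (2 * (Lam * A2) * B ^ 2 * / (E0 - E)) by (field; lra).
  replace (2 ^ 2 * B ^ 2 * (Lam * A2) * / delta) with (2 * (Lam * A2) * B ^ 2 * (2 * / delta)) by (field; lra).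
  apply Rmult_le_compat_l; auto. apply Rmult_le_pos; [lra|apply pow2_ge_0].
Qed.

Lemma energy_const a b : 0 <= b -> / B <= a <= B ->
  b <= 2 * B ^ 3 * sqrt (Lam * A2) * / sqrt delta -> m0 * Q / B ^ 2 <= / B + b ->
  / C1_const * Q <= a + b <= C1_const * / sqrt delta.
Proof.
  intros Hb Ha Hbu Hbl. destruct Hsmall as [Hd _]. destruct energy_A as [_ HA]. assert (HB := energy_B).
  assert (Hsd : 0 < sqrt delta) by (apply sqrt_lt_R0; lra).
  assert (Hsd1 : 1 <= / sqrt delta).
  { rewrite <- Rinv_1. apply Rinv_le_contravar; auto. rewrite <- sqrt_1. apply sqrt_le_1; lra. }
  assert (Hs : 0 < sqrt (Lam * A2)) by (apply sqrt_lt_R0; lra).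
  assert (Hm0 := m0_pos).
  assert (HB2 : 0 < B ^ 2) by (apply pow_lt; lra). assert (HB3 : 0 < B ^ 3) by (apply pow_lt; lra).
  assert (H1 : 0 < 2 * B ^ 3 * sqrt (Lam * A2)) by (apply Rmult_lt_0_compat; lra).
  assert (H2 : 0 < B ^ 2 / m0) by (apply Rdiv_lt_0_compat; auto).
  assert (HQ : 0 < Q).
  { apply Rinv_0_lt_compat, Rmult_lt_0_compat; auto. apply pow_lt. generalize (loglen_gt delta Hd). lra. }
  split.
  - apply Rle_trans with (m0 * Q / B ^ 2); [|lra].
    replace (m0 * Q / B ^ 2) with (/ (B ^ 2 / m0) * Q) by (field; lra).
    apply Rmult_le_compat_r; [lra|]. apply Rinv_le_contravar; auto. unfold C1_const. lra.
  - unfold C1_const. rewrite !Rmult_plus_distr_r.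
    assert (a <= B * / sqrt delta) by nra.
    assert (0 < B ^ 2 / m0 * / sqrt delta) by (apply Rmult_lt_0_compat; lra). lra.
Qed.

Lemma energy_norm_u : exists Nu, is_C1_norm (psiu E) Nu /\
  / C1_const * Q <= Nu <= C1_const * / sqrt delta.
Proof.
  assert (HB := energy_B). destruct energy_C1_u as [dp [b [Hdat [Hb Hb2]]]].
  assert (Hup := energy_b_upper b Hb Hb2).
  (* [1 + b] because the Lipschitz constant has to be positive; after division by [B^2] the 1 is
     absorbed by the maximum of the slope, at least [1 / B]. *)
  assert (Hlow : m0 * Q <= 1 + b).
  { apply energy_lower_u; [lra|]. intros t s. eapply Rle_trans; [apply (C1_data_lip _ _ _ Hdat)|].
    apply Rmult_le_compat_r; [apply Rabs_pos|lra]. }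
  destruct (C1_norm_of_data (psiu E) dp b B Hdat) as [a [HN Ha]].
  - apply (contracted_period (W E) w); auto. apply model_W_per.
  - apply energy_u_bounds.
  - lra.
  - exists (a + b). split; auto.
    assert (Hi : 0 < / B <= 1).
    { split; [apply Rinv_0_lt_compat; lra|]. rewrite <- Rinv_1. apply Rinv_le_contravar; lra. }
    apply energy_const; auto.
    + eapply Rle_trans; [apply Hup|]. apply Rmult_le_compat_r.
      { apply Rlt_le, Rinv_0_lt_compat, sqrt_lt_R0. destruct Hsmall; lra. }
      apply Rmult_le_compat_r; [apply sqrt_pos|]. simpl. nra.
    + unfold Rdiv. rewrite <- pow_inv.
      apply Rle_trans with ((1 + b) * (/ B) ^ 2); [apply Rmult_le_compat_r; auto; apply pow2_ge_0|].
      assert ((/ B) ^ 2 <= / B) by (simpl; nra). assert (b * (/ B) ^ 2 <= b * 1) by (apply Rmult_le_compat_l; lra).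
      lra.
Qed.

Lemma energy_norm_s : exists Ns, is_C1_norm (psis E) Ns /\
  / C1_const * Q <= Ns <= C1_const * / sqrt delta.
Proof.
  assert (HB := energy_B). destruct energy_C1_r as [dr [br [Hdat [Hbr Hbr2]]]].
  assert (Hup := energy_b_upper br Hbr Hbr2).
  assert (Hlow : m0 * Q <= 1 + br).
  { apply energy_lower_r; [lra|]. intros t s. eapply Rle_trans; [apply (C1_data_lip _ _ _ Hdat)|].
    apply Rmult_le_compat_r; [apply Rabs_pos|lra]. }
  assert (Hrper : forall t k, slope_r E (t + IZR k) = slope_r E t).
  { apply (contracted_period (rev (W E)) w); auto. intros t k. unfold rev.
    replace (- (t + IZR k)) with (- t + IZR (- k)) by (rewrite opp_IZR; ring). apply model_W_per. }
  destruct (C1_data_inv w (slope_r E) dr br B (psis E) Hdat) as [dp [b [Hs [Hb1 Hb2]]]]; auto.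
  - lra.
  - apply (model_psis E HEl).
  - apply energy_s_bounds.
  - assert (Hi : 0 < / B <= 1).
    { split; [apply Rinv_0_lt_compat; lra|]. rewrite <- Rinv_1. apply Rinv_le_contravar; lra. }
    assert (HiB : / B ^ 2 <= / B) by (rewrite <- pow_inv; simpl; nra).
    assert (HB2 : 0 < B ^ 2) by (apply pow_lt; lra).
    assert (HiB0 : 0 < / B ^ 2) by (apply Rinv_0_lt_compat; auto).
    destruct (C1_norm_of_data (psis E) dp b B Hs) as [a [HN Ha]].
    + intros t k. assert (H := Hrper (w - t) (- k)%Z). unfold slope_r in H.
      apply Rinv_eq_reg in H. rewrite opp_IZR in H.
      replace (w - (w - t + - IZR k)) with (t + IZR k) in H by ring.
      replace (w - (w - t)) with t in H by ring. auto.
    + apply energy_s_bounds.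
    + lra.
    + exists (a + b). split; auto.
      apply energy_const; auto.
      * eapply Rle_trans; [|apply Hb1]. apply Rmult_le_pos; lra.
      * eapply Rle_trans; [apply Hb2|].
        replace (2 * B ^ 3 * sqrt (Lam * A2) * / sqrt delta)
          with (2 * B * sqrt (Lam * A2) * / sqrt delta * B ^ 2) by ring.
        apply Rmult_le_compat_r; lra.
      * apply (Rmult_le_compat_r (/ B ^ 2)) in Hlow; [|lra]. unfold Rdiv in *. lra.
Qed.
End AtEnergy.

(** * Dependence of the minimal gap on the energy *)

Definition minimizer E th := forall t, mgap E th <= mgap E t.

(** One trial function, the minimizer at [E'], with two bounds for its square norm: 2, from decay,
    and [mgap E' th' / (E0 - E')], from coercivity. The second one says that the quotient of the gap
    by [E0 - E] is nondecreasing. *)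
Lemma model_step E E' th th' : E0 - 1 < E -> E < E' -> E' < E0 -> minimizer E th -> minimizer E' th' ->
  mgap E th <= mgap E' th' + (E' - E) * 2 /\
  mgap E th * (E0 - E') <= mgap E' th' * (E0 - E).
Proof.
  intros H1 H2 H3 Hm Hm'.
  assert (HE : E0 - 1 < E < E0) by lra. assert (HE' : E0 - 1 < E' < E0) by lra.
  assert (HWB := energy_W_up E' HE').
  assert (He : 0 < E0 - E') by lra.
  assert (Hp := model_contracted E' H3). assert (Hr := proj2 (model_psis E' H3)).
  assert (Hf := model_form E' H3).
  assert (Hstep : forall S, (forall N, phi_sum w (psiu E') (slope_r E') th' N <= S) ->
    mgap E th <= mgap E' th' + (E' - E) * S).
  { intros S HS. apply (gap_energy_step (W E') w B (E0 - E') (psiu E') (slope_r E') HWB He Hf Hp Hr (W E)); auto.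
    - intros t. unfold W. ring.
    - lra.
    - apply (energy_trial E HE th Hm). }
  split.
  - apply Hstep, (energy_phi_sum E' HE' th' Hm').
  - assert (H := Hstep (mgap E' th' / (E0 - E'))).
    assert (HS : forall N, phi_sum w (psiu E') (slope_r E') th' N <= mgap E' th' / (E0 - E')).
    { intros N. apply (Rmult_le_reg_l (E0 - E')); auto.
      replace ((E0 - E') * (mgap E' th' / (E0 - E'))) with (mgap E' th') by (field; lra).
      apply (phi_sum_bound (W E') w B (E0 - E')); auto. }
    specialize (H HS). apply (Rmult_le_compat_r (E0 - E')) in H; [|lra].
    eapply Rle_trans; [apply H|]. right. field. lra.
Qed.

(* Otherwise the gap would stay bounded below up to [E0], and [E0] would lie in the resolvent set. *)
Lemma model_delta_upper E th : E0 - 1 < E < E0 -> minimizer E th -> mgap E th <= 2 * (E0 - E).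
Proof.
  intros HE Hm. apply Rnot_lt_le. intros Hlt.
  set (d := mgap E th - 2 * (E0 - E)). assert (Hd : 0 < d) by (unfold d; lra).
  assert (HB : 0 < B) by (generalize energy_B; lra).
  (* Half of the coercivity constant that the gap [d] provides at [E']; the other half pays for
     passing from [E'] to [E0 = E' + h] with [h <= c]. *)
  set (c := d ^ 2 / (8 * B ^ 3)).
  assert (Hc : 0 < c).
  { apply Rdiv_lt_0_compat; [apply pow_lt; auto|]. apply Rmult_lt_0_compat; [lra|apply pow_lt; auto]. }
  apply (model_not_coercive c Hc). intros p n u Hn.
  set (h := Rmin c ((E0 - E) / 2)).
  assert (Hh : 0 < h) by (apply Rmin_pos; lra).
  assert (Hh1 : h <= c) by apply Rmin_l. assert (Hh2 : h <= (E0 - E) / 2) by apply Rmin_r.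
  set (E' := E0 - h). assert (HE' : E0 - 1 < E' < E0) by (unfold E'; lra).
  destruct (energy_minimizer E' HE') as [th' Hm'].
  destruct (model_step E E' th th') as [H1 _]; auto; try (unfold E'; lra).
  assert (Hgap : forall t, d <= gap (W E') (psiu E') (slope_r E') t).
  { intros t. eapply Rle_trans; [|apply (Hm' t)]. unfold d, E' in *. lra. }
  assert (H := gap_coercive (W E') w B (E0 - E') (psiu E') (slope_r E') (energy_W_up E' HE')
    ltac:(lra) (model_form E' (proj2 HE')) (model_contracted E' (proj2 HE'))
    (proj2 (model_psis E' (proj2 HE'))) d Hd Hgap 0 p n u Hn).
  rewrite model_form_shift in H.
  replace (d ^ 2 / (4 * B ^ 3)) with (c + c) in H by (unfold c; field; lra).
  replace (E0 - E') with h in H by (unfold E'; ring).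
  assert (Hs : 0 <= zsum p n (fun k => u k ^ 2)) by (apply zsum_nonneg; intros; apply pow2_ge_0).
  assert (h * zsum p n (fun k => u k ^ 2) <= c * zsum p n (fun k => u k ^ 2))
    by (apply Rmult_le_compat_r; auto).
  lra.
Qed.

(** [C1] is the supremum of the quotients of the gap by [E0 - E], which lie between 1 and 2; by
    monotonicity they stay within [e] of it from some energy [E1] on. *)
Lemma model_asymptotics : exists C1, 0 < C1 /\ forall e, 0 < e -> exists rh, 0 < rh <= 1 /\
  forall E th, E0 - rh < E < E0 -> minimizer E th -> Rabs (mgap E th - C1 * (E0 - E)) <= e * (E0 - E).
Proof.
  set (S := fun x => exists E th, E0 - 1 < E < E0 /\ minimizer E th /\ x = mgap E th / (E0 - E)).
  assert (Hx : forall E th, E0 - 1 < E < E0 -> minimizer E th -> 1 <= mgap E th / (E0 - E) <= 2).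
  { intros E th HE Hm. assert (H1 := model_delta_upper E th HE Hm).
    destruct (energy_delta E HE th Hm) as [H2 _].
    split; apply (Rmult_le_reg_r (E0 - E)); try lra; unfold Rdiv; rewrite Rmult_assoc, Rinv_l; lra. }
  destruct (completeness S) as [C1 [Hub Hlub]].
  - exists 2. intros x [E [th [HE [Hm ->]]]]. apply Hx; auto.
  - assert (HE : E0 - 1 < E0 - / 2 < E0) by lra.
    destruct (energy_minimizer _ HE) as [th Hm]. exists (mgap (E0 - / 2) th / (E0 - (E0 - / 2))).
    exists (E0 - / 2), th. auto.
  - exists C1. split.
    + assert (HE : E0 - 1 < E0 - / 2 < E0) by lra.
      destruct (energy_minimizer _ HE) as [th Hm].
      apply Rlt_le_trans with (mgap (E0 - / 2) th / (E0 - (E0 - / 2))); [generalize (Hx _ _ HE Hm); lra|].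
      apply Hub. exists (E0 - / 2), th. auto.
    + intros e He.
      destruct (classic (exists E1 th1, E0 - 1 < E1 < E0 /\ minimizer E1 th1 /\ C1 - e < mgap E1 th1 / (E0 - E1)))
        as [[E1 [th1 [HE1 [Hm1 Hl]]]]|Hno].
      * exists (E0 - E1). split; [lra|]. intros E th HE Hm.
        assert (HEb : E0 - 1 < E < E0) by lra.
        destruct (model_step E1 E th1 th) as [_ H]; auto; try lra.
        assert (Hup : mgap E th / (E0 - E) <= C1) by (apply Hub; exists E, th; auto).
        set (x := mgap E th / (E0 - E)) in *.
        assert (Ex : mgap E th = x * (E0 - E)) by (unfold x; field; lra).
        set (y := mgap E1 th1 / (E0 - E1)) in *.
        assert (Ey : mgap E1 th1 = y * (E0 - E1)) by (unfold y; field; lra).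
        rewrite Ex, Ey in H. assert (Hyx : y <= x).
        { apply (Rmult_le_reg_r ((E0 - E1) * (E0 - E))); [apply Rmult_lt_0_compat; lra|]. lra. }
        rewrite Ex. replace (x * (E0 - E) - C1 * (E0 - E)) with (- (C1 - x) * (E0 - E)) by ring.
        rewrite Rabs_mult, Rabs_Ropp, !Rabs_pos_eq by lra. apply Rmult_le_compat_r; lra.
      * exfalso. assert (H : C1 <= C1 - e); [|lra]. apply Hlub.
        intros x [E [th [HE [Hm ->]]]]. apply Rnot_lt_le. intros Hl. apply Hno. exists E, th. auto.
Qed.

(** The two cases differ only in the upper bound of the potential: [B] is available above [E0 - 1],
    and [Lam * Av - E] serves below. *)
Lemma model_diff E t : E < E0 -> Rabs (psiu E t - psis E t) = mgap E (t - w).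
Proof.
  intros HE. rewrite <- model_gap by auto. apply Rabs_pos_eq.
  destruct (Rle_lt_dec E (E0 - 1)) as [Hle|Hlt].
  - assert (Hk := pot_bound _ _ _ _ _ _ _ _ _ _ Hpot). unfold mgap.
    apply Rle_trans with (E0 - E); [lra|].
    apply (gap_ge (W E) w (Lam * Av - E) (E0 - E)); auto; try lra.
    + intros s. specialize (Hk s). apply Rabs_le_between in Hk. unfold W. change (lam ^ 2) with Lam.
      assert (Lam * v s <= Lam * Av) by (apply Rmult_le_compat_l; [apply pow2_ge_0|lra]). lra.
    + apply model_form; auto.
    + apply model_contracted; auto.
    + apply model_psis; auto.
  - apply Rle_trans with (E0 - E); [lra|].
    apply (gap_ge (W E) w B (E0 - E)); auto; try lra.
    + apply energy_W_up. lra.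
    + apply model_form; auto.
    + apply model_contracted; auto.
    + apply model_psis; auto.
Qed.

Lemma model_min_value E th d : E < E0 -> minimizer E th ->
  is_min_value (fun t => Rabs (psiu E t - psis E t)) d -> d = mgap E th.
Proof.
  intros HE Hm [[t Ht] Hd]. rewrite model_diff in Ht by auto. apply Rle_antisym.
  - specialize (Hd (th + w)). cbv beta in Hd. rewrite model_diff in Hd by auto.
    replace (th + w - w) with th in Hd by ring. auto.
  - rewrite <- Ht. apply Hm.
Qed.

Lemma model_unique_min E th : E0 - 1 < E < E0 -> minimizer E th ->
  unique_min_mod1 (fun t => Rabs (psiu E t - psis E t)) (th + w).
Proof.
  intros HE Hm. assert (HEl := proj2 HE). split.
  - intros t. rewrite !model_diff by auto. replace (th + w - w) with th by ring. apply Hm.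
  - intros t Ht. rewrite !model_diff in Ht by auto. replace (th + w - w) with th in Ht by ring.
    destruct (energy_unique E HE th Hm _ Ht) as [k Hk]. exists k. lra.
Qed.

Theorem model_conclusion : exists (C1 C2 eta : R) (eps : R -> R),
    0 < C1 /\ 0 < C2 /\ 0 < eta /\
    (forall E, E0 - eta < E < E0 ->
       exists thc : R,
         unique_min_mod1 (fun t => Rabs (psiu E t - psis E t)) thc) /\
    (forall e, 0 < e -> exists rho, 0 < rho /\
       forall E, E0 - rho < E < E0 ->
       forall d, is_min_value (fun t => Rabs (psiu E t - psis E t)) d ->
         Rabs (d - C1 * (E0 - E)) <= e * (E0 - E)) /\
    (forall E, E0 - eta < E < E0 -> 0 < eps E) /\
    (forall e, 0 < e -> exists rho, 0 < rho /\
       forall E, E0 - rho < E < E0 -> eps E < e) /\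
    (forall E, E0 - eta < E < E0 ->
       forall d, is_min_value (fun t => Rabs (psiu E t - psis E t)) d ->
       (exists Nu, is_C1_norm (psiu E) Nu /\
          / C2 * Rpower (/ sqrt d) (1 - eps E) <= Nu /\ Nu <= C2 * / sqrt d) /\
       (exists Ns, is_C1_norm (psis E) Ns /\
          / C2 * Rpower (/ sqrt d) (1 - eps E) <= Ns /\ Ns <= C2 * / sqrt d)).
Proof.
  set (thm := fun E => epsilon (inhabits 0) (minimizer E)).
  assert (Hthm : forall E, E0 - 1 < E < E0 -> minimizer E (thm E)).
  { intros E HE. apply epsilon_spec. apply (energy_minimizer E HE). }
  set (dl := fun E => mgap E (thm E)).
  assert (Hdl : forall E, E0 - 1 < E < E0 -> 0 < dl E <= 2 * (E0 - E)).
  { intros E HE. split; [|apply model_delta_upper; auto].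
    destruct (energy_delta E HE (thm E) (Hthm E HE)) as [H _]. unfold dl. lra. }
  destruct model_asymptotics as [C1 [HC1 Has]].
  assert (HcL := sc_lam _ _ _ _ _ _ _ _ _ _ Hsc).
  destruct Hdio as [Hk [Htau _]].
  destruct (log_small (c1 * Lam * Rmin kappa 1 ^ 2 / 48) (2 + 2 * tau)) as [d0 [Hd0 Hlog]]; [|lra|].
  { apply Rdiv_lt_0_compat; [|lra]. apply Rmult_lt_0_compat; [lra|]. apply pow_lt, Rmin_pos; lra. }
  assert (Hsm : forall E, E0 - d0 / 2 < E < E0 -> small_gap (dl E)).
  { intros E HE. assert (H := Hdl E ltac:(lra)). split; [lra|]. apply Hlog. lra. }
  assert (Hnorm : forall E, E0 - d0 / 2 < E < E0 ->
    (exists Nu, is_C1_norm (psiu E) Nu /\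
       / C1_const * / (loglen (dl E) ^ 2 * sqrt (dl E)) <= Nu <= C1_const * / sqrt (dl E)) /\
    (exists Ns, is_C1_norm (psis E) Ns /\
       / C1_const * / (loglen (dl E) ^ 2 * sqrt (dl E)) <= Ns <= C1_const * / sqrt (dl E))).
  { intros E HE. assert (HE' : E0 - 1 < E < E0) by lra. split.
    - apply (energy_norm_u E HE' (thm E) (Hthm E HE')); [apply Hsm; auto|apply Hdl; auto].
    - apply (energy_norm_s E HE' (thm E) (Hthm E HE')); [apply Hsm; auto|apply Hdl; auto]. }
  (* The minimal gap is at most [2 (E0 - E)], so [eta = d0 / 2] keeps it below the threshold [d0] of
     [small_gap]. *)
  exists C1, C1_const, (d0 / 2), (fun E => 4 * ln (loglen (dl E)) / (- ln (dl E))).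
  split; auto. split; [apply C1_const_pos|]. split; [lra|]. split; [|split; [|split; [|split]]].
  - intros E HE. exists (thm E + w). apply model_unique_min; [lra|apply Hthm; lra].
  - intros e He. destruct (Has e He) as [rh [Hrh H]]. exists rh. split; [lra|].
    intros E HE d Hd. rewrite (model_min_value E (thm E) d); [|lra|apply Hthm; lra|auto].
    apply H; auto. apply Hthm; lra.
  - intros E HE. destruct (Hsm E HE) as [Hd _]. assert (HL := loglen_gt _ Hd).
    assert (ln (dl E) < 0) by (rewrite <- ln_1; apply ln_increasing; lra).
    assert (0 < ln (loglen (dl E))) by (rewrite <- ln_1; apply ln_increasing; lra).
    apply Rdiv_lt_0_compat; lra.
  - intros e He. destruct (log_ratio_lim e He) as [d1 [Hd1 H]]. exists (d1 / 2). split; [lra|].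
    intros E HE. apply H. generalize (Hdl E ltac:(lra)). lra.
  - intros E HE d Hd. rewrite (model_min_value E (thm E) d); [|lra|apply Hthm; lra|auto].
    fold (dl E). rewrite Rpower_loglen by apply (Hsm E HE). apply (Hnorm E HE).
Qed.
End Model.

Theorem theorem2p1 :
  forall (w kappa tau : R), diophantine w kappa tau ->
  forall (v v1 v2 : R -> R) (tmin : R),
    periodic1 v -> C2_with v v1 v2 ->
    unique_min_mod1 v tmin -> 0 < v2 tmin ->
  exists lam0 : R, 0 < lam0 /\
  forall lam : R, lam > lam0 ->
  forall E0 : R, is_min_spectrum lam w v E0 ->
  forall psiu psis : R -> R -> R,
    (forall E, E < E0 ->
       is_unstable_fn lam E w v (psiu E) /\ is_stable_fn lam E w v (psis E)) ->
  exists (C1 C2 eta : R) (eps : R -> R),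
    0 < C1 /\ 0 < C2 /\ 0 < eta /\
    (* minimum of |psi^u - psi^s| attained at a unique point of T *)
    (forall E, E0 - eta < E < E0 ->
       exists thc : R,
         unique_min_mod1 (fun t => Rabs (psiu E t - psis E t)) thc) /\
    (* delta(E) = C1 (E0 - E) + o(E0 - E) *)
    (forall e, 0 < e -> exists rho, 0 < rho /\
       forall E, E0 - rho < E < E0 ->
       forall d, is_min_value (fun t => Rabs (psiu E t - psis E t)) d ->
         Rabs (d - C1 * (E0 - E)) <= e * (E0 - E)) /\
    (* eps(E) > 0 and eps(E) -> 0 as E -> E0^- *)
    (forall E, E0 - eta < E < E0 -> 0 < eps E) /\
    (forall e, 0 < e -> exists rho, 0 < rho /\
       forall E, E0 - rho < E < E0 -> eps E < e) /\
    (* two-sided C^1 bounds for psi^u and psi^s *)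
    (forall E, E0 - eta < E < E0 ->
       forall d, is_min_value (fun t => Rabs (psiu E t - psis E t)) d ->
       (exists Nu, is_C1_norm (psiu E) Nu /\
          / C2 * Rpower (/ sqrt d) (1 - eps E) <= Nu /\ Nu <= C2 * / sqrt d) /\
       (exists Ns, is_C1_norm (psis E) Ns /\
          / C2 * Rpower (/ sqrt d) (1 - eps E) <= Ns /\ Ns <= C2 * / sqrt d)).
Proof.
  intros w kappa tau Hdio v v1 v2 tmin Hper HC2 Hmin Hnd.
  destruct (potential_exists v v1 v2 tmin Hper HC2 Hmin Hnd) as [Av [A1 [A2 [cv [rv [c0 Hpot]]]]]].
  destruct (small_divisor_product w kappa tau Hdio) as [cw [Hcw Hprod]].
  destruct (dioph_scale w kappa tau Hdio) as [k0 Hk0].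
  destruct (pot_pos _ _ _ _ _ _ _ _ _ _ Hpot) as [P1 [P2 [P3 [P4 [P5 P6]]]]].
  destruct (strong_coupling_exists c0 cv rv (2 * Av + 3) A1 A2 cw k0) as [c1 [Lam0 [HL0 Hsc]]]; auto; [lra|].
  (* [Lam0] is a threshold for the squared coupling; as it is at least 1, [lam > Lam0] implies
     [lam^2 > Lam0]. *)
  exists Lam0. split; [lra|]. intros lam Hlam E0 HE0 psiu psis Hpsi.
  apply (model_conclusion w kappa tau v v1 v2 tmin Av A1 A2 cv rv c0 cw k0 c1 lam E0 psiu psis); auto.
  apply Hsc. simpl. nra.
Qed.
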